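(* For every planar convex body $K\subset\mathbb R^2$, $$\mathbb E|X_1-X_2|\le \mathbb E|B_1-B_2|,$$ where $X_1,X_2$ are independent and uniform in $K$, and $B_1,B_2$ are independent and uniform on $\partial K$.
   Context: A convex body is a compact convex set with nonempty interior. Uniform in $K$ means distributed according to normalized Lebesgue (area) measure on $K$; uniform on $\partial K$ means distributed according to normalized arclength measure on $\partial K$. $|\cdot|$ is the Euclidean norm. *)

(* Defs.v *)
From HB Require Import structures.
From mathcomp Require Import all_boot all_order all_algebra.
From mathcomp Require Import all_classical all_reals all_analysis.

Set Implicit Arguments.
Unset Strict Implicit.
Unset Printing Implicit Defensive.

Import Order.TTheory GRing.Theory Num.Theory.
Import numFieldNormedType.Exports.

Local Open Scope classical_set_scope.
Local Open Scope ring_scope.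

(* [R^o] rather than [R]: it is [R^o * R^o] that carries the [lmodType R]
   structure required by [convex_set]. Topology and Borel sigma-algebra are the
   product ones. *)
Notation plane R := (R^o * R^o)%type.

(* The library norm `|x| on a product is the sup norm, hence this definition. *)
Definition eucl_norm (R : realType) (x : plane R) : R :=
  Num.sqrt (x.1 ^+ 2 + x.2 ^+ 2).

Definition eucl_dist (R : realType) (x y : plane R) : R := eucl_norm (x - y).

Definition convex_body (R : realType) (K : set (plane R)) : Prop :=
  [/\ compact K, convex_set K & interior K !=set0].

Definition boundary (T : topologicalType) (A : set T) : set T :=
  closure A `\` interior A.

Definition area (R : realType) : set (plane R) -> \bar R :=
  (@lebesgue_measure R \x @lebesgue_measure R)%E.

(* Euclidean diameter; [0] is added to the set so that [diam set0 = 0]. *)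
Definition diam (R : realType) (E : set (plane R)) : \bar R :=
  ereal_sup (0%E |` [set (eucl_dist x y)%:E | x in E & y in E]).

Definition hausdorff1_pre (R : realType) (delta : R) (A : set (plane R)) :
    \bar R :=
  ereal_inf [set (\sum_(0 <= i <oo) diam (E i))%E | E in
    [set E : nat -> set (plane R) |
      A `<=` \bigcup_i E i /\ forall i, (diam (E i) <= delta%:E)%E]].

(* Arclength is the one-dimensional Hausdorff measure. With covers weighted by
   their diameters, a segment has measure its length, so that no normalizing
   constant is needed. *)
Definition arclength (R : realType) (A : set (plane R)) : \bar R :=
  ereal_sup [set hausdorff1_pre delta A | delta in [set delta : R | 0 < delta]].

Definition uniform_on (R : realType) (m : set (plane R) -> \bar R)
    (S : set (plane R)) (d : measure_display) (T : measurableType d)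
    (P : probability T R) (X : {RV P >-> plane R}) : Prop :=
  forall A : set (plane R), measurable A ->
    distribution P X A = (m (A `&` S) / m S)%E.

Definition independent_RV (R : realType) (d d' : measure_display)
    (T : measurableType d) (T' : measurableType d') (P : probability T R)
    (X Y : {RV P >-> T'}) : Prop :=
  forall A B : set T', measurable A -> measurable B ->
    P (X @^-1` A `&` Y @^-1` B) = (P (X @^-1` A) * P (Y @^-1` B))%E.

(* Main.v *)
Require Import Defs.
From HB Require Import structures.
From mathcomp Require Import all_boot all_order all_algebra.
From mathcomp Require Import all_classical all_reals all_analysis.
From mathcomp Require Import measurable_realfun.
From mathcomp Require Import ring lra.

Import Order.TTheory GRing.Theory Num.Theory.
Import numFieldNormedType.Exports.

Local Open Scope classical_set_scope.
Local Open Scope ring_scope.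

Set Implicit Arguments.
Unset Strict Implicit.
Unset Printing Implicit Defensive.

(** Distances are compared through their projections. The integral of [|<z, y>|]
    over the unit disc is proportional to the Euclidean norm of [z], because
    rotations preserve area ([integral_disc_dot]). By Tonelli it suffices to
    prove, for every direction, that the mean distance between the projections
    of two points uniform in [K] is at most that of two points uniform on the
    boundary ([projection_le]); after a rotation the direction is the first axis
    ([abscissa_le]).

    On a line, two independent variables with common distribution function [F]
    are at mean distance the integral of [2 * F * (1 - F)] ([mean_distance_cdf]).
    Write [K] as the region between a convex and a concave graph over [[m, M]],
    with chord length [C x] at abscissa [x] and perimeter [L]. The abscissa of a
    uniform point of [K] has density proportional to [C]. For a uniform boundary
    point let [r x] be the probability of an abscissa at most [x], minus
    [C x / L]. This excess [r] is convex ([excess_convex]): a segment of slope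
    [s] has length [sqrt (1 + s ^+ 2)] per unit of run, hence an excess
    [sqrt (1 + s ^+ 2) - s] over its rise, which is decreasing in [s], while the
    slopes of a concave arc decrease. The comparison of lengths uses only finite
    covers of the arc to the left of a point, and the projection of the arc to
    its right onto a supporting line, so that no arclength formula is required.
    Moreover [r m = 0], [r >= 0] and [r M <= 1]. The excess [l] obtained by
    counting from the right has the same properties for the reflected body, and
    [l + r = 1 - 2 * C / L], [l - r = 1 - 2 * F] inside [(m, M)].

    With [[m, M]] rescaled to [[0, 1]], let [q x = x - r x], and let [p x] be the
    same for the reflected body. Both are concave and lie between 0 and [x];
    their sum [w x = q x + p (1 - x)] is the density of the uniform point of [K]
    up to a factor, and [e x = 1 - 2 * x + q x - p (1 - x)] is [1 - 2 * F x]. The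
    mean distance on the boundary is then [(1 - \int e ^+ 2) / 2], and integrating
    [(G x - x) ^+ 2 >= 0] for the distribution function [G] of the density [w]
    bounds the mean distance in the body by
    [2 / 3 - 2 * \int x * (1 - x) * w / \int w] ([mean_distance_density_le]).
    What remains is the inequality [spread_le],
    [(\int w) * (1 / 3 + \int e ^+ 2) <= 4 * \int x * (1 - x) * w].
    It is a polynomial inequality in the first three moments of [p] and [q],
    the integrals of their squares and the integral of the product
    [q x * p (1 - x)] ([moment_inequality]), once these quantities are related by
    sharp estimates for concave functions below the diagonal: [mom1_ge],
    [mom2_le], [concave01_ge] and Berwald's inequality [J_sqr_le]. *)

(** * Integrals over subintervals of the unit interval *)

Section integral_unit_interval.
Context {R : realType}.
Implicit Types f g : R -> R.

(** Integrals are taken with values in [R] rather than in [\bar R], for [ring]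
    and [lra] to apply to them. *)
Definition J (a b : R) f : R := \int[@lebesgue_measure R]_(x in `]a, b[) f x.

Definition bmeas f : Prop :=
  measurable_fun setT f /\ exists M : R, forall x : R, 0 < x < 1 -> `|f x| <= M.

Lemma bmeasD f g : bmeas f -> bmeas g -> bmeas (fun x => f x + g x).
Proof.
move=> [mf [M hM]] [mg [N hN]]; split; first exact: measurable_funD.
by exists (M + N) => x hx; rewrite (le_trans (ler_normD _ _))// lerD// ?hM ?hN.
Qed.

Lemma bmeasM f g : bmeas f -> bmeas g -> bmeas (fun x => f x * g x).
Proof.
move=> [mf [M hM]] [mg [N hN]]; split; first exact: measurable_funM.
by exists (M * N) => x hx; rewrite normrM ler_pM// ?hM ?hN.
Qed.

Lemma bmeas_cst k : bmeas (fun=> k).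
Proof. by split; [exact: measurable_cst|exists `|k|]. Qed.

Lemma bmeas_id : bmeas (fun x => x).
Proof.
split; first exact: measurable_id.
by exists 1 => x /andP[x0 x1]; rewrite ger0_norm ltW.
Qed.

Lemma bmeasB f g : bmeas f -> bmeas g -> bmeas (fun x => f x - g x).
Proof.
move=> hf hg.
rewrite (_ : (fun _ => _) = (fun x => f x + (-1) * g x)); last first.
  by apply/funext => x; rewrite mulN1r.
by apply: bmeasD => //; apply: bmeasM => //; exact: bmeas_cst.
Qed.

Lemma bmeasX f n : bmeas f -> bmeas (fun x => f x ^+ n).
Proof.
move=> hf; elim: n => [|n ih]; first exact: bmeas_cst.
rewrite (_ : (fun _ => _) = (fun x => f x * f x ^+ n)); first exact: bmeasM.
by apply/funext => x; rewrite exprS.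
Qed.

Lemma bmeas_integrable f (a b : R) : bmeas f -> 0 <= a -> b <= 1 ->
  (@lebesgue_measure R).-integrable `]a, b[ (EFin \o f).
Proof.
move=> [mf [M hM]] a0 b1; apply: measurable_bounded_integrable => //.
- by rewrite /= lebesgue_measure_itv/=; case: ifPn => // _; rewrite -EFinB ltry.
- exact: measurable_funTS.
- exists M; split; rewrite ?num_real// => N MN x /=; rewrite in_itv/= => /andP[ax xb].
  apply: le_trans (ltW MN); apply: hM.
  by rewrite (le_lt_trans a0 ax) (lt_le_trans xb b1).
Qed.

Section within.
Variables (a b : R).
Hypotheses (a0 : 0 <= a) (b1 : b <= 1).

Lemma JD f g : bmeas f -> bmeas g ->
  J a b (fun x => f x + g x) = J a b f + J a b g.
Proof. by move=> hf hg; apply: RintegralD => //; exact: bmeas_integrable. Qed.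

Lemma JZ f k : bmeas f -> J a b (fun x => k * f x) = k * J a b f.
Proof. by move=> hf; apply: RintegralZl => //; exact: bmeas_integrable. Qed.

Lemma JB f g : bmeas f -> bmeas g ->
  J a b (fun x => f x - g x) = J a b f - J a b g.
Proof. by move=> hf hg; apply: RintegralB => //; exact: bmeas_integrable. Qed.

Lemma le_J f g : bmeas f -> bmeas g ->
  (forall x, a < x < b -> f x <= g x) -> J a b f <= J a b g.
Proof.
move=> hf hg fg.
have := bmeas_integrable hf a0 b1; have := bmeas_integrable hg a0 b1 => ig i_f.
exact: le_Rintegral.
Qed.

Lemma eq_J f g : (forall x, a < x < b -> f x = g x) -> J a b f = J a b g.
Proof.
move=> fg; apply: eq_Rintegral => x; rewrite inE/= in_itv/=; exact: fg.
Qed.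

End within.

Lemma J_split f a b c : bmeas f -> 0 <= a -> a <= b -> b <= c -> c <= 1 ->
  J a c f = J a b f + J b c f.
Proof.
move=> hf a0 ab bc c1; have ii := bmeas_integrable hf.
have := ab; rewrite le_eqVlt => /predU1P[->|ab'].
  by rewrite [J b b f]/J set_itv_ge ?bnd_simp ?ltxx// Rintegral_set0 add0r.
have := bc; rewrite le_eqVlt => /predU1P[->|bc'].
  by rewrite [J c c f]/J set_itv_ge ?bnd_simp ?ltxx// Rintegral_set0 addr0.
have := @Rintegral_itvB R f (BRight a) (BLeft c) b (ii _ _ a0 c1).
rewrite !bnd_simp => /(_ (ltW ab') bc').
rewrite -Rintegral_itv_bndo_bndc => [h|]; last exact: ii a0 (le_trans bc c1).
by rewrite /J -h addrC subrK.
Qed.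

(** All the comparison functions of the one-dimensional part are piecewise
    polynomials of degree at most three. *)
Lemma J_cubic a b (k0 k1 k2 k3 : R) : a <= b ->
  let F t := k0 * t + k1 / 2 * t ^+ 2 + k2 / 3 * t ^+ 3 + k3 / 4 * t ^+ 4 in
  J a b (fun t => k0 + k1 * t + k2 * t ^+ 2 + k3 * t ^+ 3) = F b - F a.
Proof.
move=> + F; rewrite le_eqVlt => /predU1P[->|ab].
  by rewrite [LHS]/J set_itv_ge ?bnd_simp ?ltxx// Rintegral_set0 subrr.
set f := (X in J a b X).
have dF (x : R) : is_derive x (1 : R) F (f x).
  rewrite /F /f; apply: is_derive_eq.
  by rewrite /GRing.scale /=; field.
have cF : continuous F.
  move=> x; apply: differentiable_continuous.
  by apply/derivable1_diffP; exact: (@ex_derive _ _ _ _ _ _ _ (dF x)).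
have cf : continuous f.
  have df x : derivable f x 1 by rewrite /f; exact: ex_derive.
  by move=> x; apply: differentiable_continuous; apply/derivable1_diffP; exact: df.
have E : (\int[lebesgue_measure]_(x in `[a, b]) (f x)%:E)%E = ((F b)%:E - (F a)%:E)%E.
  apply: continuous_FTC2 => //.
  - exact: continuous_subspaceT.
  - split.
    + by move=> x _; exact: (@ex_derive _ _ _ _ _ _ _ (dF x)).
    + exact/cvg_at_right_filter/cF.
    + exact/cvg_at_left_filter/cF.
  - by move=> x _; rewrite derive1E; exact: derive_val.
rewrite /J /Rintegral.
have mf : measurable_fun setT (EFin \o f).
  by apply/measurable_EFinP; exact: continuous_measurable_fun.
rewrite integral_itv_obnd_cbnd; last exact: measurable_funTS.
rewrite integral_itv_bndo_bndc; last exact: measurable_funTS.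
by rewrite E.
Qed.

End integral_unit_interval.

(** * Moment inequalities for concave functions on the unit interval *)

Section concave_unit_interval.
Context {R : realType}.
Implicit Types p q : R -> R.

Definition concave01 q : Prop := forall x y z, 0 <= x -> x <= y -> y <= z ->
  z <= 1 -> (z - y) * q x + (y - x) * q z <= (z - x) * q y.

(** Concave functions below the diagonal; they vanish at [0]. The deficits
    [x - r x] of convex functions [r] with [r 0 = 0] and [r 1 <= 1] are of this
    kind. *)
Definition subdiag q : Prop :=
  [/\ bmeas q, concave01 q & forall x, 0 <= x <= 1 -> 0 <= q x <= x].

Definition mom (n : nat) q : R := J 0 1 (fun x => x ^+ n * q x).

Lemma bmeas_mom n q : bmeas q -> bmeas (fun x => x ^+ n * q x).
Proof. by move=> bq; apply: bmeasM => //; apply: bmeasX; exact: bmeas_id. Qed.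

Lemma bmeas_cubic (k0 k1 k2 k3 : R) :
  bmeas (fun t : R => k0 + k1 * t + k2 * t ^+ 2 + k3 * t ^+ 3).
Proof.
have m k n : bmeas (fun t : R => k * t ^+ n).
  by apply: bmeasM; [exact: bmeas_cst|apply: bmeasX; exact: bmeas_id].
have m1 : bmeas (fun t : R => k1 * t) by apply: bmeasM; [exact: bmeas_cst|exact: bmeas_id].
by do 3 (apply: bmeasD => //); exact: bmeas_cst.
Qed.

Lemma mom_quadratic q (k0 k1 k2 : R) : bmeas q ->
  J 0 1 (fun x => (k0 + k1 * x + k2 * x ^+ 2) * q x) =
  k0 * mom 0 q + k1 * mom 1 q + k2 * mom 2 q.
Proof.
move=> bq; rewrite /mom -!JZ//; try exact: bmeas_mom.
have b n k : bmeas (fun x => k * (x ^+ n * q x)).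
  by apply: bmeasM; [exact: bmeas_cst|exact: bmeas_mom].
rewrite -!JD//; last exact: bmeasD.
by apply: eq_J => x _; ring.
Qed.

(** The bound is stated through the primitive of the cubic minorant, so that
    what remains after its use is arithmetic in the endpoints. *)
Lemma cubic_le_J (a b k0 k1 k2 k3 : R) f : 0 <= a -> a <= b -> b <= 1 ->
  bmeas f ->
  (forall t, a < t < b -> k0 + k1 * t + k2 * t ^+ 2 + k3 * t ^+ 3 <= f t) ->
  (k0 * b + k1 / 2 * b ^+ 2 + k2 / 3 * b ^+ 3 + k3 / 4 * b ^+ 4) -
  (k0 * a + k1 / 2 * a ^+ 2 + k2 / 3 * a ^+ 3 + k3 / 4 * a ^+ 4) <= J a b f.
Proof.
move=> a0 ab b1 bf h; have /= <- := J_cubic k0 k1 k2 k3 ab.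
by apply: le_J => //; exact: bmeas_cubic.
Qed.

Section facts.
Variable q : R -> R.
Hypothesis sq : subdiag q.
Let bq : bmeas q. Proof. by case: sq. Qed.
Let cq : concave01 q. Proof. by case: sq. Qed.
Let q0 x : 0 <= x <= 1 -> 0 <= q x. Proof. by case: sq => _ _ h /h /andP[]. Qed.
Let qx x : 0 <= x <= 1 -> q x <= x. Proof. by case: sq => _ _ h /h /andP[]. Qed.

Lemma mom0_ge0 : 0 <= mom 0 q.
Proof.
have := @cubic_le_J 0 1 0 0 0 0 (fun x => x ^+ 0 * q x) _ _ _ _ _.
rewrite /mom => /(_ (lexx _) ler01 (lexx _) (bmeas_mom 0 bq)) h.
have {h} : 0 - 0 <= J 0 1 (fun x => x ^+ 0 * q x).
  apply: le_trans (h _); first by lra.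
  by move=> t /andP[t0 t1]; have := @q0 t; rewrite expr0; lra.
by rewrite subr0.
Qed.

Lemma mom0_le : mom 0 q <= 1 / 2.
Proof.
have bn : bmeas (fun x => - 1 * (x ^+ 0 * q x)).
  by apply: bmeasM; [exact: bmeas_cst|exact: bmeas_mom].
have := @cubic_le_J 0 1 0 (-1) 0 0 _ (lexx _) ler01 (lexx _) bn.
rewrite JZ//; last exact: bmeas_mom.
rewrite -/(mom 0 q) => h.
suff : (-1/2 : R) <= -1 * mom 0 q by lra.
apply: le_trans (h _); first by lra.
by move=> t /andP[t0 t1]; have := @qx t; rewrite expr0; lra.
Qed.

(** Let [c] be twice the integral of [q]. The comparison function is the diagonal on [[0, c]] and, on [[c, 1]], the
    line through the point of the graph at [xc] that vanishes at [1]; it lies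
    above [q] where [t - xc <= 0] and below [q] where [t - xc >= 0]. The weight
    [t - xc] is orthogonal to [1 - t] on [[c, 1]], which determines [xc] and
    makes the slope of that line irrelevant. *)
Lemma mom1_ge : 3 * mom 1 q >= mom 0 q + 2 * mom 0 q ^+ 2.
Proof.
set A := mom 0 q; pose c := 2 * A; pose xc := (1 + 2 * c) / 3.
have A0 : 0 <= A := mom0_ge0.
have A1 : A <= 1 / 2 := mom0_le.
have c0 : 0 <= c by rewrite /c; lra.
have c1 : c <= 1 by rewrite /c; lra.
have xcc : c <= xc by rewrite /xc; lra.
have xc1 : xc <= 1 by rewrite /xc; lra.
have xc0 : 0 <= xc by lra.
pose f t := (- xc + 1 * t + 0 * t ^+ 2) * q t.
have bf : bmeas f.
  apply: bmeasM => //; have := bmeas_cubic (- xc) 1 0 0.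
  by congr bmeas; apply/funext => t; ring.
have fE : J 0 1 f = - xc * A + mom 1 q by rewrite mom_quadratic// -/A; ring.
have I1 : - xc * c ^+ 2 / 2 + c ^+ 3 / 3 <= J 0 c f.
  have := @cubic_le_J 0 c 0 (- xc) 1 0 f (lexx _) c0 c1 bf.
  move=> h; apply: le_trans (h _); first by lra.
  move=> t /andP[t0 tc]; have := @qx t; rewrite /f => hq.
  have {hq}: q t <= t by apply: hq; lra.
  by move=> hq; nra.
have I2 : 0 <= J c 1 f.
  pose k := q xc / (1 - xc).
  have [c1'|c1'] := eqVneq c 1.
    by rewrite c1' /J set_itv_ge ?bnd_simp ?ltxx// Rintegral_set0.
  have xc1' : xc < 1 by rewrite /xc; move/eqP : c1'; lra.
  have kE : q xc = k * (1 - xc) by rewrite /k divfK//; lra.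
  have := @cubic_le_J c 1 (- k * xc) (k * (1 + xc)) (- k) 0 f c0 c1 (lexx _) bf.
  move=> h; apply: le_trans (h _).
    by rewrite le_eqVlt; apply/orP; left; apply/eqP; rewrite /xc; field.
  move=> t /andP[ct t1]; rewrite /f.
  have [txc|xct] := leP t xc.
    have : q t <= k * (1 - t).
      have := @cq t xc 1; rewrite kE.
      have := @q0 1; nra.
    by nra.
  have : k * (1 - t) <= q t.
    have := @cq xc t 1; rewrite kE.
    have := @q0 1; nra.
  by nra.
have JE := J_split bf (lexx _) c0 c1 (lexx _).
move: JE; rewrite fE => JE.
have : - xc * c ^+ 2 / 2 + c ^+ 3 / 3 <= - xc * A + mom 1 q by rewrite JE; lra.
rewrite /xc /c; lra.
Qed.

End facts.
End concave_unit_interval.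

Section quadratic_moment.
Context {R : realType}.
Variable q : R -> R.
Hypothesis sq : subdiag q.
Let bq : bmeas q. Proof. by case: sq. Qed.
Let cq : concave01 q. Proof. by case: sq. Qed.
Let q0 x : 0 <= x <= 1 -> 0 <= q x. Proof. by case: sq => _ _ h /h /andP[]. Qed.
Let qx x : 0 <= x <= 1 -> q x <= x. Proof. by case: sq => _ _ h /h /andP[]. Qed.

(** The weight is, up to a factor, the second Legendre polynomial of [[c, 1]]:
    it is orthogonal to affine functions there, so that the chord of [q] through
    its two roots may be subtracted, which leaves a product of constant sign.
    On [[0, c]], where the weight is negative, [q] is at most the diagonal. *)
Lemma mom2_le (c : R) : 0 <= c <= 1 ->
  12 * mom 2 q <= (12 + 12 * c) * mom 1 q
                  - (2 + 8 * c + 2 * c ^+ 2) * mom 0 q + c ^+ 2.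
Proof.
move=> /andP[c0 c1].
pose w := 2 + 8 * c + 2 * c ^+ 2.
pose f t := (- w + (12 + 12 * c) * t + (- 12) * t ^+ 2) * q t.
have bf : bmeas f.
  apply: bmeasM => //; have := bmeas_cubic (- w) (12 + 12 * c) (- 12) 0.
  by congr bmeas; apply/funext => t; ring.
have fE : J 0 1 f = - w * mom 0 q + (12 + 12 * c) * mom 1 q + (- 12) * mom 2 q.
  by rewrite mom_quadratic.
(* [x1] and [x2] are the two nodes of Gauss quadrature on [[c, 1]]. *)
pose r : R := Num.sqrt (1 / 3).
have r2 : r ^+ 2 = 1 / 3 by rewrite sqr_sqrtr//; lra.
have r0 : 0 < r by rewrite sqrtr_gt0; lra.
have r1 : r < 1 by nra.
pose x1 := (1 + c) / 2 - (1 - c) * r / 2.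
pose x2 := (1 + c) / 2 + (1 - c) * r / 2.
have WE t : - w + (12 + 12 * c) * t + (- 12) * t ^+ 2 = - 12 * (t - x1) * (t - x2).
  rewrite /w /x1 /x2.
  have -> : - 12 * (t - ((1 + c) / 2 - (1 - c) * r / 2)) *
    (t - ((1 + c) / 2 + (1 - c) * r / 2)) =
    - 12 * t ^+ 2 + (12 + 12 * c) * t - 3 * ((1 + c) ^+ 2 - (1 - c) ^+ 2 * r ^+ 2).
    by field.
  by rewrite r2; field.
have cx1 : c <= x1 by rewrite /x1; nra.
have x12 : x1 <= x2 by rewrite /x1 /x2; nra.
have x21 : x2 <= 1 by rewrite /x2; nra.
have I1 : - w * c ^+ 2 / 2 + (12 + 12 * c) / 3 * c ^+ 3 - 3 * c ^+ 4 <= J 0 c f.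
  have := @cubic_le_J _ 0 c 0 (- w) (12 + 12 * c) (- 12) f (lexx _) c0 c1 bf.
  move=> h; apply: le_trans (h _); first by lra.
  move=> t /andP[t0 tc]; have := @qx t; rewrite /f => hq.
  have {}hq : q t <= t by apply: hq; lra.
  have -> : 0 + (- w) * t + (12 + 12 * c) * t ^+ 2 + (- 12) * t ^+ 3 =
            (- w + (12 + 12 * c) * t + (- 12) * t ^+ 2) * t by ring.
  rewrite WE.
  have h0 : 0 <= (x1 - t) * (x2 - t) by apply: mulr_ge0; lra.
  have : 0 <= (x1 - t) * (x2 - t) * (t - q t) by apply: mulr_ge0; lra.
  lra.
have I2 : 0 <= J c 1 f.
  have [c1'|c1'] := eqVneq c 1.
    by rewrite c1' /J set_itv_ge ?bnd_simp ?ltxx// Rintegral_set0.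
  have {c1'}c1' : c < 1 by move/eqP : c1'; lra.
  have x12' : x1 < x2 by rewrite /x1 /x2; nra.
  pose b := (q x2 - q x1) / (x2 - x1); pose a := q x1 - b * x1.
  have q1E : q x1 = a + b * x1 by rewrite /a; ring.
  have q2E : q x2 = a + b * x2.
    by rewrite /a /b; field; lra.
  have := @cubic_le_J _ c 1 (- a * w) ((12 + 12 * c) * a - b * w)
    (- 12 * a + (12 + 12 * c) * b) (- 12 * b) f c0 c1 (lexx _) bf.
  move=> h; apply: le_trans (h _).
    by rewrite le_eqVlt; apply/orP; left; apply/eqP; rewrite /w; field.
  move=> t /andP[ct t1]; rewrite /f.
  rewrite [leLHS](_ : _ =
    (- w + (12 + 12 * c) * t + (- 12) * t ^+ 2) * (a + b * t)); last by ring.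
  rewrite WE.
  suff : 0 <= (t - x1) * (t - x2) * (a + b * t - q t) by lra.
  have x120 : 0 < x2 - x1 by lra.
  have [tx1|x1t] := leP t x1.
    have : q t <= a + b * t.
      have := @cq t x1 x2; rewrite q1E q2E; nra.
    by move=> ?; rewrite mulr_ge0// ?subr_ge0// mulr_le0//; lra.
  have [tx2|x2t] := leP t x2.
    have : a + b * t <= q t.
      have := @cq x1 t x2; rewrite q1E q2E; nra.
    by move=> ?; rewrite mulr_le0// ?subr_le0// mulr_ge0_le0//; lra.
  have : q t <= a + b * t.
    have := @cq x1 x2 t; rewrite q1E q2E; nra.
  by move=> ?; rewrite mulr_ge0// ?subr_ge0// mulr_ge0//; lra.
have JE := J_split bf (lexx _) c0 c1 (lexx _).
move: JE; rewrite fE => JE.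
have : - w * c ^+ 2 / 2 + (12 + 12 * c) / 3 * c ^+ 3 - 3 * c ^+ 4 <=
  - w * mom 0 q + (12 + 12 * c) * mom 1 q + (- 12) * mom 2 q by rewrite JE; lra.
rewrite /w; lra.
Qed.

(** The chords from [t] to the endpoints, where [q] is nonnegative, bound [q s] by
    [q t * (s / t + (1 - s) / (1 - t))], and the integral of this bound over [s]
    is [q t / (2 * t * (1 - t))]. *)
Lemma concave01_ge t : 0 <= t <= 1 -> 2 * mom 0 q * (t * (1 - t)) <= q t.
Proof.
move=> /andP[t0 t1].
have [->|tn0] := eqVneq t 0; first by rewrite mul0r mulr0 q0//; lra.
have [->|tn1] := eqVneq t 1; first by rewrite subrr !mulr0 q0//; lra.
have {tn0}t0 : 0 < t by rewrite lt_neqAle eq_sym tn0.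
have {tn1}t1 : t < 1 by rewrite lt_neqAle tn1.
pose k := q t.
have k0 : 0 <= k by apply: q0; lra.
have bn : bmeas (fun x => - (t * (1 - t)) * (x ^+ 0 * q x)).
  by apply: bmeasM; [exact: bmeas_cst|exact: bmeas_mom].
have := @cubic_le_J _ 0 1 (- (k * t)) (- (k * (1 - t) - k * t)) 0 0 _ (lexx _) ler01 (lexx _) bn.
rewrite JZ//; last exact: bmeas_mom.
rewrite -/(mom 0 q) => h.
suff : - (k / 2) <= - (t * (1 - t)) * mom 0 q by rewrite /k; lra.
apply: le_trans (h _); first by lra.
move=> s /andP[s0 s1]; rewrite expr0 mul1r.
have hs0 : 0 <= q s by apply: q0; lra.
have t1' : 0 <= 1 - t by lra.
have [st|ts] := leP s t.
  have h1 := @cq s t 1 (ltW s0) st (ltW t1) (lexx _).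
  have h2 : 0 <= (t - s) * q 1 by apply: mulr_ge0; [lra|apply: q0; lra].
  have h3 : 0 <= t * ((1 - s) * k - (1 - t) * q s) by apply: mulr_ge0; rewrite /k; lra.
  have h4 : 0 <= k * ((1 - t) * s) by rewrite !mulr_ge0//; lra.
  lra.
have h1 := @cq 0 t s (lexx _) (ltW t0) (ltW ts) (ltW s1).
have h2 : 0 <= (s - t) * q 0 by apply: mulr_ge0; [lra|apply: q0; lra].
have h3 : 0 <= (1 - t) * (s * k - t * q s) by apply: mulr_ge0; rewrite /k; lra.
have h4 : 0 <= k * (t * (1 - s)) by rewrite !mulr_ge0//; lra.
lra.
Qed.

End quadratic_moment.

Section swap.
Context {R : realType}.
Local Notation mu := (@lebesgue_measure R).

Lemma EFin_J (f : R -> R) (a b : R) : bmeas f -> 0 <= a -> b <= 1 ->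
  ((J a b f)%:E = \int[mu]_(x in `]a, b[) (f x)%:E)%E.
Proof.
move=> bf a0 b1; rewrite /J /Rintegral fineK//.
exact: (integrable_fin_num _ (bmeas_integrable bf a0 b1)).
Qed.

Lemma bmeas_J (F : R -> R -> R) (M : R) :
  measurable_fun setT (fun z : R * R => F z.1 z.2) ->
  (forall x t, 0 <= F x t) ->
  (forall x t, 0 < x < 1 -> 0 < t < 1 -> F x t <= M) ->
  (forall x, 0 < x < 1 -> bmeas (F x)) /\ bmeas (fun x => J 0 1 (F x)).
Proof.
move=> mF F0 FM.
have bF x : 0 < x < 1 -> bmeas (F x).
  move=> x01; split; first exact: (measurable_fun_pair2 x mF).
  by exists M => t t01; rewrite ger0_norm ?F0 ?FM.
split => //; split.
  pose G (z : R * R) : \bar R := (F z.1 z.2 * \1_(`]0, 1[) z.2)%:E.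
  have mG : measurable_fun setT G.
    apply/measurable_EFinP; apply: measurable_funM; first exact: mF.
    by apply: measurableT_comp => //; exact: measurable_indic.
  have G0 z : (0 <= G z)%E by rewrite lee_fin mulr_ge0.
  have := @measurable_fun_fubini_tonelli_F _ _ _ _ R mu G mG G0.
  move=> /(measurableT_comp (@fine_measurable R setT measurableT)).
  congr measurable_fun; apply/funext => x /=; rewrite /fubini_F /J /Rintegral.
  congr fine; rewrite [RHS]integral_mkcond; apply: eq_integral => t _.
  rewrite /G patchE indicE /=.
  by case: ifPn => _; rewrite ?mulr1 ?mulr0.
exists M => x x01; rewrite ger0_norm; last exact: Rintegral_ge0.
have -> : M = J 0 1 (fun=> M).
  by rewrite /J Rintegral_cst//= lebesgue_measure_itv/= lte_fin ltr01 -EFinB subr0 mulr1.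
by apply: le_J => //; [exact: bF|exact: bmeas_cst|move=> t t01; exact: FM].
Qed.

Lemma J_swap (F : R -> R -> R) (M : R) :
  measurable_fun setT (fun z : R * R => F z.1 z.2) ->
  (forall x t, 0 <= F x t) ->
  (forall x t, 0 < x < 1 -> 0 < t < 1 -> F x t <= M) ->
  J 0 1 (fun x => J 0 1 (F x)) = J 0 1 (fun t => J 0 1 (F ^~ t)).
Proof.
move=> mF F0 FM; have [bF bJ] := bmeas_J mF F0 FM.
have mF' : measurable_fun setT (fun z : R * R => F z.2 z.1).
  have -> : (fun z : R * R => F z.2 z.1) = (fun z => F z.1 z.2) \o (fun z => (z.2, z.1)) by [].
  apply: measurableT_comp => //; apply: measurable_fun_pair.
    exact: measurable_snd.
  exact: measurable_fst.
have [bF' bJ'] := @bmeas_J (fun t x => F x t) M mF' (fun _ _ => F0 _ _)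
  (fun _ _ h1 h2 => FM _ _ h2 h1).
apply: EFin_inj; rewrite !EFin_J//.
pose G (z : R * R) : \bar R :=
  (F z.1 z.2 * (\1_(`]0, 1[) z.1 * \1_(`]0, 1[) z.2))%:E.
have mG : measurable_fun setT G.
  apply/measurable_EFinP; apply: measurable_funM; first exact: mF.
  apply: measurable_funM.
    by apply: measurableT_comp => //; exact: measurable_indic.
  by apply: measurableT_comp => //; exact: measurable_indic.
have G0 z : (0 <= G z)%E by rewrite lee_fin !mulr_ge0.
have in01 (x : R) : x \in (`]0, 1[%classic : set R) -> 0 < x < 1.
  by rewrite inE/= in_itv.
transitivity (\int[mu]_x \int[mu]_y G (x, y))%E.
  rewrite integral_mkcond; apply: eq_integral => x _; rewrite patchE.
  case: ifPn => [/in01 x01|xn]; last first.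
    rewrite integral0_eq// => y _; rewrite /G /= [\1__ x]indicE.
    by rewrite (negbTE xn) mul0r mulr0.
  rewrite EFin_J//; last exact: bF.
  rewrite integral_mkcond; apply: eq_integral => y _; rewrite patchE /G/=.
  rewrite !indicE [x \in _]mem_set ?mul1r//=.
  by case: ifPn => _; rewrite ?mulr1 ?mulr0.
rewrite fubini_tonelli//.
rewrite [RHS]integral_mkcond; apply: eq_integral => x _; rewrite patchE.
case: ifPn => [/in01 x01|xn]; last first.
  rewrite integral0_eq// => y _; rewrite /G /= [\1__ x]indicE.
  by rewrite (negbTE xn) !mulr0.
rewrite EFin_J//; last exact: bF'.
rewrite [RHS]integral_mkcond; apply: eq_integral => y _; rewrite patchE /G/=.
rewrite !indicE [x \in _]mem_set ?mulr1//=.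
by case: ifPn => _; rewrite ?mulr1 ?mulr0.
Qed.

End swap.

Section square_moment.
Context {R : realType}.
Variable q : R -> R.
Hypothesis sq : subdiag q.
Let bq : bmeas q. Proof. by case: sq. Qed.
Let cq : concave01 q. Proof. by case: sq. Qed.
Let q0 x : 0 <= x <= 1 -> 0 <= q x. Proof. by case: sq => _ _ h /h /andP[]. Qed.
Let qx x : 0 <= x <= 1 -> q x <= x. Proof. by case: sq => _ _ h /h /andP[]. Qed.

Let linear_J (a b k0 k1 : R) : a <= b ->
  J a b (fun t => k0 + k1 * t) = k0 * (b - a) + k1 / 2 * (b ^+ 2 - a ^+ 2).
Proof.
move=> ab; have /= := J_cubic k0 k1 0 0 ab.
rewrite (@eq_J _ a b _ (fun t => k0 + k1 * t)) => [->|x _]; last by ring.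
by field.
Qed.

Let bmeas_linear (k0 k1 : R) : bmeas (fun t => k0 + k1 * t).
Proof.
have := bmeas_cubic k0 k1 0 0; congr bmeas; apply/funext => t; ring.
Qed.

Let J_ge0 (a b : R) (f : R -> R) : 0 <= a -> b <= 1 -> bmeas f ->
  (forall x, a < x < b -> 0 <= f x) -> 0 <= J a b f.
Proof. by move=> a0 b1 bf h; apply: Rintegral_ge0 => x /=; rewrite in_itv/=; exact: h. Qed.

(** On either side of [u * z] the function [q] compares with the line through the
    origin and the point of its graph at [u * z]; for that line there is
    equality. *)
Lemma concave_mass_left (u z : R) : 0 <= u <= 1 -> 0 <= z <= 1 ->
  u ^+ 2 * J 0 z q <= J 0 (u * z) q.
Proof.
move=> /andP[u0 u1] /andP[z0 z1].
have uz0 : 0 <= u * z by rewrite mulr_ge0.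
have uzz : u * z <= z by rewrite ler_piMl.
have [e|e] := eqVneq (u * z) 0.
  rewrite e; have [->|zn0] := eqVneq z 0; first by rewrite ler_piMl ?exprn_ile1 ?J_ge0// => x; lra.
  move/eqP: e; rewrite mulf_eq0 (negbTE zn0) orbF => /eqP ->.
  by rewrite expr0n mul0r /= J_ge0// => x; lra.
have {e}uz : 0 < u * z by rewrite lt_neqAle eq_sym e.
pose k := q (u * z) / (u * z).
have kE : q (u * z) = k * (u * z) by rewrite /k divfK// gt_eqF.
have k0 : 0 <= k by rewrite divr_ge0// q0//; lra.
have h1 : k / 2 * (u * z) ^+ 2 <= J 0 (u * z) q.
  have <- : J 0 (u * z) (fun t => 0 + k * t) = k / 2 * (u * z) ^+ 2.
    by rewrite linear_J//; field.
  apply: le_J => //; first lra.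
  move=> x /andP[x0 xuz].
  have := @cq 0 x (u * z) (lexx _) (ltW x0) (ltW xuz) (le_trans uzz z1).
  have : 0 <= (u * z - x) * q 0 by rewrite mulr_ge0 ?q0//; lra.
  rewrite kE => h2 h3.
  suff : u * z * (k * x) <= u * z * q x by rewrite ler_pM2l// add0r.
  lra.
have h2 : J (u * z) z q <= k / 2 * (z ^+ 2 - (u * z) ^+ 2).
  have <- : J (u * z) z (fun t => 0 + k * t) = k / 2 * (z ^+ 2 - (u * z) ^+ 2).
    by rewrite linear_J//; field.
  apply: le_J => //.
  move=> x /andP[uzx xz].
  have := @cq 0 (u * z) x (lexx _) (ltW uz) (ltW uzx) _.
  have : 0 <= (x - u * z) * q 0 by rewrite mulr_ge0 ?q0//; lra.
  rewrite kE => h2 /(_ _) h3.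
  suff : u * z * q x <= u * z * (k * x) by rewrite ler_pM2l// add0r.
  have : x <= 1 by lra.
  by move=> /h3; lra.
rewrite (J_split bq (lexx _) uz0 uzz z1).
have uu : u ^+ 2 <= 1 by rewrite exprn_ile1.
have h3 : u ^+ 2 * J (u * z) z q <= u ^+ 2 * (k / 2 * (z ^+ 2 - (u * z) ^+ 2)).
  by rewrite ler_wpM2l// sqr_ge0.
have h4 : (1 - u ^+ 2) * (k / 2 * (u * z) ^+ 2) <= (1 - u ^+ 2) * J 0 (u * z) q.
  by rewrite ler_wpM2l//; lra.
lra.
Qed.

Lemma concave_mass_right (u z : R) : 0 <= u <= 1 -> 0 <= z <= 1 ->
  u ^+ 2 * J z 1 q <= J (1 - u * (1 - z)) 1 q.
Proof.
move=> /andP[u0 u1] /andP[z0 z1].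
pose y := 1 - u * (1 - z).
have uz0 : 0 <= u * (1 - z) by rewrite mulr_ge0//; lra.
have uzz : u * (1 - z) <= 1 - z by rewrite ler_piMl//; lra.
rewrite -/y.
have y1 : y <= 1 by rewrite /y; lra.
have zy : z <= y by rewrite /y; lra.
have y0 : 0 <= y by lra.
have [e|e] := eqVneq y 1.
  have [->|zn1] := eqVneq z 1; first by rewrite e ler_piMl ?exprn_ile1 ?J_ge0// => x; lra.
  have : u * (1 - z) == 0 by apply/eqP; move: e; rewrite /y; lra.
  rewrite mulf_eq0 subr_eq0 [1 == z]eq_sym (negbTE zn1) orbF => /eqP ->.
  by rewrite expr0n mul0r /= J_ge0// => x; lra.
have {e}y1' : y < 1 by rewrite lt_neqAle e.
pose k := q y / (1 - y).
have kE : q y = k * (1 - y) by rewrite /k divfK//; lra.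
have k0 : 0 <= k by rewrite divr_ge0// ?q0//; lra.
have h1 : k / 2 * (1 - y) ^+ 2 <= J y 1 q.
  have <- : J y 1 (fun t => k + (- k) * t) = k / 2 * (1 - y) ^+ 2.
    by rewrite linear_J//; field.
  apply: le_J => //.
  move=> x /andP[yx x1].
  have := @cq y x 1 y0 (ltW yx) (ltW x1) (lexx _).
  have : 0 <= (x - y) * q 1 by rewrite mulr_ge0 ?q0//; lra.
  rewrite kE => h2 h3.
  suff : (1 - y) * (k * (1 - x)) <= (1 - y) * q x by rewrite ler_pM2l; lra.
  lra.
have h2 : J z y q <= k / 2 * ((1 - z) ^+ 2 - (1 - y) ^+ 2).
  have <- : J z y (fun t => k + (- k) * t) = k / 2 * ((1 - z) ^+ 2 - (1 - y) ^+ 2).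
    by rewrite linear_J//; field.
  apply: le_J => //.
  move=> x /andP[zx xy].
  have x0 : 0 <= x by lra.
  have := @cq x y 1 x0 (ltW xy) y1 (lexx _).
  have : 0 <= (y - x) * q 1 by rewrite mulr_ge0 ?q0//; lra.
  rewrite kE => h2 h3.
  suff : (1 - y) * q x <= (1 - y) * (k * (1 - x)) by rewrite ler_pM2l; lra.
  lra.
rewrite (J_split bq z0 zy y1 (lexx _)).
have uu : u ^+ 2 <= 1 by rewrite exprn_ile1.
have h3 : u ^+ 2 * J z y q <= u ^+ 2 * (k / 2 * ((1 - z) ^+ 2 - (1 - y) ^+ 2)).
  by rewrite ler_wpM2l// sqr_ge0.
have h4 : (1 - u ^+ 2) * (k / 2 * (1 - y) ^+ 2) <= (1 - u ^+ 2) * J y 1 q.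
  by rewrite ler_wpM2l//; lra.
have yE : 1 - y = u * (1 - z) by rewrite /y; ring.
rewrite yE in h3 h4.
lra.
Qed.

Let A := J 0 1 q.

(** The complement of [[x1, x2]] is the union of the images of [[0, z]] and [[z, 1]]
    under the contractions of ratio [u] that fix [0] and [1], for
    [z = x1 / u]; it carries at least [u ^+ 2] times the total mass. *)
Lemma concave_mass_itv (x1 x2 u : R) : 0 <= x1 -> x1 <= x2 -> x2 <= 1 ->
  x2 - x1 = 1 - u -> J x1 x2 q <= A * (1 - u ^+ 2).
Proof.
move=> x10 x12 x21 ux.
have u0 : 0 <= u by lra.
have u1 : u <= 1 by lra.
have E : A = J 0 x1 q + J x1 x2 q + J x2 1 q.
  have x11 : x1 <= 1 by lra.
  have x20 : 0 <= x2 by lra.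
  by rewrite /A (J_split bq (lexx _) x20 x21 (lexx _)) (J_split bq (lexx _) x10 x12 x21).
have [e|e] := eqVneq u 0.
  have J1 : 0 <= J 0 x1 q by apply: J_ge0 => // [|x h]; [lra|apply: q0; lra].
  have J2 : 0 <= J x2 1 q by apply: J_ge0 => // [|x h]; [lra|apply: q0; lra].
  by rewrite e expr0n/= subr0 mulr1; lra.
have {e}u0' : 0 < u by rewrite lt_neqAle eq_sym e.
pose z := x1 / u.
have x1E : x1 = u * z by rewrite /z mulrC divfK// gt_eqF.
have z0 : 0 <= z by rewrite divr_ge0.
have z1 : z <= 1 by rewrite /z ler_pdivrMr//; lra.
have x2E : x2 = 1 - u * (1 - z) by lra.
have := @concave_mass_left u z; rewrite u0 u1 z0 z1 -x1E => /(_ isT isT) h1.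
have := @concave_mass_right u z; rewrite u0 u1 z0 z1 -x2E => /(_ isT isT) h2.
have E' : A = J 0 z q + J z 1 q by rewrite /A (J_split bq (lexx _) z0 z1 (lexx _)).
have : u ^+ 2 * A <= J 0 x1 q + J x2 1 q by rewrite E' mulrDr lerD.
lra.
Qed.

Let bmeas_excess t : bmeas (fun x => Num.max (q x - t) 0).
Proof.
case: (bq) => mq _; split.
  by apply: measurable_maxr => //; apply: measurable_funB.
exists (1 + `|t|) => x x01.
have := @q0 x; have := @qx x => h1 h2.
have {}h1 : q x <= x by apply: h1; lra.
have {}h2 : 0 <= q x by apply: h2; lra.
rewrite ger0_norm ?le_max ?lexx ?orbT// ge_max.
have := ler_norm (- t); rewrite normrN => ?.
by apply/andP; split; have := normr_ge0 t; lra.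
Qed.

(** The set where [q] exceeds [t] is an interval, of length [1 - u] say. *)
Lemma concave_excess t : exists2 u, 0 <= u <= 1 &
  J 0 1 (fun x => Num.max (q x - t) 0) <= A * (1 - u ^+ 2) - t * (1 - u).
Proof.
pose phi x := Num.max (q x - t) 0; rewrite -/phi.
have bphi : bmeas phi by exact: bmeas_excess.
pose E := [set x | 0 < x < 1 /\ t < q x].
have phi0 x : 0 < x < 1 -> ~ E x -> phi x = 0.
  move=> x01 nE; apply/max_idPr; rewrite subr_le0 leNgt; apply/negP => h.
  exact: nE.
have [E0|/set0P[e0 Ee0]] := eqVneq E set0.
  exists 1; first by rewrite ler01 lexx.
  rewrite expr1n subrr !mulr0 subr0 (@eq_J _ 0 1 _ (fun=> 0)).
    by rewrite /J Rintegral_cst// mul0r.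
  by move=> x x01; apply: phi0 => //; rewrite E0.
have lE : has_lbound E by exists 0 => x [/andP[/ltW]].
have uE : has_ubound E by exists 1 => x [/andP[_ /ltW]].
pose x1 := inf E; pose x2 := sup E.
have x10 : 0 <= x1 by apply: lb_le_inf; [exists e0|move=> x [/andP[/ltW]]].
have x21 : x2 <= 1 by apply: ge_sup; [exists e0|move=> x [/andP[_ /ltW]]].
have x12 : x1 <= x2 by apply: le_trans (ub_le_sup uE Ee0); exact: ge_inf.
exists (1 - (x2 - x1)); first by apply/andP; split; lra.
have Jm : J x1 x2 q <= A * (1 - (1 - (x2 - x1)) ^+ 2).
  by apply: concave_mass_itv => //; ring.
have J1 : J 0 x1 phi = 0.
  rewrite (@eq_J _ 0 x1 _ (fun=> 0)); first by rewrite /J Rintegral_cst// mul0r.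
  move=> x /andP[x0 xx1]; apply: phi0; first by lra.
  by move=> Ex; have := ge_inf lE Ex; rewrite -/x1; lra.
have J2 : J x2 1 phi = 0.
  rewrite (@eq_J _ x2 1 _ (fun=> 0)); first by rewrite /J Rintegral_cst// mul0r.
  move=> x /andP[x2x xx1]; apply: phi0; first by lra.
  by move=> Ex; have := ub_le_sup uE Ex; rewrite -/x2; lra.
have J3 : J x1 x2 phi = J x1 x2 q - t * (x2 - x1).
  have <- : J x1 x2 (fun x => t + 0 * x) = t * (x2 - x1).
    by rewrite linear_J//; ring.
  rewrite -JB//; apply: eq_J => x /andP[x1x xx2].
  have d1 : 0 < x - x1 by lra.
  have [e1 [he1 te1] e1x] := inf_adherent d1 (conj (ex_intro _ e0 Ee0) lE).
  have d2 : 0 < x2 - x by lra.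
  have [e2 [he2 te2] e2x] := sup_adherent d2 (conj (ex_intro _ e0 Ee0) uE).
  rewrite -/x1 in e1x; rewrite -/x2 in e2x.
  have {}e1x : e1 < x by lra.
  have {}e2x : x < e2 by lra.
  rewrite /phi mul0r addr0; apply/max_idPl; rewrite subr_ge0.
  have e10 : 0 <= e1 by lra.
  have e21 : e2 <= 1 by lra.
  have := @cq e1 x e2 e10 (ltW e1x) (ltW e2x) e21.
  have h1 : (e2 - x) * t <= (e2 - x) * q e1 by rewrite ler_wpM2l//; lra.
  have h2 : (x - e1) * t <= (x - e1) * q e2 by rewrite ler_wpM2l//; lra.
  move=> h3.
  suff : (e2 - e1) * t <= (e2 - e1) * q x by rewrite ler_pM2l; lra.
  lra.
have x20 : 0 <= x2 by lra.
rewrite (J_split bphi (lexx _) x20 x21 (lexx _)) (J_split bphi (lexx _) x10 x12 x21).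
rewrite J1 J2 J3; lra.
Qed.

(** Berwald's inequality for the exponents 1 and 2. By the layer cake formula,
    it is the integral over [t] of the bound on the integral of the positive
    part of [q - t]. *)
Lemma J_sqr_le : J 0 1 (fun x => q x ^+ 2) <= 4 / 3 * A ^+ 2.
Proof.
case: (bq) => mq _.
have A0 : 0 <= A by apply: J_ge0 => // x h; apply: q0; lra.
pose F x t := 2 * Num.max (q x - t) 0.
have mF : measurable_fun setT (fun z : R * R => F z.1 z.2).
  apply: measurable_funM => //; apply: measurable_maxr => //.
  by apply: measurable_funB => //; apply: measurableT_comp.
have F0 x t : 0 <= F x t by rewrite mulr_ge0// le_max lexx orbT.
have F2 x t : 0 < x < 1 -> 0 < t < 1 -> F x t <= 2.
  move=> x01 t01; have := @qx x => h; have {}h : q x <= x by apply: h; lra.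
  suff : Num.max (q x - t) 0 <= 1 by rewrite /F; lra.
  by rewrite ge_max; apply/andP; split; lra.
have [bF bJF] := bmeas_J mF F0 F2.
have mF' : measurable_fun setT (fun z : R * R => F z.2 z.1).
  have -> : (fun z : R * R => F z.2 z.1) = (fun z => F z.1 z.2) \o (fun z => (z.2, z.1)) by [].
  apply: measurableT_comp => //; apply: measurable_fun_pair.
    exact: measurable_snd.
  exact: measurable_fst.
have [bF' bJF'] := @bmeas_J _ (fun t x => F x t) 2 mF' (fun _ _ => F0 _ _)
  (fun _ _ h1 h2 => F2 _ _ h2 h1).
have -> : J 0 1 (fun x => q x ^+ 2) = J 0 1 (fun x => J 0 1 (F x)).
  apply: eq_J => x x01.
  have qxx : q x <= x by apply: qx; lra.
  have qx1 : q x <= 1 by lra.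
  have qx0 : 0 <= q x by apply: q0; lra.
  rewrite (J_split (bF _ x01) (lexx _) qx0 qx1 (lexx _)).
  rewrite (@eq_J _ 0 (q x) _ (fun t => 2 * q x + (- 2) * t)); last first.
    move=> t /andP[t0 tq]; rewrite /F.
    have /max_idPl -> : 0 <= q x - t by lra.
    by ring.
  rewrite (@eq_J _ (q x) 1 _ (fun=> 0)); last first.
    move=> t /andP[qt t1]; rewrite /F.
    have /max_idPr -> : q x - t <= 0 by lra.
    by rewrite mulr0.
  rewrite linear_J// [X in _ + X](_ : _ = 0); first by field.
  by rewrite /J Rintegral_cst// mul0r.
rewrite (J_swap mF F0 F2).
pose c := 2 * A.
have bound t : 0 < t < 1 -> exists2 u, 0 <= u <= 1 &
    J 0 1 (F^~ t) <= 2 * (A * (1 - u ^+ 2) - t * (1 - u)).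
  move=> t01; have [u u01 hu] := concave_excess t; exists u => //.
  have -> : J 0 1 (F^~ t) = 2 * J 0 1 (fun x => Num.max (q x - t) 0).
    by apply: JZ => //; exact: bmeas_excess.
  by rewrite ler_pM2l.
have c1 : c <= 1.
  have : A <= J 0 1 (fun t => 0 + 1 * t).
    apply: le_J => // x h; rewrite add0r mul1r; apply: qx; lra.
  by rewrite linear_J// /c; lra.
have c0 : 0 <= c by rewrite /c; lra.
rewrite (J_split bJF' (lexx _) c0 c1 (lexx _)).
have I2 : J c 1 (fun t => J 0 1 (F^~ t)) <= 0.
  have z0 : J c 1 (fun=> 0) = 0 :> R by rewrite /J Rintegral_cst// mul0r.
  rewrite -[leRHS]z0.
  apply: (le_J c0 (lexx _) bJF' (bmeas_cst _)).
  move=> t /andP[ct t1]; have [|u u01 hu] := bound t; first by lra.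
  apply: le_trans hu _.
  have -> : 2 * (A * (1 - u ^+ 2) - t * (1 - u)) = 2 * ((1 - u) * (A * (1 + u) - t)) by ring.
  rewrite pmulr_rle0// mulr_ge0_le0//; first lra.
  have : A * (1 + u) <= A * 2 by rewrite ler_wpM2l//; lra.
  by move: ct; rewrite /c; lra.
have [cz|cn0] := eqVneq c 0.
  rewrite {1}cz {1}/J set_itv_ge ?bnd_simp ?ltxx// Rintegral_set0 add0r.
  by apply: le_trans I2 _; rewrite mulr_ge0// sqr_ge0.
have A0' : 0 < A by move/eqP: cn0; rewrite /c; lra.
have I1 : J 0 c (fun t => J 0 1 (F^~ t)) <= c ^+ 2 / 3.
  have <- : J 0 c (fun t => c + (- 2) * t + (1 / c) * t ^+ 2 + 0 * t ^+ 3) = c ^+ 2 / 3.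
    by rewrite J_cubic//; field.
  apply: (le_J (lexx _) c1 bJF' (bmeas_cubic _ _ _ _)).
  move=> t /andP[t0 tc]; have [|u u01 hu] := bound t; first by lra.
  apply: le_trans hu _.
  rewrite -subr_ge0.
  rewrite (_ : _ - _ = (2 * A * u - t) ^+ 2 / (2 * A)); last first.
    by rewrite /c; field; lra.
  by rewrite divr_ge0 ?sqr_ge0//; lra.
have -> : 4 / 3 * A ^+ 2 = c ^+ 2 / 3 by rewrite /c; field.
lra.
Qed.

End square_moment.

(** * Affine changes of variables *)

Section affine_substitution.
Context {R : realType}.
Local Notation mu := (@lebesgue_measure R).

Lemma measurable_affine (a b : R) :
  measurable_fun setT (fun x : measurableTypeR R => a + b * x : measurableTypeR R).
Proof. by apply: measurable_funD => //; apply: measurable_funM. Qed.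

Lemma lebesgue_measure_affine (a b : R) (A : set (measurableTypeR R)) : 0 < b ->
  measurable A ->
  (mu A = b%:E * mu ((fun x : measurableTypeR R => (a + b * x)%R) @^-1` A))%E.
Proof.
move=> b0 mA; have m := measurable_affine a b.
pose phi (x : measurableTypeR R) := (a + b * x : measurableTypeR R).
apply: (@lebesgue_measure_unique R (mscale (NngNum (ltW b0)) (pushforward mu phi))) => // _ [[x y]] _ <-.
change (mu `]x, y] = b%:E * mu (phi @^-1` `]x, y]))%E.
have -> : phi @^-1` `]x, y] = `](x - a) / b, (y - a) / b]%classic.
  apply/seteqP; split => z /=; rewrite !in_itv/= ltr_pdivrMr// ler_pdivlMr// /phi;
    by move=> /andP[? ?]; apply/andP; split; lra.
rewrite !lebesgue_measure_itv/= !lte_fin ltr_pM2r ?invr_gt0// ltrD2r.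
case: ifPn => _; last by rewrite mule0.
by rewrite -!EFinB -EFinM; congr EFin; field; rewrite gt_eqF.
Qed.

Lemma ge0_integral_affine (a b : R) (f : R -> \bar R) : 0 < b ->
  measurable_fun setT f -> (forall x, 0 <= f x)%E ->
  (\int[mu]_x f x = b%:E * \int[mu]_x f (a + b * x)%R)%E.
Proof.
move=> b0 mf f0; have m := measurable_affine a b.
pose phi (x : measurableTypeR R) := (a + b * x : measurableTypeR R).
have -> : (\int[mu]_x f (a + b * x)%R = \int[pushforward mu phi]_x f x)%E.
  by rewrite ge0_integral_pushforward//= preimage_setT.
rewrite -[X in (X%:E * _)%E]/((NngNum (ltW b0))%:num).
rewrite -ge0_integral_mscale//.
by apply: eq_measure_integral => A mA _; exact: lebesgue_measure_affine.
Qed.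

Lemma ge0_integral_reflect (a : R) (f : R -> \bar R) :
  measurable_fun setT f -> (forall x, 0 <= f x)%E ->
  (\int[mu]_x f x = \int[mu]_x f (a - x)%R)%E.
Proof.
move=> mf f0.
rewrite (ge0_integral_affine a ltr01 mf f0) mul1e.
under eq_integral do rewrite mul1r.
pose g x := f (a + x)%R.
have mg : measurable_fun setT g.
  by apply: measurableT_comp => //; apply: measurable_funD.
transitivity (\int[pushforward mu (-%R : _ -> measurableTypeR R)]_x g x)%E.
  by apply: eq_measure_integral => A mA _; exact/esym/lebesgue_measureN.
by rewrite ge0_integral_pushforward//= => y _; exact: f0.
Qed.

Lemma J_reflect (f : R -> R) : bmeas f -> J 0 1 (fun x => f (1 - x)) = J 0 1 f.
Proof.
move=> bf; case: (bf) => mf [M hM].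
have bf' : bmeas (fun x => f (1 - x)).
  split; first by apply: measurableT_comp => //; apply: measurable_funB.
  by exists M => x x01; apply: hM; lra.
suff H (g : R -> R) : bmeas g -> (forall x, 0 < x < 1 -> 0 <= g x) ->
    J 0 1 (fun x => g (1 - x)) = J 0 1 g.
  have bM : bmeas (fun=> M) by exact: bmeas_cst.
  have := H (fun x => f x + M) (bmeasD bf bM).
  rewrite !JD// => /(_ _) h.
  have : J 0 1 (fun x => f (1 - x)) + J 0 1 (fun=> M) = J 0 1 f + J 0 1 (fun=> M).
    apply: h => x x01; have := hM _ x01; rewrite ler_norml => /andP[]; lra.
  by move/addIr.
move=> [mg _] g0.
rewrite /J /Rintegral; congr fine.
rewrite integral_mkcond [RHS]integral_mkcond.
rewrite [RHS](ge0_integral_reflect 1).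
- apply: eq_integral => x _; rewrite !patchE.
  have -> : (x \in `]0, 1[%classic) = ((1 - x) \in (`]0, 1[%classic : set R)).
    by apply/idP/idP; rewrite !inE/= !in_itv/= => /andP[? ?]; apply/andP; split; lra.
  by [].
- apply/(measurable_restrictT _ _).1 => //.
  by apply/measurable_EFinP; exact: measurable_funTS.
- move=> x; rewrite patchE; case: ifPn => // /set_mem/=; rewrite in_itv/= => h.
  by rewrite lee_fin g0.
Qed.

End affine_substitution.

(** * The one-dimensional inequality *)

Section spread_inequality.
Context {R : realType}.

(** The inequality between moments to which everything reduces: [x0], [x1], [x2]
    and [y0], [y1], [y2] stand for the moments of two functions below the
    diagonal, [P] and [Q] for their square integrals and [S] for the integral of
    the product of one of them with the reflection of the other. *)
Lemma moment_inequality (x0 x1 x2 y0 y1 y2 P Q S : R) :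
  0 <= x0 -> 0 <= y0 -> y0 <= x0 -> x0 <= 1 / 2 ->
  x0 + 2 * x0 ^+ 2 <= 3 * x1 -> y0 + 2 * y0 ^+ 2 <= 3 * y1 ->
  (forall c, 0 <= c <= 1 -> 12 * x2 <= (12 + 12 * c) * x1
                  - (2 + 8 * c + 2 * c ^+ 2) * x0 + c ^+ 2) ->
  (forall c, 0 <= c <= 1 -> 12 * y2 <= (12 + 12 * c) * y1
                  - (2 + 8 * c + 2 * c ^+ 2) * y0 + c ^+ 2) ->
  P <= 4 / 3 * x0 ^+ 2 -> Q <= 4 / 3 * y0 ^+ 2 ->
  x0 * y0 / 3 <= S -> (y0 - y1) + (x0 - x1) - 1 / 6 <= S ->
  (x0 + y0) * (2 / 3 + 2 * (x0 + y0) - 4 * (x1 + y1) + P + Q - 2 * S) <=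
  4 * (x1 - x2 + (y1 - y2)).
Proof.
move=> x00 y00 yx x01 Vx Vy Cx Cy Px Qy S1 S2.
(* When the mass is large the last factor on the left is at most [2 / 3], and the
   choice [c = 0] suffices. *)
have [A1|A1] := leP (1 / 2) (x0 + y0).
  have c01 : 0 <= (0 : R) <= 1 by lra.
  have := Cx _ c01; have := Cy _ c01; rewrite !expr0n/= !mulr0 !addr0 => Cy0 Cx0.
  have : 2 / 3 + 2 * (x0 + y0) - 4 * (x1 + y1) + P + Q - 2 * S <= 2 / 3 by lra.
  move=> h; apply: (@le_trans _ _ ((x0 + y0) * (2 / 3))); last by lra.
  by rewrite ler_wpM2l//; lra.
(* With the choices [c = x0 + y0] for the first function and [c = 2 * y0] for the
   second one, the difference of the two sides is a combination of the
   nonnegative products [h2], [h3] and [h4]. *)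
have cx : 0 <= x0 + y0 <= 1 by apply/andP; split; lra.
have cy : 0 <= 2 * y0 <= 1 by apply/andP; split; lra.
have {Cx}Cx := Cx _ cx; have {Cy}Cy := Cy _ cy.
have h1 : (x0 + y0) * (P + Q - 2 * S) <=
    (x0 + y0) * (4 / 3 * x0 ^+ 2 + 4 / 3 * y0 ^+ 2 - 2 / 3 * (x0 * y0)).
  by rewrite ler_wpM2l//; lra.
have h2 : 0 <= (x0 - y0) * (3 * y1 - y0 - 2 * y0 ^+ 2) by rewrite mulr_ge0//; lra.
have h3 : 0 <= (x0 - y0) ^+ 2 * (1 - 2 * x0 - 2 * y0).
  by rewrite mulr_ge0 ?sqr_ge0//; lra.
have h4 : 0 <= y0 ^+ 2 * (3 * x0 - y0) by rewrite mulr_ge0 ?sqr_ge0//; lra.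
lra.
Qed.

Variables p q : R -> R.
Hypotheses (sp : subdiag p) (sq : subdiag q).

(** For a convex body projected onto [[0, 1]], [q x + p (1 - x)] is proportional to
    the chord length, that is, to the density of a uniform point of the body,
    and [1 - 2 * x + q x - p (1 - x)] is [1 - 2 * F x] for the distribution
    function [F] of a uniform boundary point. *)
Lemma spread_le :
  (mom 0 p + mom 0 q) *
    (1 / 3 + J 0 1 (fun x => (1 - 2 * x + q x - p (1 - x)) ^+ 2)) <=
  4 * J 0 1 (fun x => x * (1 - x) * (q x + p (1 - x))).
Proof.
have bp : bmeas p by case: sp.
have bq : bmeas q by case: sq.
have bp' : bmeas (fun x => p (1 - x)).
  case: (bp) => mp [M hM]; split.
    by apply: measurableT_comp => //; apply: measurable_funB.
  by exists M => x x01; apply: hM; lra.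
have quad k0 k1 k2 : bmeas (fun x : R => k0 + k1 * x + k2 * x ^+ 2).
  have := bmeas_cubic k0 k1 k2 0; congr bmeas; apply/funext => t; ring.
pose S := J 0 1 (fun x => q x * p (1 - x)).
pose P := J 0 1 (fun x => p x ^+ 2).
pose Q := J 0 1 (fun x => q x ^+ 2).
have mom_reflect k0 k1 k2 :
    J 0 1 (fun x => (k0 + k1 * x + k2 * x ^+ 2) * p (1 - x)) =
    (k0 + k1 + k2) * mom 0 p + (- k1 - 2 * k2) * mom 1 p + k2 * mom 2 p.
  rewrite -mom_quadratic// -[RHS]J_reflect; last exact: bmeasM.
  by apply: eq_J => x _; congr (_ * _); ring.
have RE : J 0 1 (fun x => x * (1 - x) * (q x + p (1 - x))) =
    mom 1 p - mom 2 p + (mom 1 q - mom 2 q).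
  rewrite (@eq_J _ 0 1 _ (fun x => (0 + 1 * x + (-1) * x ^+ 2) * q x +
      (0 + 1 * x + (-1) * x ^+ 2) * p (1 - x))); last by move=> x _; ring.
  rewrite JD//; try exact: bmeasM.
  by rewrite mom_quadratic// mom_reflect; ring.
have LE : J 0 1 (fun x => (1 - 2 * x + q x - p (1 - x)) ^+ 2) =
    1 / 3 + 2 * (mom 0 p + mom 0 q) - 4 * (mom 1 p + mom 1 q) + P + Q - 2 * S.
  pose f1 (x : R) := 1 + (-4) * x + 4 * x ^+ 2.
  pose f2 x := (2 + (-4) * x + 0 * x ^+ 2) * q x.
  pose f3 x := (-2 + 4 * x + 0 * x ^+ 2) * p (1 - x).
  pose f4 x := q x ^+ 2.
  pose f5 x := p (1 - x) ^+ 2.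
  pose f6 x := (-2) * (q x * p (1 - x)).
  have b1 : bmeas f1 by exact: quad.
  have b2 : bmeas f2 by apply: bmeasM => //; exact: quad.
  have b3 : bmeas f3 by apply: bmeasM => //; exact: quad.
  have b4 : bmeas f4 by exact: bmeasX.
  have b5 : bmeas f5 by exact: bmeasX.
  have b6 : bmeas f6 by apply: bmeasM; [exact: bmeas_cst|exact: bmeasM].
  rewrite (@eq_J _ 0 1 _ (fun x => f1 x + (f2 x + (f3 x + (f4 x + (f5 x + f6 x)))))); last first.
    by move=> x _; rewrite /f1 /f2 /f3 /f4 /f5 /f6; ring.
  have c56 := bmeasD b5 b6; have c46 := bmeasD b4 c56.
  have c36 := bmeasD b3 c46; have c26 := bmeasD b2 c36.
  rewrite (JD (lexx _) (lexx _) b1 c26) (JD (lexx _) (lexx _) b2 c36).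
  rewrite (JD (lexx _) (lexx _) b3 c46) (JD (lexx _) (lexx _) b4 c56).
  rewrite (JD (lexx _) (lexx _) b5 b6).
  have -> : J 0 1 f1 = 1 / 3.
    have := J_cubic 1 (-4) 4 (0 : R) (@ler01 R).
    rewrite (@eq_J _ 0 1 _ f1) => [->|x _]; last by rewrite /f1; ring.
    by field.
  have -> : J 0 1 f5 = P by exact: (J_reflect (bmeasX 2 bp)).
  have -> : J 0 1 f6 = -2 * S by rewrite JZ//; exact: bmeasM.
  by rewrite mom_quadratic// mom_reflect -/Q; ring.
have p01 x : 0 <= x <= 1 -> 0 <= p x <= x by case: sp => _ _; exact.
have q01 x : 0 <= x <= 1 -> 0 <= q x <= x by case: sq => _ _; exact.
(* Replace [q] by its lower bound [2 * mom 0 q * (x * (1 - x))]. *)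
have S1 : mom 0 p * mom 0 q / 3 <= S.
  have c01 : 0 <= (0 : R) <= 1 by lra.
  have := mom2_le sp c01; rewrite expr0n/= !mulr0 !addr0 => hp.
  apply: (@le_trans _ _ (2 * mom 0 q * (mom 1 p - mom 2 p))).
    have : 0 <= mom 0 q * (6 * (mom 1 p - mom 2 p) - mom 0 p).
      by rewrite mulr_ge0 ?mom0_ge0//; lra.
    lra.
  have -> : 2 * mom 0 q * (mom 1 p - mom 2 p) =
      J 0 1 (fun x => (0 + (2 * mom 0 q) * x + (- (2 * mom 0 q)) * x ^+ 2) * p (1 - x)).
    by rewrite mom_reflect; ring.
  apply: le_J => //; try exact: bmeasM.
  move=> x /andP[x0 x1].
  have /andP[px0 _] : 0 <= p (1 - x) <= 1 - x by apply: p01; lra.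
  rewrite ler_wpM2r//.
  have := @concave01_ge _ _ sq x; rewrite ltW// ltW// => /(_ isT); lra.
(* Integrate [0 <= (x - q x) * (1 - x - p (1 - x))]. *)
have S2 : (mom 0 q - mom 1 q) + (mom 0 p - mom 1 p) - 1 / 6 <= S.
  have -> : (mom 0 q - mom 1 q) + (mom 0 p - mom 1 p) - 1 / 6 =
      J 0 1 (fun x => (1 + (-1) * x + 0 * x ^+ 2) * q x) +
      (J 0 1 (fun x => (0 + 1 * x + 0 * x ^+ 2) * p (1 - x)) +
       J 0 1 (fun x => 0 + (-1) * x + 1 * x ^+ 2 + 0 * x ^+ 3)).
    by rewrite mom_quadratic// mom_reflect J_cubic//; field.
  rewrite -JD//; try exact: bmeasM; last exact: bmeas_cubic.
  rewrite -JD//; last 2 first.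
    exact: bmeasM.
    by apply: bmeasD; [exact: bmeasM|exact: bmeas_cubic].
  apply: le_J => //; last 2 first.
    exact: bmeasM.
    move=> x /andP[x0 x1].
    have /andP[px0 px1] : 0 <= p (1 - x) <= 1 - x by apply: p01; lra.
    have /andP[qx0 qx1] : 0 <= q x <= x by apply: q01; lra.
    have : 0 <= (x - q x) * (1 - x - p (1 - x)) by rewrite mulr_ge0//; lra.
    lra.
  by apply: bmeasD; [exact: bmeasM|apply: bmeasD; [exact: bmeasM|exact: bmeas_cubic]].
rewrite RE LE.
have P4 : P <= 4 / 3 * mom 0 p ^+ 2.
  have := J_sqr_le sp; congr (_ <= _ * _ ^+ 2).
  by apply: eq_J => x _; rewrite expr0 mul1r.
have Q4 : Q <= 4 / 3 * mom 0 q ^+ 2.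
  have := J_sqr_le sq; congr (_ <= _ * _ ^+ 2).
  by apply: eq_J => x _; rewrite expr0 mul1r.
have [qp|pq] := leP (mom 0 q) (mom 0 p).
  have := @moment_inequality (mom 0 p) (mom 1 p) (mom 2 p) (mom 0 q) (mom 1 q) (mom 2 q) P Q S
    (mom0_ge0 sp) (mom0_ge0 sq) qp (mom0_le sp) (mom1_ge sp) (mom1_ge sq)
    (mom2_le sp) (mom2_le sq) P4 Q4 S1 S2.
  by congr (_ * _ <= _); lra.
have S1' : mom 0 q * mom 0 p / 3 <= S by rewrite [mom 0 q * _]mulrC.
have S2' : (mom 0 p - mom 1 p) + (mom 0 q - mom 1 q) - 1 / 6 <= S.
  by rewrite [(mom 0 p - _) + _]addrC.
have := @moment_inequality (mom 0 q) (mom 1 q) (mom 2 q) (mom 0 p) (mom 1 p) (mom 2 p) Q P S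
    (mom0_ge0 sq) (mom0_ge0 sp) (ltW pq) (mom0_le sq) (mom1_ge sq) (mom1_ge sp)
    (mom2_le sq) (mom2_le sp) Q4 P4 S1' S2'.
rewrite [mom 0 q + _]addrC [mom 1 q + mom 1 p]addrC [mom 1 q - _ + _]addrC.
by congr (_ * _ <= _); lra.
Qed.

End spread_inequality.

(** * One-dimensional Hausdorff measure of plane sets *)

Section arclength_bounds.
Context {R : realType}.
Implicit Types (A B E : set (plane R)) (z : plane R).

Lemma eucl_distE z z' :
  eucl_dist z z' = Num.sqrt ((z.1 - z'.1) ^+ 2 + (z.2 - z'.2) ^+ 2).
Proof. by []. Qed.

Lemma eucl_dist_ge0 z z' : 0 <= eucl_dist z z'.
Proof. exact: sqrtr_ge0. Qed.

Lemma eucl_dist_sqr z z' :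
  eucl_dist z z' ^+ 2 = (z.1 - z'.1) ^+ 2 + (z.2 - z'.2) ^+ 2.
Proof. by rewrite eucl_distE sqr_sqrtr// addr_ge0 ?sqr_ge0. Qed.

Lemma eucl_distxx z : eucl_dist z z = 0.
Proof. by rewrite eucl_distE !subrr expr0n/= addr0 sqrtr0. Qed.

Lemma ler_eucl_dist z z' (a : R) : 0 <= a ->
  (z.1 - z'.1) ^+ 2 + (z.2 - z'.2) ^+ 2 <= a ^+ 2 -> eucl_dist z z' <= a.
Proof.
by move=> a0 h; rewrite -(ler_pXn2r (n := 2))// ?nnegrE ?eucl_dist_ge0// eucl_dist_sqr.
Qed.

Lemma diam_ge0 E : (0 <= diam E)%E.
Proof. by apply: ereal_sup_ubound; left. Qed.

Lemma le_diam E z z' : E z -> E z' -> ((eucl_dist z z')%:E <= diam E)%E.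
Proof. by move=> Ez Ez'; apply: ereal_sup_ubound; right; exists z => //; exists z'. Qed.

Lemma diam_le E (c : R) : 0 <= c ->
  (forall z z', E z -> E z' -> eucl_dist z z' <= c) -> (diam E <= c%:E)%E.
Proof.
move=> c0 h; apply: ge_ereal_sup => _ [->|[z Ez [z' Ez' <-]]]; first by rewrite lee_fin.
by rewrite lee_fin h.
Qed.

Lemma diam0 : diam (set0 : set (plane R)) = 0%E.
Proof. by apply/eqP; rewrite eq_le diam_ge0 andbT; apply: diam_le. Qed.

(** Finite covers suffice to bound the arclength of boundary arcs from above,
    and they can be concatenated, unlike countable ones, without reindexing. *)
Definition fine_cover A (c : R) : Prop := forall delta : R, 0 < delta ->
  exists s : seq (set (plane R)),
  [/\ forall z, A z -> exists2 E, List.In E s & E z,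
      forall E, List.In E s -> (diam E <= delta%:E)%E &
      (\sum_(E <- s) diam E <= c%:E)%E].

Lemma fine_cover_arclength A (c : R) : fine_cover A c -> (arclength A <= c%:E)%E.
Proof.
move=> h; apply: ge_ereal_sup => _ [delta delta0 <-].
have [s [sA sd sc]] := h _ delta0.
apply: le_trans sc; apply: ereal_inf_lbound.
exists (fun i => nth set0 s i).
  split.
    move=> z /sA[E Es Ez].
    suff [i Ei] : exists i, nth set0 s i = E by exists i => //; rewrite Ei.
    elim: s Es {sA sd} => [//|F s IH] /= [->|/IH[i Ei]]; first by exists 0%N.
    by exists i.+1.
  move=> i; have [si|si] := leqP (size s) i.
    by rewrite nth_default// diam0 lee_fin ltW.
  apply: sd; elim: s i si {sA} => [//|F s IH] [|i] /= si; first by left.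
  by right; exact: IH.
rewrite (nneseries_split 0%N (size s)); last by move=> k _; exact: diam_ge0.
rewrite add0n eseries0 ?adde0; last first.
  by move=> i si _; rewrite nth_default// diam0.
by rewrite (big_nth set0).
Qed.

Lemma fine_coverU A B (a b : R) :
  fine_cover A a -> fine_cover B b -> fine_cover (A `|` B) (a + b).
Proof.
move=> hA hB delta d0; have [s [sA sd sc]] := hA _ d0.
have [t [tB td tc]] := hB _ d0.
exists (s ++ t); split.
- move=> z [/sA[E Es Ez]|/tB[E Es Ez]]; exists E => //; apply/List.in_or_app;
    by [left|right].
- by move=> E /(@List.in_app_or _ _ _ _)[/sd|/td].
- by rewrite big_cat/= EFinD leeD.
Qed.

Lemma fine_coverS A B (a b : R) :
  A `<=` B -> b <= a -> fine_cover B b -> fine_cover A a.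
Proof.
move=> AB ba h delta d0; have [s [sA sd sc]] := h _ d0.
exists s; split => //; first by move=> z /AB/sA.
by apply: le_trans sc _; rewrite lee_fin.
Qed.

(** A set with an expanding parameter ranging in [[a, b]] has arclength at most
    [b - a]. Halving the parameter interval makes the cover fine. *)
Lemma fine_cover_param A (psi : plane R -> R) (a b : R) : a <= b ->
  (forall z, A z -> a <= psi z <= b) ->
  (forall z z', A z -> A z' -> eucl_dist z z' <= `|psi z - psi z'|) ->
  fine_cover A (b - a).
Proof.
move=> ab Aab Apsi delta d0.
have [n hn] : exists n, b - a <= delta * 2 ^+ n.
  have [n hn] : exists n : nat, (b - a) / delta <= n%:R.
    by exists (Num.truncn ((b - a) / delta)).+1; exact/ltW/truncnS_gt.
  exists n; rewrite -ler_pdivrMl// mulrC (le_trans hn)//.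
  by rewrite -natrX ler_nat ltnW// ltn_expl.
elim: n A a b ab Aab Apsi hn => [|n IH] A a b ab Aab Apsi hn.
  have dA : (diam A <= (b - a)%:E)%E.
    apply: diam_le; first by lra.
    move=> z z' Az Az'; apply: le_trans (Apsi _ _ Az Az') _.
    have /andP[? ?] := Aab _ Az; have /andP[? ?] := Aab _ Az'.
    by rewrite ler_norml; apply/andP; split; lra.
  exists [:: A]; split.
  - by move=> z Az; exists A => //; left.
  - move=> E /= [<-|//]; apply: le_trans dA _; rewrite lee_fin.
    by move: hn; rewrite expr0 mulr1.
  - by rewrite big_seq1.
pose m := (a + b) / 2.
have [||| |s [sA sd sc]] := IH (A `&` [set z | psi z <= m]) a m.
- by rewrite /m; lra.
- by move=> z [/Aab/andP[-> _]].
- by move=> z z' [Az _] [Az' _]; exact: Apsi.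
- by move: hn; rewrite /m exprS; lra.
have [||| |t [tA td tc]] := IH (A `&` [set z | m <= psi z]) m b.
- by rewrite /m; lra.
- by move=> z [/Aab/andP[_ ->] /= ->].
- by move=> z z' [Az _] [Az' _]; exact: Apsi.
- by move: hn; rewrite /m exprS; lra.
exists (s ++ t); split.
- move=> z Az; have [zm|zm] := leP (psi z) m.
    have [E Es Ez] := sA z (conj Az zm).
    by exists E => //; apply/List.in_or_app; left.
  have [E Et Ez] := tA z (conj Az (ltW zm)).
  by exists E => //; apply/List.in_or_app; right.
- by move=> E /(@List.in_app_or _ _ _ _)[/sd|/td].
- rewrite big_cat/=; apply: le_trans (leeD sc tc) _.
  by rewrite -EFinD lee_fin; lra.
Qed.

Lemma fine_cover_point z : fine_cover [set z] 0.
Proof.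
have := @fine_cover_param [set z] (fun=> 0) 0 0; rewrite subrr; apply => //.
- by move=> ? _; rewrite lexx.
- by move=> ? ? -> ->; rewrite eucl_distxx normr_ge0.
Qed.

(** The measure of the image under a map that does not increase distances is a
    lower bound for the arclength. *)
Lemma arclength_ge A (f : plane R -> R) (a b : R) :
  (forall z z', `|f z - f z'| <= eucl_dist z z') ->
  `]a, b] `<=` f @` A -> ((b - a)%:E <= arclength A)%E.
Proof.
move=> f1 abA.
apply: (@le_trans _ _ (hausdorff1_pre 1 A)); last first.
  by apply: ereal_sup_ubound; exists 1 => //=.
apply: le_ereal_inf_tmp => _ [E [AE E1] <-].
pose I i : set (measurableTypeR R) :=
  if pselect (E i !=set0) then `[inf (f @` E i), sup (f @` E i)]%classic else set0.
have mI i : measurable (I i).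
  by rewrite /I; case: pselect => ?; [exact: (@measurable_itv R)|exact: measurable0].
have bE i z z' : E i z -> E i z' -> f z - f z' <= fine (diam (E i)).
  move=> Ez Ez'; apply: le_trans (ler_norm _) _; apply: le_trans (f1 _ _) _.
  have := le_diam Ez Ez'; have := E1 i; have := diam_ge0 (E i).
  by case: (diam (E i)) => [r| |]//=; rewrite lee_fin.
have hub i z : E i z -> has_ubound (f @` E i).
  move=> Ez; exists (f z + fine (diam (E i))) => _ [z' Ez' <-].
  by have := bE _ _ _ Ez' Ez; lra.
have hlb i z : E i z -> has_lbound (f @` E i).
  move=> Ez; exists (f z - fine (diam (E i))) => _ [z' Ez' <-].
  by have := bE _ _ _ Ez Ez'; lra.
have lI i : (lebesgue_measure (I i) <= diam (E i))%E.
  rewrite /I; case: pselect => [[z Ez]|nE] /=; last by rewrite measure0 diam_ge0.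
  rewrite lebesgue_measure_itv/=; case: (ltP (inf _)%:E) => _; last exact: diam_ge0.
  rewrite -EFinB.
  have dfin : diam (E i) = (fine (diam (E i)))%:E.
    rewrite fineK// fin_numElt (lt_le_trans _ (diam_ge0 _))//=.
    by rewrite (le_lt_trans (E1 i))// ltry.
  rewrite dfin lee_fin lerBlDr.
  apply: ge_sup; first by exists (f z), z.
  move=> _ [z1 Ez1 <-]; rewrite -lerBlDl.
  apply: lb_le_inf; first by exists (f z), z.
  by move=> _ [z2 Ez2 <-]; have := bE _ _ _ Ez1 Ez2; lra.
have abI : `]a, b]%classic `<=` \bigcup_i I i.
  move=> x /abA[z /AE[i _ Eiz] <-]; exists i => //.
  rewrite /I; case: pselect => [Ei0|n] /=; last by case: n; exists z.
  rewrite /= in_itv/=; apply/andP; split.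
    by apply: ge_inf; [exact: hlb Eiz|exists z].
  by apply: ub_le_sup; [exact: hub Eiz|exists z].
have := @measure_sigma_subadditive _ _ _ (@lebesgue_measure R) `]a, b]%classic I mI
  (measurable_itv _) abI.
rewrite /= lebesgue_measure_itv/= => h.
apply: le_trans (le_trans h _); last by apply: lee_nneseries => // i _; exact: lI.
case: (ltP a%:E) => [_|]; first by rewrite EFinB.
by rewrite !lee_fin subr_le0.
Qed.

End arclength_bounds.

(** * Convex bodies as regions between two graphs *)

Section convex_body_graphs.
Context {R : realType}.
Implicit Type K : set (plane R).

Lemma interior_boxP K (z : plane R) : interior K z <-> exists2 e : R, 0 < e &
  forall z' : plane R, `|z.1 - z'.1| < e -> `|z.2 - z'.2| < e -> K z'.
Proof.
rewrite /interior; split => [/nbhs_ballP[e /= e0 h]|[e e0 h]].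
  by exists e => // z' h1 h2; apply: h.
by apply/nbhs_ballP; exists e => //= z' [h1 h2]; exact: h.
Qed.

Lemma convex_set_comb K (z z' : plane R) (t : R) : convex_set K -> K z -> K z' ->
  0 <= t <= 1 ->
  K (t * z.1 + (1 - t) * z'.1, t * z.2 + (1 - t) * z'.2).
Proof.
move=> cK Kz Kz' /andP[t0 t1].
by have := cK z z' (Itv01 t0 t1); rewrite !inE => /(_ Kz Kz').
Qed.

Lemma continuous_plane_fst : continuous (fst : plane R -> R).
Proof. by move=> z; exact: cvg_fst. Qed.

Lemma continuous_plane_snd : continuous (snd : plane R -> R).
Proof. by move=> z; exact: cvg_snd. Qed.

Lemma compact_level K (f : plane R -> R) (c : R) : continuous f ->
  compact K -> compact (K `&` f @^-1` [set c]).
Proof.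
move=> cf cK; apply: compact_closedI => //.
by apply: closed_comp.
Qed.

Lemma compact_max K (f : plane R -> R) : continuous f -> compact K ->
  K !=set0 -> exists2 z, K z & forall z', K z' -> f z' <= f z.
Proof.
move=> cf cK K0.
have [|z zK zm] := @compact_EVT_max _ R f _ K0 cK; first exact: continuous_subspaceT.
by exists z; [exact: set_mem|move=> z' Kz'; apply: zm; exact: mem_set].
Qed.

Lemma compact_min K (f : plane R -> R) : continuous f -> compact K ->
  K !=set0 -> exists2 z, K z & forall z', K z' -> f z <= f z'.
Proof.
move=> cf cK K0.
have [|z zK zm] := @compact_EVT_min _ R f _ K0 cK; first exact: continuous_subspaceT.
by exists z; [exact: set_mem|move=> z' Kz'; apply: zm; exact: mem_set].
Qed.

Definition concave_itv (m M : R) (f : R -> R) : Prop :=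
  forall x y z, m <= x -> x <= y -> y <= z -> z <= M ->
  (z - y) * f x + (y - x) * f z <= (z - x) * f y.

(** [K] is the region above [[m, M]] between the graphs of the convex function
    [- g'] and of the concave function [h]; taking [g' = - g] lets upper and
    lower arcs share their lemmas. *)
Record graph_body K (m M : R) (g' h : R -> R) : Prop := GraphBody {
  graph_body_itv : m < M ;
  graph_body_mem : forall z, K z <-> m <= z.1 <= M /\ - g' z.1 <= z.2 <= h z.1 ;
  graph_body_le : forall x, m <= x <= M -> 0 <= h x + g' x ;
  graph_body_lt : forall x, m < x < M -> 0 < h x + g' x ;
  graph_body_top : concave_itv m M h ;
  graph_body_bottom : concave_itv m M g' }.

Lemma convex_body_graphs K : convex_body K ->
  exists m M g' h, graph_body K m M g' h.
Proof.
move=> [cK vK [z0 /interior_boxP[e e0 hz0]]].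
have Kz0 : K z0 by apply: hz0; rewrite subrr normr0.
have K0 : K !=set0 by exists z0.
have [zm Kzm hm] := compact_min continuous_plane_fst cK K0.
have [zM KzM hM] := compact_max continuous_plane_fst cK K0.
pose m := zm.1; pose M := zM.1.
have sec (x : R) : m <= x <= M -> exists y : R, K (x, y).
  move=> /andP[mx xM].
  have [mM|mM] := eqVneq m M.
    have -> : x = zm.1 by apply/eqP; rewrite eq_le mx -/m mM xM.
    by exists zm.2; rewrite -surjective_pairing.
  pose t := (M - x) / (M - m).
  have dM : 0 < M - m.
    by rewrite subr_gt0 lt_neqAle mM/= (le_trans mx xM).
  have t01 : 0 <= t <= 1.
    by apply/andP; split; rewrite /t ?divr_ge0 ?ler_pdivrMr//; lra.
  have := convex_set_comb vK Kzm KzM t01.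
  set y := (X in (_, X)); rewrite -/m -/M (_ : _ + _ = x); first by exists y.
  by rewrite /t; field; lra.
have top (x : R) : exists y : R, m <= x <= M ->
    K (x, y) /\ forall y', K (x, y') -> y' <= y.
  have [xI|xI] := boolP (m <= x <= M); last by exists 0.
  have [y Ky] := sec x xI.
  have [|||z [Kz zx] hz] := @compact_max (K `&` fst @^-1` [set x]) snd.
  - exact: continuous_plane_snd.
  - by apply: compact_level => //; exact: continuous_plane_fst.
  - by exists (x, y).
  - exists z.2 => _; split; first by rewrite -zx -surjective_pairing.
    by move=> y' Ky'; exact: (hz (x, y')).
have bot (x : R) : exists y : R, m <= x <= M ->
    K (x, y) /\ forall y', K (x, y') -> y <= y'.
  have [xI|xI] := boolP (m <= x <= M); last by exists 0.
  have [y Ky] := sec x xI.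
  have [|||z [Kz zx] hz] := @compact_min (K `&` fst @^-1` [set x]) snd.
  - exact: continuous_plane_snd.
  - by apply: compact_level => //; exact: continuous_plane_fst.
  - by exists (x, y).
  - exists z.2 => _; split; first by rewrite -zx -surjective_pairing.
    by move=> y' Ky'; exact: (hz (x, y')).
pose h x := sval (cid (top x)); pose g x := sval (cid (bot x)).
have Kh x : m <= x <= M -> K (x, h x) /\ forall y', K (x, y') -> y' <= h x.
  by rewrite /h; case: cid.
have Kg x : m <= x <= M -> K (x, g x) /\ forall y', K (x, y') -> g x <= y'.
  by rewrite /g; case: cid.
have comb x y z a b : m <= x -> x <= y -> y <= z -> z <= M -> x < z ->
    K (x, a) -> K (z, b) -> K (y, ((z - y) * a + (y - x) * b) / (z - x)).
  move=> mx xy yz zM' xz Ka Kb.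
  have t01 : 0 <= (z - y) / (z - x) <= 1.
    by apply/andP; split; rewrite ?divr_ge0 ?ler_pdivrMr//; lra.
  have := convex_set_comb vK Ka Kb t01; rewrite /=.
  by congr (K (_, _)); field; lra.
have box (a b : R) : `|a| < e -> `|b| < e -> K (z0.1 + a, z0.2 + b).
  by move=> ae be; apply: hz0 => /=; rewrite opprD addNKr normrN.
have e2 : `|e / 2| < e by rewrite ger0_norm; lra.
have Ne2 : `|- (e / 2)| < e by rewrite normrN.
have e00 : `|0 : R| < e by rewrite normr0.
have mz0 : m < z0.1 by have := hm _ (box _ _ Ne2 e00); rewrite /= -/m; lra.
have z0M : z0.1 < M by have := hM _ (box _ _ e2 e00); rewrite /= -/M; lra.
have hconc : concave_itv m M h.
  move=> x y z mx xy yz zM'.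
  have [xz|xz] := ltP x z; last first.
    have xy' : x = y by lra.
    have yz' : y = z by lra.
    by rewrite xy' yz' !subrr; lra.
  have xI : m <= x <= M by lra.
  have yI : m <= y <= M by lra.
  have zI : m <= z <= M by lra.
  have [Kx _] := Kh _ xI; have [Kz _] := Kh _ zI; have [_ hy] := Kh _ yI.
  have := hy _ (comb _ _ _ _ _ mx xy yz zM' xz Kx Kz).
  by rewrite ler_pdivrMr ?subr_gt0// [h y * _]mulrC.
have gconc : concave_itv m M (fun x => - g x).
  move=> x y z mx xy yz zM'.
  have [xz|xz] := ltP x z; last first.
    have xy' : x = y by lra.
    have yz' : y = z by lra.
    by rewrite xy' yz' !subrr; lra.
  have xI : m <= x <= M by lra.
  have yI : m <= y <= M by lra.
  have zI : m <= z <= M by lra.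
  have [Kx _] := Kg _ xI; have [Kz _] := Kg _ zI; have [_ hy] := Kg _ yI.
  have := hy _ (comb _ _ _ _ _ mx xy yz zM' xz Kx Kz).
  by rewrite ler_pdivlMr ?subr_gt0//; lra.
have gh x : m <= x <= M -> g x <= h x.
  by move=> xI; have [Kx _] := Kh _ xI; have [_] := Kg _ xI; exact.
have gh0 : g z0.1 < h z0.1.
  have z0I : m <= z0.1 <= M by lra.
  have [_] := Kg _ z0I; have := box _ _ e00 Ne2; rewrite addr0 => b2 /(_ _ b2).
  have [_] := Kh _ z0I; have := box _ _ e00 e2; rewrite addr0 => b1 /(_ _ b1).
  by lra.
exists m, M, (fun x => - g x), h; split => //.
- by lra.
- move=> [x y] /=; rewrite opprK; split=> [Kxy|[xI /andP[gy yh]]].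
    have xI : m <= x <= M.
      by have := hm _ Kxy; have := hM _ Kxy; rewrite /= -/m -/M => -> ->.
    by have [_ ->//] := Kh _ xI; have [_ ->//] := Kg _ xI.
  have [ghx|ghx] := eqVneq (g x) (h x).
    by have -> : y = h x; [lra|have [] := Kh _ xI].
  have d0 : 0 < h x - g x by rewrite subr_gt0 lt_neqAle ghx (le_trans gy).
  have t01 : 0 <= (h x - y) / (h x - g x) <= 1.
    by apply/andP; split; rewrite ?divr_ge0 ?ler_pdivrMr//; lra.
  have [Kgx _] := Kg _ xI; have [Khx _] := Kh _ xI.
  have := convex_set_comb vK Kgx Khx t01; rewrite /=.
  by congr (K (_, _)); field; lra.
- by move=> x /gh; rewrite subr_ge0.
- move=> x /andP[mx xM].
  have [xz0|z0x] := leP x z0.1.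
    have h1 : concave_itv m M (fun x => h x - g x).
      move=> a b c ma ab bc cM; have := hconc a b c ma ab bc cM.
      by have := gconc a b c ma ab bc cM; lra.
    have := h1 m x z0.1 (lexx _) (ltW mx) xz0 (ltW z0M).
    have : 0 <= (z0.1 - x) * (h m - g m) by apply: mulr_ge0; [lra|rewrite subr_ge0; apply: gh; lra].
    have : 0 < (x - m) * (h z0.1 - g z0.1) by rewrite mulr_gt0 ?subr_gt0.
    move=> ? ? ?; suff : 0 < (z0.1 - m) * (h x - g x) by rewrite pmulr_rgt0 ?subr_gt0.
    lra.
  have h1 : concave_itv m M (fun x => h x - g x).
    move=> a b c ma ab bc cM; have := hconc a b c ma ab bc cM.
    by have := gconc a b c ma ab bc cM; lra.
  have := h1 z0.1 x M (ltW mz0) (ltW z0x) (ltW xM) (lexx _).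
  have : 0 <= (x - z0.1) * (h M - g M) by apply: mulr_ge0; [lra|rewrite subr_ge0; apply: gh; lra].
  have : 0 < (M - x) * (h z0.1 - g z0.1) by rewrite mulr_gt0 ?subr_gt0.
  move=> ? ? ?; suff : 0 < (M - z0.1) * (h x - g x) by rewrite pmulr_rgt0 ?subr_gt0.
  lra.
Qed.

End convex_body_graphs.

Section concave_arcs.
Context {R : realType}.
Variables (m M : R) (f : R -> R).
Hypothesis cf : concave_itv m M f.

Lemma concave_supergradient (x : R) : m < x < M ->
  exists s, forall y, m <= y <= M -> f y <= f x + s * (y - x).
Proof.
move=> /andP[mx xM].
pose S := [set (f y - f x) / (y - x) | y in [set y | x < y <= M]].
have left_slope y z : m <= y -> y < x -> x < z -> z <= M ->
    (f z - f x) / (z - x) <= (f x - f y) / (x - y).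
  move=> my yx xz zM; rewrite ler_pdivrMr ?subr_gt0// mulrAC ler_pdivlMr ?subr_gt0//.
  by have := cf my (ltW yx) (ltW xz) zM; lra.
have S0 : S !=set0 by exists ((f M - f x) / (M - x)), M => //=; rewrite xM lexx.
have uS : has_ubound S.
  exists ((f x - f m) / (x - m)) => _ [z /andP[xz zM] <-].
  exact: left_slope.
exists (sup S) => y /andP[my yM].
have [yx|xy|->] := ltgtP y x; last by rewrite subrr mulr0 addr0.
  have : sup S <= (f x - f y) / (x - y).
    by apply: ge_sup => // _ [z /andP[xz zM] <-]; exact: left_slope.
  by rewrite ler_pdivlMr ?subr_gt0//; lra.
have : (f y - f x) / (y - x) <= sup S.
  by apply: ub_le_sup => //; exists y => //=; rewrite xy.
by rewrite ler_pdivrMr ?subr_gt0//; lra.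
Qed.

Lemma concave_local_lower (x : R) : m < x < M ->
  exists2 k, 0 <= k & forall y, m <= y <= M -> f x - k * `|y - x| <= f y.
Proof.
move=> /andP[mx xM].
pose k1 := `|f M - f x| / (M - x); pose k2 := `|f m - f x| / (x - m).
have k10 : 0 <= k1 by rewrite divr_ge0//; lra.
have k20 : 0 <= k2 by rewrite divr_ge0//; lra.
exists (k1 + k2) => [|y /andP[my yM]]; first by rewrite addr_ge0.
have [yx|xy] := leP y x.
  have := cf (lexx m) my yx (ltW xM).
  rewrite ler0_norm; last by lra.
  have : - k2 * (x - m) <= f m - f x.
    by rewrite mulNr /k2 divfK ?gt_eqF ?subr_gt0// lerNl -normrN ler_norm.
  move=> h1 h2.
  suff : (x - m) * (f x - (k1 + k2) * - (y - x)) <= (x - m) * f y.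
    by rewrite ler_pM2l ?subr_gt0.
  have : 0 <= (x - m) * (k1 * (x - y)) by apply: mulr_ge0; [lra|apply: mulr_ge0 => //; lra].
  have : (x - y) * (- k2 * (x - m)) <= (x - y) * (f m - f x).
    by rewrite ler_wpM2l//; lra.
  lra.
have := cf (ltW mx) (ltW xy) yM (lexx _).
rewrite gtr0_norm; last by lra.
have : - k1 * (M - x) <= f M - f x.
  by rewrite mulNr /k1 divfK ?gt_eqF ?subr_gt0// lerNl -normrN ler_norm.
move=> h1 h2.
suff : (M - x) * (f x - (k1 + k2) * (y - x)) <= (M - x) * f y.
  by rewrite ler_pM2l ?subr_gt0.
have : 0 <= (M - x) * (k2 * (y - x)) by apply: mulr_ge0; [lra|apply: mulr_ge0 => //; lra].
have : (y - x) * (- k1 * (M - x)) <= (y - x) * (f M - f x).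
  by rewrite ler_wpM2l//; lra.
lra.
Qed.

Lemma concave_continuous (x : R) : m < x < M -> {for x, continuous f}.
Proof.
move=> xI; have [s hs] := concave_supergradient xI.
have [k k0 hk] := concave_local_lower xI.
apply/cvgrPdist_le => e e0.
pose K := k + `|s| + 1.
have K0 : 0 < K by rewrite /K; have := normr_ge0 s; lra.
have nb (r : R) : 0 < r -> \forall y \near x, `|x - y| <= r.
  by move=> r0; apply/nbhs_ballP; exists r => //= y /ltW.
near=> y.
have yI : m <= y <= M.
  by apply/andP; split; near: y; case/andP: xI => mx xM;
    [exact: lt_le_nbhsr|exact: lt_le_nbhsl].
have h1 := hs _ yI; have h2 := hk _ yI.
have h3 : s * (y - x) <= `|s| * `|y - x| by rewrite -normrM ler_norm.
have h4 : K * `|y - x| <= e.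
  rewrite -ler_pdivlMl// distrC; near: y.
  by apply: nb; rewrite mulr_gt0// invr_gt0.
have h5 : 0 <= `|s| * `|y - x| by rewrite mulr_ge0.
have h6 : 0 <= k * `|y - x| by rewrite mulr_ge0.
have h7 := normr_ge0 (y - x).
by rewrite ler_norml; apply/andP; split; rewrite /K in h4; lra.
Unshelve. all: by end_near.
Qed.

End concave_arcs.

(** ** Length of an arc between two abscissas *)

Section arc_length.
Context {R : realType}.

(** The excess of the length of a segment of slope [s] over its rise, per unit
    of run. It decreases with [s]: this is why the length of a concave arc minus
    its rise is convex in the abscissa. *)
Definition slack (s : R) : R := Num.sqrt (1 + s ^+ 2) - s.

Lemma slack_sqr (s : R) : (slack s + s) ^+ 2 = 1 + s ^+ 2.
Proof. by rewrite /slack subrK sqr_sqrtr// addr_ge0// sqr_ge0. Qed.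

Lemma slack_hyp_gt0 (s : R) : 0 < slack s + s.
Proof. by rewrite /slack subrK sqrtr_gt0 ltr_wpDr ?sqr_ge0. Qed.

Lemma slack_gt0 (s : R) : 0 < slack s.
Proof.
have := slack_sqr s; have := slack_hyp_gt0 s.
set t := slack s + s => t0 tE.
have st : slack s = t - s by rewrite /t addrK.
rewrite st subr_gt0.
have [s0|s0] := ltP s 0; first by lra.
by rewrite -(ltr_pXn2r (n := 2))// ?nnegrE ?ltW// tE ltrDr.
Qed.

Variables (m M : R) (f : R -> R).
Hypothesis cf : concave_itv m M f.
(** [sg] is 1 for an upper arc and -1 for a lower arc. *)
Variable sg : R.
Hypothesis sg2 : sg ^+ 2 = 1.

Section at_point.
Variables x s : R.
Hypothesis xI : m < x < M.
Hypothesis fs : forall y, m <= y <= M -> f y <= f x + s * (y - x).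

(** To the left of a point where [s] is a supergradient, the slopes are at least
    [s]. *)
Let left_slope a b : m <= a -> a <= b -> b <= x -> s * (b - a) <= f b - f a.
Proof.
move=> ma ab bx; case/andP: xI => mx xM.
have [bx'|xb] := ltP b x; last first.
  have -> : b = x by lra.
  by have := @fs a; lra.
have h1 := @cf a b x ma ab bx (ltW xM).
have h2 : f b <= f x + s * (b - x) by apply: fs; lra.
have h3 : 0 <= (b - a) * (f x + s * (b - x) - f b) by rewrite mulr_ge0//; lra.
suff : (x - b) * (s * (b - a)) <= (x - b) * (f b - f a) by rewrite ler_pM2l//; lra.
lra.
Qed.

(** The slopes on the arc are at least [s], and under this condition the parameter
    [f t + slack s * t] increases at least as fast as the arclength. *)
Lemma left_arc_cover y : m <= y <= x ->
  fine_cover [set z : plane R | y <= z.1 <= x /\ z.2 = sg * f z.1]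
             (f x - f y + slack s * (x - y)).
Proof.
move=> /andP[my yx].
have k0 := slack_gt0 s; have k2 := slack_sqr s; have t0 := slack_hyp_gt0 s.
pose psi (z : plane R) := sg * z.2 + slack s * z.1.
have psiE (z : plane R) : z.2 = sg * f z.1 -> psi z = f z.1 + slack s * z.1.
  by rewrite /psi => ->; rewrite mulrA -expr2 sg2 mul1r.
have incr a b : y <= a -> a <= b -> b <= x ->
    0 <= (f b + slack s * b) - (f a + slack s * a).
  move=> ya ab bx; have := left_slope (le_trans my ya) ab bx.
  by have : 0 <= (slack s + s) * (b - a) by [rewrite mulr_ge0//; lra]; lra.
have -> : f x - f y + slack s * (x - y) =
    (f x + slack s * x) - (f y + slack s * y) by ring.
apply: (@fine_cover_param R _ psi).
- by rewrite -subr_ge0; apply: incr.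
- move=> z [/andP[yz zx] zE]; rewrite (psiE _ zE); apply/andP; split.
    by rewrite -subr_ge0; apply: incr.
  by rewrite -subr_ge0; apply: incr.
- suff H z z' : y <= z.1 -> z.1 <= z'.1 -> z'.1 <= x -> z.2 = sg * f z.1 ->
      z'.2 = sg * f z'.1 -> eucl_dist z z' <= psi z' - psi z.
    move=> z z' [/andP[yz zx] zE] [/andP[yz' zx'] zE'].
    have [zz'|z'z] := leP z.1 z'.1.
      by rewrite distrC (le_trans (H z z' _ _ _ _ _))// ler_norm.
    have := H z' z yz' (ltW z'z) zx zE' zE.
    rewrite eucl_distE -[(z'.1 - _) ^+ 2]sqrrN opprB -[(z'.2 - _) ^+ 2]sqrrN opprB.
    by rewrite -eucl_distE => h; apply: le_trans h (ler_norm _).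
  move=> yz zz' zx zE zE'; rewrite !psiE//.
  have h0 := incr _ _ yz zz' zx.
  apply: ler_eucl_dist => //; rewrite zE zE' -mulrBr exprMn sg2 mul1r.
  have h1 := left_slope (le_trans my yz) zz' zx.
  set d := z'.1 - z.1 in h1 *; set e := f z'.1 - f z.1 in h1 *.
  have -> : (z.1 - z'.1) ^+ 2 + (f z.1 - f z'.1) ^+ 2 = d ^+ 2 + e ^+ 2.
    by rewrite /d /e; ring.
  have -> : f z'.1 + slack s * z'.1 - (f z.1 + slack s * z.1) = e + slack s * d.
    by rewrite /d /e; ring.
  have d0 : 0 <= d by rewrite /d; lra.
  have : 0 <= 2 * slack s * d * (e - s * d).
    by rewrite !mulr_ge0// ?(ltW k0)//; lra.
  have : d ^+ 2 * ((slack s + s) ^+ 2) = d ^+ 2 * (1 + s ^+ 2) by rewrite k2.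
  lra.
Qed.

(** The arc is projected orthogonally onto the direction of slope [s], that of a
    supporting line at [x]. *)
Lemma right_arc_ge (A : set (plane R)) y : x < y -> y < M ->
  (forall t, x < t <= y -> A (t, sg * f t)) ->
  ((f y - f x + slack s * (y - x))%:E <= arclength A)%E.
Proof.
move=> xy yM fA; case/andP: (xI) => mx xM.
have k0 := slack_gt0 s; have k2 := slack_sqr s; have t0 := slack_hyp_gt0 s.
set t := slack s + s in k2 t0.
pose phi (z : plane R) := (z.1 + s * (sg * z.2)) / t.
pose psi u := (u + s * f u) / t.
have phi1 z z' : `|phi z - phi z'| <= eucl_dist z z'.
  rewrite -(ler_pXn2r (n := 2))// ?nnegrE ?eucl_dist_ge0// eucl_dist_sqr.
  rewrite real_normK ?num_real//.
  have -> : phi z - phi z' = ((z.1 - z'.1) + s * (sg * (z.2 - z'.2))) / t.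
    by rewrite /phi; field; rewrite gt_eqF.
  rewrite expr_div_n ler_pdivrMr ?exprn_gt0// k2 -subr_ge0.
  set a := z.1 - z'.1; set b := z.2 - z'.2.
  have -> : (a ^+ 2 + b ^+ 2) * (1 + s ^+ 2) - (a + s * (sg * b)) ^+ 2 =
    (s * a - sg * b) ^+ 2 + (1 - sg ^+ 2) * (b ^+ 2 * (1 + s ^+ 2)).
    by ring.
  by rewrite sg2 subrr mul0r addr0 sqr_ge0.
have img : `]psi x, psi y] `<=` phi @` A.
  move=> v /=; rewrite in_itv/= => /andP[xv vy].
  have cpsi : {within `[x, y], continuous psi}.
    apply: continuous_in_subspaceT => u; rewrite inE/= in_itv/= => /andP[xu uy].
    rewrite /psi; apply: cvgMr_tmp; apply: cvgD; first exact: cvg_id.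
    by apply: cvgMl_tmp; apply: (concave_continuous cf); lra.
  have [|c] := @IVT R psi x y v (ltW xy) cpsi.
    by rewrite ge_min le_max (ltW xv) vy orbT.
  rewrite in_itv/= => /andP[xc cy] cv.
  have xc' : x < c.
    rewrite lt_neqAle xc andbT; apply/eqP => xE.
    by move: xv; rewrite -cv -xE ltxx.
  exists (c, sg * f c); first by apply: fA; rewrite xc'.
  by rewrite /phi /= [sg * (sg * _)]mulrA -expr2 sg2 mul1r.
apply: le_trans (arclength_ge phi1 img); rewrite lee_fin.
have fy : f y <= f x + s * (y - x) by apply: fs; lra.
have -> : psi y - psi x = ((y - x) + s * (f y - f x)) / t.
  by rewrite /psi; field; rewrite gt_eqF.
rewrite ler_pdivlMr//.
have st : 0 <= slack s * (s * (y - x) - (f y - f x)).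
  by apply: mulr_ge0; [exact: ltW|lra].
have -> : slack s = t - s by rewrite /t addrK.
have st' : 0 <= (t - s) * (s * (y - x) - (f y - f x)).
  by move: st; rewrite {1}(_ : slack s = t - s)// /t addrK.
have tt : (y - x) * t ^+ 2 = (y - x) * (1 + s ^+ 2) by rewrite k2.
lra.
Qed.

End at_point.
End arc_length.

(** * The law of a uniform boundary point on half-planes *)

Section boundary_law.
Context {R : realType}.
Implicit Types (K : set (plane R)).

(** A condition on plain maps rather than on random variables, so that they can be
    composed with isometries. *)
Definition boundary_law K d (T : measurableType d) (P : probability T R)
    (B : T -> plane R) : Prop :=
  measurable_fun setT B /\ forall A, measurable A ->
    P (B @^-1` A) = (arclength (A `&` boundary K) / arclength (boundary K))%E.

Lemma arclength_ge0 (A : set (plane R)) : (0 <= arclength A)%E.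
Proof.
apply: (@le_trans _ _ (hausdorff1_pre 1 A)); last first.
  by apply: ereal_sup_ubound; exists 1 => //=.
apply: le_ereal_inf_tmp => _ [E _ <-].
by apply: nneseries_ge0 => i _ _; exact: diam_ge0.
Qed.

Lemma measurable_fst_halfspace (i : interval R) :
  measurable [set z : plane R | z.1 \in i].
Proof.
have := @measurable_fst _ _ R R measurableT [set` i] (measurable_itv _).
by rewrite setTI.
Qed.

Section convexity.
Variables (K : set (plane R)) (d : measure_display) (T : measurableType d).
Variables (P : probability T R) (B : T -> plane R).
Hypotheses (hK : convex_body K) (hB : boundary_law K P B).
Variables (m M : R) (g' h : R -> R).
Hypothesis gK : graph_body K m M g' h.

Let S := boundary K.
Let C x := h x + g' x.

Definition perimeter (K : set (plane R)) : R := fine (arclength (boundary K)).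
Local Notation L := (perimeter K).

(** The existence of a uniform boundary point forces the perimeter to be positive
    and finite, as quotients by [0] and by infinity do not have total mass 1. *)
Lemma perimeterP : (arclength S = L%:E)%E /\ 0 < L.
Proof.
have [_ hP] := hB; have := hP setT measurableT.
rewrite preimage_setT probability_setT setTI -/S /perimeter -/S.
have := arclength_ge0 S; case: (arclength S) => [r| |]//=.
- rewrite lee_fin => r0 e; split => //.
  rewrite lt_neqAle r0 andbT eq_sym; apply/eqP => rE.
  by move: e; rewrite rE mul0e => /eqP; rewrite onee_eq0.
- by move=> _; rewrite invey mule0 => /eqP; rewrite onee_eq0.
Qed.

Definition prob_in (A : set (plane R)) : R := fine (P (B @^-1` A)).
Local Notation pr := prob_in.

Let mB (A : set (plane R)) : measurable A -> measurable (B @^-1` A).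
Proof. by move=> mA; have [mB _] := hB; rewrite -[X in measurable X]setTI; exact: mB. Qed.

Lemma prob_inE A : measurable A -> P (B @^-1` A) = (pr A)%:E.
Proof. by move=> mA; rewrite /prob_in fineK//; exact: fin_num_measure (mB mA). Qed.

Lemma prob_in_ge0 A : 0 <= pr A.
Proof. by rewrite fine_ge0. Qed.

Lemma prob_in_arclength A : measurable A ->
  (arclength (A `&` S) = (pr A * L)%:E)%E.
Proof.
move=> mA; have [SL L0] := perimeterP; have [_ hP] := hB.
have := hP _ mA; rewrite prob_inE// -/S SL inver gt_eqF//.
move=> /(congr1 (fun x => x * L%:E)%E).
by rewrite EFinM => ->; rewrite -muleA -EFinM mulVf ?gt_eqF// mule1.
Qed.

Lemma prob_in_le A c : measurable A -> fine_cover (A `&` S) c -> pr A * L <= c.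
Proof.
by move=> mA /fine_cover_arclength; rewrite prob_in_arclength// lee_fin.
Qed.

Lemma prob_inU A1 A2 : measurable A1 -> measurable A2 -> A1 `&` A2 = set0 ->
  pr (A1 `|` A2) = pr A1 + pr A2.
Proof.
move=> m1 m2 A12; apply: EFin_inj.
rewrite EFinD -!prob_inE//; last exact: measurableU.
rewrite preimage_setU measureU//; try exact: mB.
by rewrite -preimage_setI A12 preimage_set0.
Qed.

Lemma prob_inS A1 A2 : measurable A1 -> measurable A2 -> A1 `<=` A2 -> pr A1 <= pr A2.
Proof.
move=> m1 m2 A12; rewrite -lee_fin -!prob_inE//.
by apply: le_measure; rewrite ?inE; [exact: mB|exact: mB|exact: preimage_subset].
Qed.

Let closedK : closed K.
Proof. by case: hK => cK _ _; exact: compact_closed. Qed.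

Lemma boundaryP z : S z <-> K z /\
  ~ (m < z.1 < M /\ - g' z.1 < z.2 < h z.1).
Proof.
have [mM memK _ ltK ch cg] := gK.
rewrite /S /boundary setDE; have <- : K = closure K by exact/closure_id.
split=> [[Kz nI]|[Kz nz]]; split => //.
  move=> [zI /andP[gz zh]]; apply: nI; apply/interior_boxP.
  case/andP: (zI) => mz zM.
  pose eta := Num.min (h z.1 - z.2) (z.2 + g' z.1) / 2.
  have eta0 : 0 < eta by rewrite divr_gt0// lt_min; apply/andP; split; lra.
  have etah : 2 * eta <= h z.1 - z.2.
    by rewrite /eta mulrC divfK// ge_min lexx.
  have etag : 2 * eta <= z.2 + g' z.1.
    by rewrite /eta mulrC divfK// ge_min lexx orbT.
  have near_val f : concave_itv m M f -> exists2 e, 0 < e &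
      forall x, `|z.1 - x| < e -> `|f z.1 - f x| < eta.
    move=> cf; have /cvgrPdist_lt /(_ _ eta0) := concave_continuous cf zI.
    by move=> /nbhs_ballP[e /= e0 he]; exists e.
  have [e1 e10 h1] := near_val _ ch; have [e2 e20 h2] := near_val _ cg.
  exists (Num.min (Num.min e1 e2) (Num.min eta (Num.min (z.1 - m) (M - z.1)))).
    by rewrite !lt_min e10 e20 eta0 !subr_gt0 mz.
  move=> z'; rewrite !lt_min => /andP[/andP[d1 d2] /andP[d3 /andP[d4 d5]]].
  move=> /andP[_ /andP[d6 _]]; apply/memK.
  move: (h1 _ d1) (h2 _ d2) d4 d5 d6.
  rewrite !ltr_norml => /andP[? ?] /andP[? ?] /andP[? ?] /andP[? ?] /andP[? ?].
  by split; apply/andP; split; lra.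
move=> /interior_boxP[e e0 hz]; apply: nz.
have box (a b : R) : `|a| < e -> `|b| < e -> K (z.1 + a, z.2 + b).
  by move=> ae be; apply: hz => /=; rewrite opprD addNKr normrN.
have e2 : `|e / 2| < e by rewrite ger0_norm; lra.
have Ne2 : `|- (e / 2)| < e by rewrite normrN.
have e00 : `|0 : R| < e by rewrite normr0.
have /memK[/= /andP[? ?] _] := box _ _ e2 e00.
have /memK[/= /andP[? ?] _] := box _ _ Ne2 e00.
have /memK[/= _] := box _ _ e00 e2; rewrite addr0 => /andP[? ?].
have /memK[/= _] := box _ _ e00 Ne2; rewrite addr0 => /andP[? ?].
by split; apply/andP; split; lra.
Qed.

Lemma boundary_top x : m <= x <= M -> S (x, h x).
Proof.
move=> xI; have [_ memK leK _ _ _] := gK; apply/boundaryP; split.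
  by apply/memK => /=; split => //; have := leK _ xI; lra.
by move=> /= [_ /andP[_]]; rewrite ltxx.
Qed.

Lemma boundary_bottom x : m <= x <= M -> S (x, - g' x).
Proof.
move=> xI; have [_ memK leK _ _ _] := gK; apply/boundaryP; split.
  by apply/memK => /=; split => //; have := leK _ xI; lra.
by move=> /= [_ /andP[]]; rewrite ltxx.
Qed.

Lemma boundary_inner z : S z -> m < z.1 < M -> z.2 = 1 * h z.1 \/ z.2 = -1 * g' z.1.
Proof.
have [_ memK _ _ _ _] := gK.
move=> /boundaryP[/memK[_ /andP[gz zh]] nz] zI.
have [|zh'] := eqVneq z.2 (h z.1); first by rewrite mul1r; left.
have [|zg'] := eqVneq z.2 (- g' z.1); first by rewrite mulN1r; right.
by case: nz; split => //; rewrite !lt_neqAle gz zh zh' eq_sym zg'.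
Qed.

Lemma boundary_range z : S z -> m <= z.1 <= M /\ - g' z.1 <= z.2 <= h z.1.
Proof. by have [_ memK _ _ _ _] := gK; move=> /boundaryP[/memK]. Qed.

Local Notation half x := [set z : plane R | z.1 \in `]-oo, x]].
Local Notation strip x y := [set z : plane R | z.1 \in `]x, y]].

Lemma prob_strip x y : x <= y -> pr (half y) = pr (half x) + pr (strip x y).
Proof.
move=> xy; rewrite -prob_inU; try exact: measurable_fst_halfspace.
  congr pr; apply/seteqP; split => z /=; rewrite !in_itv/=.
    by have [zx|xz] := leP z.1 x; [left|right].
  by move=> [zx|/andP[]//]; exact: le_trans xy.
rewrite -subset0 => z /= []; rewrite !in_itv/= => zx /andP[xz _].
by move: (le_lt_trans zx xz); rewrite ltxx.
Qed.

Section inner_point.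
Variables x s s' : R.
Hypothesis xI : m < x < M.
Hypothesis hs : forall y, m <= y <= M -> h y <= h x + s * (y - x).
Hypothesis gs : forall y, m <= y <= M -> g' y <= g' x + s' * (y - x).

Let phi := slack s + slack s'.
Let one2 : (1 : R) ^+ 2 = 1. Proof. by rewrite expr1n. Qed.
Let mone2 : (-1 : R) ^+ 2 = 1. Proof. by rewrite sqrrN expr1n. Qed.

(** Upper bounds for the lengths of the two arcs add up without any measurability. *)
Lemma strip_left y : m <= y -> y <= x ->
  pr (strip y x) * L <= C x - C y + phi * (x - y).
Proof.
move=> my yx; have [_ _ _ _ ch cg] := gK; case/andP: xI => mx xM.
apply: prob_in_le; first exact: measurable_fst_halfspace.
have yI : m <= y <= x by rewrite my.
have := fine_coverU (left_arc_cover ch one2 xI hs yI) (left_arc_cover cg mone2 xI gs yI).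
apply: fine_coverS; last by rewrite /C /phi; lra.
move=> z /= []; rewrite in_itv/= => /andP[yz zx] Sz.
have zI : m < z.1 < M by lra.
by case: (boundary_inner Sz zI) => ->; [left|right]; rewrite /= ltW.
Qed.

(** Lower bounds for the lengths of the two arcs add up because the law of [B] is
    additive and the line through the midpoints of the chords at [x] and [y]
    separates the arcs. *)
Lemma strip_right y : x < y -> y < M ->
  C y - C x + phi * (y - x) <= pr (strip x y) * L.
Proof.
move=> xy yM; have [mM memK leK ltK ch cg] := gK; case/andP: (xI) => mx xM.
have yI : m < y < M by lra.
pose l (t : R) := ((y - t) * ((h x - g' x) / 2) + (t - x) * ((h y - g' y) / 2)) / (y - x).
have yx0 : 0 < y - x by lra.
have lE t : (y - x) * l t = (y - t) * ((h x - g' x) / 2) + (t - x) * ((h y - g' y) / 2).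
  by rewrite /l mulrC divfK// gt_eqF.
have Cx := ltK _ xI; have Cy := ltK _ yI.
have lh t : x <= t <= y -> l t < h t.
  move=> /andP[xt ty]; rewrite -(ltr_pM2l yx0) lE.
  have := ch _ _ _ (ltW mx) xt ty (ltW yM).
  suff : 0 < (y - t) * (h x + g' x) + (t - x) * (h y + g' y) by lra.
  have [ty'|ty'] := ltP t y.
    by apply: ltr_pwDl; [rewrite mulr_gt0//; lra|rewrite mulr_ge0//; lra].
  by apply: ltr_wpDl; [rewrite mulr_ge0//; lra|rewrite mulr_gt0//; lra].
have lg t : x <= t <= y -> - g' t < l t.
  move=> /andP[xt ty]; rewrite -(ltr_pM2l yx0) lE.
  have := cg _ _ _ (ltW mx) xt ty (ltW yM).
  suff : 0 < (y - t) * (h x + g' x) + (t - x) * (h y + g' y) by lra.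
  have [ty'|ty'] := ltP t y.
    by apply: ltr_pwDl; [rewrite mulr_gt0//; lra|rewrite mulr_ge0//; lra].
  by apply: ltr_wpDl; [rewrite mulr_ge0//; lra|rewrite mulr_gt0//; lra].
have ml : measurable_fun setT (fun z : plane R => l z.1).
  apply: measurable_funM => //; apply: measurable_funD.
    by apply: measurable_funM => //; apply: measurable_funB => //; exact: measurable_fst.
  by apply: measurable_funM => //; apply: measurable_funB => //; exact: measurable_fst.
pose up : set (plane R) := [set z | l z.1 <= z.2].
have mup : measurable up.
  have := measurable_fun_ler ml (@measurable_snd _ _ R R).
  move=> /(_ measurableT [set true] I); rewrite setTI.
  by congr measurable; apply/seteqP; split => z /=.
have -> : strip x y = (strip x y `&` up) `|` (strip x y `&` ~` up).
  by rewrite -setIUr setUv setIT.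
have ms := measurable_fst_halfspace `]x, y].
have mu1 : measurable (strip x y `&` up) by exact: measurableI.
have mu2 : measurable (strip x y `&` ~` up).
  by apply: measurableI => //; exact: measurableC.
rewrite prob_inU//; last by rewrite setIACA setICr setI0.
have I1 : h y - h x + slack s * (y - x) <= pr (strip x y `&` up) * L.
  rewrite -lee_fin -prob_in_arclength//.
  apply: (right_arc_ge ch one2 xI hs xy yM) => t /andP[xt ty].
  have tI : x <= t <= y by rewrite ltW.
  split; [split|]; rewrite /= ?in_itv/= ?xt ?ty// mul1r.
    exact/ltW/lh.
  by apply: boundary_top; lra.
have I2 : g' y - g' x + slack s' * (y - x) <= pr (strip x y `&` ~` up) * L.
  rewrite -lee_fin -prob_in_arclength//.
  apply: (right_arc_ge cg mone2 xI gs xy yM) => t /andP[xt ty].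
  have tI : x <= t <= y by rewrite ltW.
  split; [split|]; rewrite /= ?in_itv/= ?xt ?ty// mulN1r.
    by apply/negP; rewrite -ltNge lg.
  by apply: boundary_bottom; lra.
rewrite /C /phi mulrDl; lra.
Qed.

End inner_point.

End convexity.
End boundary_law.

Section excess_convexity.
Context {R : realType}.
Variables (K : set (plane R)) (d : measure_display) (T : measurableType d).
Variables (P : probability T R) (B : T -> plane R).
Hypotheses (hK : convex_body K) (hB : boundary_law K P B).
Variables (m M : R) (g' h : R -> R).
Hypothesis gK : graph_body K m M g' h.

Local Notation S := (boundary K).
Local Notation C x := (h x + g' x).
Local Notation L := (perimeter K).
Local Notation pr := (prob_in P B).
Local Notation half x := [set z : plane R | z.1 \in `]-oo, x]].
Local Notation strip x y := [set z : plane R | z.1 \in `]x, y]].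

(** Every horizontal line that meets the chord of abscissa [x] meets the boundary
    at its leftmost point in [K], hence to the left of [x]. *)
Lemma half_ge x : m <= x <= M -> C x <= pr (half x) * L.
Proof.
move=> xI; have [mM memK leK ltK ch cg] := gK; have [cK vK _] := hK.
rewrite -lee_fin -(prob_in_arclength hB); last exact: measurable_fst_halfspace.
have -> : C x = h x - (- g' x) by rewrite opprK.
apply: (@arclength_ge _ _ snd).
  move=> z z'; rewrite -(ler_pXn2r (n := 2))// ?nnegrE ?eucl_dist_ge0//.
  by rewrite eucl_dist_sqr real_normK ?num_real// lerDr sqr_ge0.
move=> v /=; rewrite in_itv/= => /andP[gv vh].
have Kxv : K (x, v) by apply/memK; split => //=; rewrite ltW.
have [|||z [Kz zv] zmin] := @compact_min _ (K `&` snd @^-1` [set v]) fst.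
- exact: continuous_plane_fst.
- by apply: compact_level => //; exact: continuous_plane_snd.
- by exists (x, v).
exists z => //; split.
  by rewrite /= in_itv/=; exact: (zmin (x, v)).
split; first exact: subset_closure.
move=> /interior_boxP[e e0 hz].
have : K (z.1 - e / 2, z.2).
  apply: hz => /=; last by rewrite subrr normr0.
  by rewrite opprB addrC subrK ger0_norm; lra.
move=> Kz'; have := zmin (z.1 - e / 2, z.2) (conj Kz' zv).
by rewrite /=; lra.
Qed.

(** On the leftmost line the boundary is the chord itself. *)
Lemma half_left_le : pr (half m) * L <= C m.
Proof.
have [mM memK leK ltK ch cg] := gK.
apply: (prob_in_le hB); first exact: measurable_fst_halfspace.
have -> : C m = h m - (- g' m) by rewrite opprK.
have Cm : 0 <= C m by apply: leK; lra.
have onface z : (half m `&` S) z -> z.1 = m /\ - g' m <= z.2 <= h m.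
  move=> []; rewrite /= in_itv/= => zm Sz.
  have [/andP[mz _]] := boundary_range hK gK Sz.
  by have -> : z.1 = m by lra.
apply: (@fine_cover_param _ _ snd).
- by lra.
- by move=> z /onface[].
- move=> z z' /onface[zE _] /onface[zE' _].
  by apply: ler_eucl_dist => //; rewrite zE zE' subrr expr0n/= add0r real_normK ?num_real.
Qed.

Lemma half_out x : x < m -> pr (half x) = 0.
Proof.
move=> xm; have [SL L0] := perimeterP hB.
have : pr (half x) * L <= 0.
  apply: (prob_in_le hB); first exact: measurable_fst_halfspace.
  apply: fine_coverS (fine_cover_point 0) => //.
  move=> z [/=]; rewrite in_itv/= => zx /(boundary_range hK gK)[/andP[mz _] _].
  by move: (le_lt_trans (le_trans mz zx) xm); rewrite ltxx.
rewrite pmulr_lle0// => h1; apply/eqP; rewrite eq_le h1 prob_in_ge0//.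
Qed.

Lemma half_full x : M <= x -> pr (half x) = 1.
Proof.
move=> Mx; have [SL L0] := perimeterP hB.
apply: EFin_inj; rewrite -(prob_inE hB); last exact: measurable_fst_halfspace.
have [_ ->] := hB; last exact: measurable_fst_halfspace.
have -> : half x `&` S = S.
  apply/seteqP; split => [z []//|z Sz]; split => //; rewrite /= in_itv/=.
  by have [/andP[_ zM] _] := boundary_range hK gK Sz; exact: le_trans Mx.
by rewrite SL inver gt_eqF// -EFinM divff// gt_eqF.
Qed.

Lemma vertical_line x : m < x < M -> pr [set z : plane R | z.1 \in `[x, x]] = 0.
Proof.
move=> xI; have [SL L0] := perimeterP hB.
have : pr [set z : plane R | z.1 \in `[x, x]] * L <= 0 + 0.
  apply: (prob_in_le hB); first exact: measurable_fst_halfspace.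
  apply: fine_coverS (fine_coverU (fine_cover_point (x, 1 * h x))
    (fine_cover_point (x, -1 * g' x))) => //.
  move=> z [/=]; rewrite in_itv/= => /andP[xz zx] Sz.
  have zE : z.1 = x by apply/eqP; rewrite eq_le zx xz.
  have zI : m < z.1 < M by rewrite zE.
  by case: (boundary_inner hK gK Sz zI); rewrite zE => z2; [left|right];
    rewrite [z]surjective_pairing zE z2.
by rewrite addr0 pmulr_lle0// => h1; apply/eqP; rewrite eq_le h1 prob_in_ge0.
Qed.

(** The part of the distribution function of the abscissa of a uniform boundary
    point that is not proportional to the chord length. *)
Definition excess (x : R) : R := pr (half x) - C x / L.

Let L0 : 0 < L. Proof. by case: (perimeterP hB). Qed.

Let excessE x : excess x * L = pr (half x) * L - C x.
Proof. by rewrite /excess mulrBl divfK// gt_eqF. Qed.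

Lemma excess_ge0 x : m <= x <= M -> 0 <= excess x.
Proof.
move=> xI; rewrite -(pmulr_lge0 _ L0) excessE subr_ge0; exact: half_ge.
Qed.

Lemma excess_left : excess m = 0.
Proof.
have [mM _ _ _ _ _] := gK.
apply/eqP; rewrite eq_le; apply/andP; split; last first.
  by apply: excess_ge0; rewrite lexx ltW.
by rewrite -(pmulr_lle0 _ L0) excessE subr_le0; exact: half_left_le.
Qed.

Lemma excess_right : excess M <= 1.
Proof.
have [mM _ leK _ _ _] := gK.
rewrite /excess half_full// gerBl divr_ge0 ?(ltW L0)//.
by apply: leK; rewrite lexx ltW.
Qed.

(** The supporting lines of the excess come from the supergradients of the two
    arcs. On the right, the estimate passes to the limit at the endpoint [M],
    where the arcs may meet or be joined by a segment. *)
Lemma excess_convex x y z : m <= x -> x <= y -> y <= z -> z <= M ->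
  (z - x) * excess y <= (z - y) * excess x + (y - x) * excess z.
Proof.
move=> mx xy yz zM; have [mM memK leK ltK ch cg] := gK.
have [->|xy'] := eqVneq x y; first by rewrite subrr mul0r addr0.
have [->|yz'] := eqVneq y z; first by rewrite subrr mul0r add0r.
have {}xy : x < y by rewrite lt_neqAle xy'.
have {}yz : y < z by rewrite lt_neqAle yz'.
have yI : m < y < M by rewrite (le_lt_trans mx xy) (lt_le_trans yz zM).
have /andP[my _] := yI.
have [s hs] := concave_supergradient ch yI.
have [s' gs] := concave_supergradient cg yI.
pose phi := slack s + slack s'.
have left_ineq : (excess y - excess x) * L <= phi * (y - x).
  have := strip_left hK hB gK yI hs gs mx (ltW xy).
  rewrite mulrBl !excessE (prob_strip hB (ltW xy)) mulrDl -/phi; lra.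
have inner_right t : y < t -> t < M -> phi * (t - y) <= (excess t - excess y) * L.
  move=> yt tM; have := strip_right hK hB gK yI hs gs yt tM.
  rewrite mulrBl !excessE (prob_strip hB (ltW yt)) mulrDl -/phi; lra.
have right_ineq : phi * (z - y) <= (excess z - excess y) * L.
  have [zM'|Mz] := ltP z M; first exact: inner_right.
  have {zM Mz}zE : z = M by apply/eqP; rewrite eq_le zM.
  rewrite zE; have yM : y < M by rewrite -zE.
  rewrite leNgt; apply/negP => lt1.
  pose D := phi * (M - y) + (C M - C y).
  have hD t : y < t -> t < M -> (t - y) * D <= (M - y) * (pr (half M) * L - pr (half y) * L).
    move=> yt tM; have := inner_right t yt tM.
    rewrite mulrBl !excessE => h1.
    have := cg _ _ _ (ltW my) (ltW yt) (ltW tM) (lexx _).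
    have := ch _ _ _ (ltW my) (ltW yt) (ltW tM) (lexx _) => h2 h3.
    have h4 : pr (half t) <= pr (half M).
      by rewrite (prob_strip hB (ltW tM)) lerDl prob_in_ge0.
    have h5 : (M - y) * (pr (half t) * L) <= (M - y) * (pr (half M) * L).
      by rewrite !ler_wpM2l ?ler_wpM2r ?(ltW L0)// subr_ge0 ltW.
    have h6 : (M - y) * (phi * (t - y)) <= (M - y) * (pr (half t) * L - C t - (pr (half y) * L - C y)).
      by rewrite ler_wpM2l// subr_ge0 ltW.
    rewrite /D; lra.
  pose a := pr (half M) * L - pr (half y) * L.
  have aD : a < D by move: lt1; rewrite mulrBl !excessE /a /D; lra.
  have a0 : 0 <= a.
    by rewrite /a -mulrBl mulr_ge0 ?(ltW L0)// (prob_strip hB (ltW yM)) addrC addKr prob_in_ge0.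
  pose t := y + (M - y) * ((a + D) / (2 * D)).
  have D0 : 0 < D by lra.
  have q1 : (a + D) / (2 * D) < 1 by rewrite ltr_pdivrMr; lra.
  have q0 : 0 < (a + D) / (2 * D) by rewrite divr_gt0; lra.
  have My : 0 < M - y by rewrite subr_gt0.
  have yt : y < t by rewrite /t ltrDl mulr_gt0.
  have tM : t < M.
    have : (M - y) * ((a + D) / (2 * D)) < (M - y) * 1 by rewrite ltr_pM2l.
    by rewrite /t; lra.
  have := hD t yt tM; rewrite /t -/a [y + _]addrC addrK -mulrA ler_pM2l//.
  have -> : (a + D) / (2 * D) * D = (a + D) / 2 by field; rewrite gt_eqF.
  lra.
rewrite -(ler_pM2r L0).
have h1 : (z - y) * ((excess y - excess x) * L) <= (z - y) * (phi * (y - x)).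
  by rewrite ler_wpM2l// subr_ge0 ltW.
have h2 : (y - x) * (phi * (z - y)) <= (y - x) * ((excess z - excess y) * L).
  by rewrite ler_wpM2l// subr_ge0 ltW.
lra.
Qed.

End excess_convexity.

(** * Orthogonal maps of the plane *)

Section orthogonal_maps.
Context {R : realType}.
Implicit Types (A K : set (plane R)).

Definition lin (a b c d : R) (z : plane R) : plane R :=
  (a * z.1 + b * z.2, c * z.1 + d * z.2).

Lemma continuous_lin (a b c d : R) : continuous (lin a b c d).
Proof.
move=> z; have c1 : fst x @[x --> z] --> z.1 by exact: continuous_plane_fst.
have c2 : snd x @[x --> z] --> z.2 by exact: continuous_plane_snd.
have h u v : u * x.1 + v * x.2 @[x --> z] --> u * z.1 + v * z.2.
  by apply: cvgD; apply: cvgMl_tmp.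
exact: (cvg_pair (h a b) (h c d)).
Qed.

Lemma measurable_lin (a b c d : R) : measurable_fun setT (lin a b c d).
Proof.
apply: measurable_fun_pair; apply: measurable_funD; apply: measurable_funM => //;
  solve [exact: measurable_fst | exact: measurable_snd].
Qed.

(** Orthonormality of the columns and of the rows are both recorded, so that
    passing to the transpose needs no argument. *)
Definition orthogonal (a b c d : R) : Prop :=
  [/\ a ^+ 2 + c ^+ 2 = 1, b ^+ 2 + d ^+ 2 = 1, a * b + c * d = 0 &
      [/\ a ^+ 2 + b ^+ 2 = 1, c ^+ 2 + d ^+ 2 = 1 & a * c + b * d = 0]].

Lemma orthogonal_tr (a b c d : R) : orthogonal a b c d -> orthogonal a c b d.
Proof. by move=> [? ? ? [? ? ?]]. Qed.

Lemma linK (a b c d : R) : orthogonal a b c d -> cancel (lin a b c d) (lin a c b d).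
Proof.
move=> [h1 h2 h3 _] [x y]; rewrite /lin /=; congr (_, _).
  transitivity ((a ^+ 2 + c ^+ 2) * x + (a * b + c * d) * y); first by ring.
  by rewrite h1 h3; ring.
transitivity ((a * b + c * d) * x + (b ^+ 2 + d ^+ 2) * y); first by ring.
by rewrite h2 h3; ring.
Qed.

Lemma eucl_dist_lin (a b c d : R) z z' : orthogonal a b c d ->
  eucl_dist (lin a b c d z) (lin a b c d z') = eucl_dist z z'.
Proof.
move=> [h1 h2 h3 _]; rewrite !eucl_distE /lin /=; congr Num.sqrt.
transitivity ((a ^+ 2 + c ^+ 2) * (z.1 - z'.1) ^+ 2 +
  (b ^+ 2 + d ^+ 2) * (z.2 - z'.2) ^+ 2 +
  2 * (a * b + c * d) * ((z.1 - z'.1) * (z.2 - z'.2))); first by ring.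
by rewrite h1 h2 h3; ring.
Qed.

Lemma preimage_linK (a b c d : R) A : orthogonal a b c d ->
  lin a b c d @^-1` (lin a c b d @^-1` A) = A.
Proof.
by move=> o; apply/seteqP; split => z /=; rewrite (linK o).
Qed.

Let arclength_lin_le (a b c d : R) A : orthogonal a b c d ->
  (arclength (lin a b c d @^-1` A) <= arclength A)%E.
Proof.
move=> o; apply: ge_ereal_sup => _ [delta delta0 <-].
apply: (@le_trans _ _ (hausdorff1_pre delta A)); last first.
  by apply: ereal_sup_ubound; exists delta.
apply: le_ereal_inf_tmp => _ [E [AE Ed] <-].
have dE i : (diam (lin a b c d @^-1` (E i)) <= diam (E i))%E.
  apply: ge_ereal_sup => _ [->|[z Ez [z' Ez' <-]]]; first exact: diam_ge0.
  by rewrite -(eucl_dist_lin _ _ o) le_diam.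
apply: (@le_trans _ _ (\sum_(0 <= i <oo) diam (lin a b c d @^-1` (E i)))%E).
  apply: ereal_inf_lbound; exists (fun i => lin a b c d @^-1` (E i)) => //.
  split; first by move=> z /AE[i _ Ei]; exists i.
  by move=> i; exact: le_trans (dE i) (Ed i).
by apply: lee_nneseries => [i _ _|i _]; [exact: diam_ge0|exact: dE].
Qed.

Lemma arclength_lin (a b c d : R) A : orthogonal a b c d ->
  arclength (lin a b c d @^-1` A) = arclength A.
Proof.
move=> o; apply/eqP; rewrite eq_le arclength_lin_le//=.
have o' := orthogonal_tr o.
have := @arclength_lin_le a c b d (lin a b c d @^-1` A) o'.
by rewrite (preimage_linK A o').
Qed.

Lemma interior_lin (a b c d : R) A : orthogonal a b c d ->
  interior (lin a b c d @^-1` A) = lin a b c d @^-1` (interior A).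
Proof.
move=> o; have o' := orthogonal_tr o; apply/seteqP; split => z.
  rewrite /interior /= => h.
  have : nbhs (lin a b c d z) (lin a c b d @^-1` (lin a b c d @^-1` A)).
    apply: (@continuous_lin a c b d); rewrite (linK o); exact: h.
  by rewrite (preimage_linK _ o').
by rewrite /interior /= => h; exact: (@continuous_lin a b c d).
Qed.

Lemma convex_body_closed K : convex_body K -> closed K.
Proof. by case=> cK _ _; exact: compact_closed. Qed.

Lemma preimage_lin_image (a b c d : R) A : orthogonal a b c d ->
  lin a b c d @^-1` A = lin a c b d @` A.
Proof.
move=> o; have o' := orthogonal_tr o; apply/seteqP; split => [z Az|_ [z Az <-]].
  by exists (lin a b c d z) => //; rewrite (linK o).
by rewrite /= (linK o').
Qed.

Lemma convex_body_lin (a b c d : R) K : orthogonal a b c d -> convex_body K ->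
  convex_body (lin a b c d @^-1` K).
Proof.
move=> o [cK vK [z Kz]]; split.
- rewrite preimage_lin_image//; apply: continuous_compact => //.
  exact/continuous_subspaceT/continuous_lin.
- move=> x y t; rewrite !inE /= => Kx Ky.
  have t01 : 0 <= t%:num <= 1 by apply/andP; split.
  have -> : conv t x y = (t%:num * x.1 + (1 - t%:num) * y.1,
    t%:num * x.2 + (1 - t%:num) * y.2) by [].
  have := convex_set_comb vK Kx Ky t01.
  by congr K; rewrite /lin /=; congr (_, _); ring.
- exists (lin a c b d z); rewrite interior_lin//= (linK (orthogonal_tr o))//.
Qed.

Lemma boundary_lin (a b c d : R) K : orthogonal a b c d -> convex_body K ->
  boundary (lin a b c d @^-1` K) = lin a b c d @^-1` (boundary K).
Proof.
move=> o hK; have hK' := convex_body_lin o hK.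
rewrite /boundary -(closure_id _).1; last exact: convex_body_closed.
rewrite -(closure_id K).1; last exact: convex_body_closed.
by rewrite interior_lin// preimage_setD.
Qed.

Lemma boundary_law_lin (a b c e : R) K d (T : measurableType d)
    (P : probability T R) (B : T -> plane R) : orthogonal a b c e ->
  convex_body K -> boundary_law K P B ->
  boundary_law (lin a c b e @^-1` K) P (lin a b c e \o B).
Proof.
move=> o hK [mB hB]; have o' := orthogonal_tr o; split.
  by apply: measurableT_comp mB; exact: measurable_lin.
move=> A mA.
have mA' : measurable (lin a b c e @^-1` A).
  by rewrite -[X in measurable X]setTI; exact: measurable_lin.
have -> := boundary_lin o' hK.
have -> := arclength_lin (boundary K) o'.
have <- := arclength_lin (A `&` lin a c b e @^-1` boundary K) o.
rewrite preimage_setI (preimage_linK _ o).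
exact: hB.
Qed.

End orthogonal_maps.

(** * Mean distances on the line *)

Section mean_distance.
Context {R : realType}.
Local Notation mu := (@lebesgue_measure R).

(** Open sets of the plane are countable unions of boxes with rational corners. *)
Lemma closed_plane_measurable (K : set (plane R)) : closed K -> measurable K.
Proof.
move=> clK; rewrite -[K]setCK; apply: measurableC.
have opK : open (~` K) by exact: closed_openC.
pose box (i : rat * rat * (rat * rat)) : set (plane R) :=
  `]ratr i.1.1, ratr i.1.2[%classic `*` `]ratr i.2.1, ratr i.2.2[%classic.
have -> : ~` K = \bigcup_i (if pselect (box i `<=` ~` K) then box i else set0).
  apply/seteqP; split => [z nKz|z [i _]]; last by case: pselect => //= h; exact: h.
  have /interior_boxP[e e0 hz] : interior (~` K) z by exact: opK.
  have below (x : R) : exists q : rat, x - e < ratr q < x.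
    have /rat_in_itvoo[q] : x - e < x by lra.
    by rewrite in_itv/= => hq; exists q.
  have above (x : R) : exists q : rat, x < ratr q < x + e.
    have /rat_in_itvoo[q] : x < x + e by lra.
    by rewrite in_itv/= => hq; exists q.
  have [a ha] := below z.1; have [b hb] := above z.1.
  have [a' ha'] := below z.2; have [b' hb'] := above z.2.
  exists ((a, b), (a', b')) => //; case: pselect => [h|nh] /=.
    by rewrite /box /= !in_itv/=; split; apply/andP; split; lra.
  exfalso; apply: nh => z' []; rewrite /= !in_itv/= => h1 h2.
  by apply: hz; rewrite ltr_norml; lra.
apply: countable_bigcupT_measurable => // i.
by case: pselect => //= _; exact: measurableX.
Qed.

Lemma measurable_halfline (d : measure_display) (T : measurableType d) (Y : T -> R) z :
  measurable_fun setT Y -> measurable [set w | Y w <= z].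
Proof.
move=> mY; have -> : [set w | Y w <= z] = setT `&` Y @^-1` `]-oo, z].
  by apply/seteqP; split => w /=; rewrite in_itv/=; [split|case].
exact: mY.
Qed.

(** [|Y1 - Y2|] is the length of the set of levels [z] separating [Y1] from [Y2],
    and a level separates them with probability [2 * F z * (1 - F z)]. *)
Lemma mean_distance_cdf (d : measure_display) (T : measurableType d)
    (P : probability T R) (Y1 Y2 : T -> R) (F : R -> R) :
  measurable_fun setT Y1 -> measurable_fun setT Y2 ->
  (forall z, P [set w | Y1 w <= z] = (F z)%:E) ->
  (forall z, P [set w | Y2 w <= z] = (F z)%:E) ->
  (forall z, P ([set w | Y1 w <= z] `&` [set w | Y2 w <= z]) = (F z ^+ 2)%:E) ->
  (\int[P]_w `|Y1 w - Y2 w|%:E = \int[mu]_z (2 * F z * (1 - F z))%:E)%E.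
Proof.
move=> m1 m2 F1 F2 F12.
pose E : set (T * R) :=
  [set u | Num.min (Y1 u.1) (Y2 u.1) <= u.2 < Num.max (Y1 u.1) (Y2 u.1)].
have mE : measurable E.
  have mfst Y : measurable_fun setT Y ->
      measurable_fun setT (fun u : T * R => Y u.1 : R).
    by move=> mY; apply: measurableT_comp => //; exact: measurable_fst.
  have mmin : measurable_fun setT (fun u : T * R => Num.min (Y1 u.1) (Y2 u.1)).
    by apply: measurable_minr; exact: mfst.
  have mmax : measurable_fun setT (fun u : T * R => Num.max (Y1 u.1) (Y2 u.1)).
    by apply: measurable_maxr; exact: mfst.
  have ms : measurable_fun setT (fun u : T * R => u.2) by exact: measurable_snd.
  have hb := measurable_and (measurable_fun_ler mmin ms) (measurable_fun_ltr ms mmax).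
  have := hb measurableT [set true] (I : measurable [set true]).
  by rewrite setTI; congr measurable; apply/seteqP; split => u.
transitivity (\int[P]_w \int[mu]_z (\1_E (w, z))%:E)%E.
  apply: eq_integral => w _.
  transitivity (\int[mu]_z (\1_`[Num.min (Y1 w) (Y2 w), Num.max (Y1 w) (Y2 w)[ z)%:E)%E.
    rewrite integral_indic// setIT /= lebesgue_measure_itv/= lte_fin -EFinB.
    case: (ltgtP (Y1 w) (Y2 w)) => h.
    - by rewrite h ltr0_norm ?subr_lt0// opprB.
    - by rewrite h gtr0_norm ?subr_gt0.
    - by rewrite ltxx h subrr normr0.
  by apply: eq_integral => z _; rewrite !indicE.
pose G (u : T * R) : \bar R := (\1_E u)%:E.
have mG : measurable_fun setT G.
  by apply/measurable_EFinP; exact: measurable_indic.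
have G0 u : (0 <= G u)%E by rewrite lee_fin.
rewrite (@fubini_tonelli _ _ _ _ R P mu G mG G0).
apply: eq_integral => z _.
have mA1 : measurable [set w | Y1 w <= z] by exact: measurable_halfline.
have mA2 : measurable [set w | Y2 w <= z] by exact: measurable_halfline.
transitivity (\int[P]_w (\1_(([set w | Y1 w <= z] `\` [set w | Y2 w <= z]) `|`
    ([set w | Y2 w <= z] `\` [set w | Y1 w <= z])) w)%:E)%E.
  apply: eq_integral => w _; rewrite !indicE; congr ((nat_of_bool _)%:R%:E).
  rewrite /E; apply/idP/idP; rewrite !inE/= ge_min lt_max.
    case/andP => /orP[h1|h1] /orP[h2|h2]; rewrite ?h1.
    - by move: (le_lt_trans h1 h2); rewrite ltxx.
    - by left; split => //; apply/negP; rewrite -ltNge.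
    - by right; split => //; apply/negP; rewrite -ltNge.
    - by move: (le_lt_trans h1 h2); rewrite ltxx.
  by case => -[-> /negP]; rewrite -ltNge => ->; rewrite ?orbT.
rewrite integral_indic ?setIT//; last by apply: measurableU; exact: measurableD.
pose D12 := [set w | Y1 w <= z] `\` [set w | Y2 w <= z].
pose D21 := [set w | Y2 w <= z] `\` [set w | Y1 w <= z].
transitivity (P D12 + P D21)%E.
  apply: measureU; [exact: measurableD..|].
  by apply/seteqP; split => w //= [[? ?] [? ?]].
have PD (A B : set T) (a c : R) : measurable A -> measurable B -> P A = a%:E ->
    P (A `&` B) = c%:E -> P (A `\` B) = (a - c)%:E.
  move=> mA mB PA PAB; rewrite measureD//= ?PA ?PAB//.
  exact: ltry.
have -> : P D12 = (F z - F z ^+ 2)%:E by exact: PD.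
have -> : P D21 = (F z - F z ^+ 2)%:E.
  by apply: PD => //; rewrite setIC.
by rewrite -EFinD; congr EFin; ring.
Qed.

End mean_distance.

Section mean_distance_interval.
Context {R : realType}.
Local Notation mu := (@lebesgue_measure R).

Lemma integral_supported (m M N : R) (f : R -> R) : m < M ->
  measurable_fun setT f -> (forall x, 0 <= f x <= N) ->
  (forall x, ~~ (m <= x <= M) -> f x = 0) ->
  (\int[mu]_x (f x)%:E = ((M - m) * J 0 1 (fun s => f (m + (M - m) * s)))%:E)%E.
Proof.
move=> mM mf f0N fS; have W0 : 0 < M - m by lra.
have bf : bmeas (fun s => f (m + (M - m) * s)).
  split; last first.
    by exists N => s _; have /andP[? ?] := f0N (m + (M - m) * s); rewrite ger0_norm.
  by apply: measurableT_comp => //; exact: measurable_affine.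
rewrite (ge0_integral_affine m W0); last 2 first.
- exact/measurable_EFinP.
- by move=> x; rewrite lee_fin; have /andP[] := f0N x.
rewrite EFinM; congr (_ * _)%E; rewrite EFin_J//.
have mf' : measurable_fun setT (EFin \o (fun s => f (m + (M - m) * s))).
  by apply/measurable_EFinP; case: bf.
rewrite integral_itv_obnd_cbnd; last exact: measurable_funTS.
rewrite integral_itv_bndo_bndc; last exact: measurable_funTS.
rewrite [RHS]integral_mkcond; apply: eq_integral => s _.
rewrite patchE; case: ifPn => //; rewrite mem_setE in_itv/= => sI.
congr EFin; apply: fS; apply: contra sI => /andP[h1 h2]; apply/andP; split.
  by rewrite -(pmulr_rge0 _ W0); lra.
by rewrite -(ler_pM2l W0); lra.
Qed.

Definition mass_below (w : R -> R) (t : R) : R :=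
  J 0 1 (fun s : R => (s <= t)%R%:R * w s).

(** For a law on [[0, 1]] with density [w / A] and distribution function [G],
    [(G t - t) ^+ 2 >= 0] bounds [G * (1 - G)] by a function linear in [G], and
    the integral of [(1 - 2 * t) * G t] is a moment of [w]. *)
Lemma mean_distance_density_le (N : R) (w : R -> R) :
  measurable_fun setT w -> (forall s, 0 <= w s <= N) -> 0 < J 0 1 w ->
  J 0 1 (fun t => 2 * (mass_below w t / J 0 1 w) * (1 - mass_below w t / J 0 1 w)) <=
  2 / 3 - 2 * (J 0 1 (fun s => s * (1 - s) * w s) / J 0 1 w).
Proof.
move=> mw w0N; set A := J 0 1 w => A0; pose G t := mass_below w t / A.
have bw : bmeas w.
  by split => //; exists N => s _; have /andP[? ?] := w0N s; rewrite ger0_norm.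
pose F (k : R -> R) (t s : R) := k t * ((s <= t)%R%:R * w s).
have mle : measurable_fun setT (fun z : R * R => ((z.2 <= z.1)%R%:R : R)).
  have -> : (fun z : R * R => ((z.2 <= z.1)%R%:R : R)) =
      (fun b : bool => (b%:R : R)) \o (fun z : R * R => z.2 <= z.1) by [].
  apply: measurableT_comp => //.
  by apply: measurable_fun_ler; [exact: measurable_snd|exact: measurable_fst].
have mF (k : R -> R) : measurable_fun setT k -> measurable_fun setT (fun z : R * R => F k z.1 z.2).
  move=> mk; apply: measurable_funM.
    by apply: measurableT_comp => //; exact: measurable_fst.
  apply: measurable_funM => //.
  by apply: measurableT_comp => //; exact: measurable_snd.
have F0 (k : R -> R) : (forall t, 0 <= k t) -> forall t s : R, 0 <= F k t s.
  move=> k0 t s; apply: mulr_ge0 => //; apply: mulr_ge0 => //.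
  by have /andP[] := w0N s.
have FN (k : R -> R) : (forall t, 0 < t < 1 -> 0 <= k t <= 1) -> forall t s : R, 0 < t < 1 -> 0 < s < 1 ->
    F k t s <= N.
  move=> k1 t s /k1/andP[k0 k1'] _; rewrite /F; have /andP[w0 wN] := w0N s.
  have N0 : 0 <= N by exact: le_trans wN.
  apply: (@le_trans _ _ (1 * (1 * w s))); last by rewrite !mul1r.
  apply: ler_pM => //; first by apply: mulr_ge0.
  by apply: ler_wpM2r => //; case: (s <= t).
have bG : bmeas G.
  pose one (t : R) : R := 1.
  have one01 t : 0 < t < 1 -> 0 <= one t <= 1 by move=> _; rewrite /one ler01 lexx.
  have m1 : measurable_fun setT one by exact: measurable_cst.
  have [_ b1] := bmeas_J (mF _ m1) (F0 _ (fun=> ler01)) (FN one one01).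
  have := bmeasM b1 (bmeas_cst A^-1); congr bmeas; apply/funext => t.
  by rewrite /G /F /mass_below; congr (J _ _ _ * _); apply/funext => s; rewrite mul1r.
have inner (k : R -> R) : bmeas k -> forall s : R, 0 < s < 1 -> J 0 1 (fun t => F k t s) = J s 1 k * w s.
  move=> bk s /andP[s0 s1].
  have bks : bmeas (fun t : R => k t * (s <= t)%R%:R).
    apply: bmeasM => //; split; last by exists 1 => t _; case: (s <= t); rewrite ?normr1 ?normr0.
    exact: (measurable_fun_pair1 s mle).
  transitivity (w s * J 0 1 (fun t : R => k t * (s <= t)%R%:R)).
    by rewrite -JZ//; congr J; apply/funext => t; rewrite /F; ring.
  rewrite mulrC; congr (_ * _); rewrite (J_split bks (lexx 0) (ltW s0) (ltW s1) (lexx 1)).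
  rewrite (@eq_J _ 0 s _ (fun=> 0 * 0)); last first.
    by move=> t /andP[_ ts]; rewrite leNgt ts mulr0 mul0r.
  rewrite JZ ?(ltW s1)//; last exact: bmeas_cst.
  rewrite mul0r add0r; apply: eq_J => t /andP[st _].
  by rewrite ltW// mulr1.
have weighted : forall k : R -> R, bmeas k -> (forall t, 0 <= k t) ->
    (forall t, 0 < t < 1 -> 0 <= k t <= 1) ->
    A * J 0 1 (fun t => k t * G t) = J 0 1 (fun s => J s 1 k * w s).
  move=> k bk k0 k1; have [mk _] := bk.
  have := J_swap (mF _ mk) (F0 _ k0) (FN _ k1).
  rewrite [RHS](eq_J (g := fun s => J s 1 k * w s)); last exact: inner.
  move=> <-; rewrite -JZ//; last exact: bmeasM.
  apply: eq_J => t t01; rewrite /F JZ//; last first.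
    apply: bmeasM bw; split; first exact: (measurable_fun_pair2 t mle).
    by exists 1 => s _; case: (s <= t); rewrite ?normr1 ?normr0.
  by rewrite /G /mass_below; field; rewrite gt_eqF.
(* [1 - 2 * t] is the difference of the nonnegative weights below, so that
   Tonelli applies to each. *)
have s1 := weighted _ (bmeas_cubic 1 (- 2) 1 0); have s2 := weighted _ (bmeas_cubic 0 0 1 0).
have e1 (t : R) : 1 + (- 2) * t + 1 * t ^+ 2 + 0 * t ^+ 3 = (1 - t) ^+ 2 by ring.
have e2 (t : R) : 0 + 0 * t + 1 * t ^+ 2 + 0 * t ^+ 3 = t ^+ 2 by ring.
have p1 (t : R) : 0 <= 1 + (- 2) * t + 1 * t ^+ 2 + 0 * t ^+ 3 by rewrite e1 sqr_ge0.
have p2 (t : R) : 0 <= 0 + 0 * t + 1 * t ^+ 2 + 0 * t ^+ 3 by rewrite e2 sqr_ge0.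
have q1 (t : R) : 0 < t < 1 -> 0 <= 1 + (- 2) * t + 1 * t ^+ 2 + 0 * t ^+ 3 <= 1.
  by move=> ?; rewrite p1 e1 exprn_ile1//; lra.
have q2 (t : R) : 0 < t < 1 -> 0 <= 0 + 0 * t + 1 * t ^+ 2 + 0 * t ^+ 3 <= 1.
  by move=> ?; rewrite p2 e2 exprn_ile1//; lra.
have {}s1 := s1 p1 q1; have {}s2 := s2 p2 q2.
have bsw (k0 k1 k2 k3 : R) :
    bmeas (fun s => (k0 + k1 * s + k2 * s ^+ 2 + k3 * s ^+ 3) * w s).
  by apply: bmeasM bw; exact: bmeas_cubic.
have E : A * J 0 1 (fun t => (1 - 2 * t) * G t) = - J 0 1 (fun s => s * (1 - s) * w s).
  transitivity (A * J 0 1 (fun t => (1 + (- 2) * t + 1 * t ^+ 2 + 0 * t ^+ 3) * G t) -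
    A * J 0 1 (fun t => (0 + 0 * t + 1 * t ^+ 2 + 0 * t ^+ 3) * G t)).
    rewrite -mulrBr -JB//; [|apply: bmeasM => //; exact: bmeas_cubic..]; congr (_ * _).
    by apply: eq_J => t _; ring.
  rewrite s1 s2.
  rewrite (eq_J (g := fun s => (1 / 3 + (- 1) * s + 1 * s ^+ 2 + (- 1 / 3) * s ^+ 3) * w s));
    last by move=> s /andP[_ sl1]; rewrite J_cubic ?ltW//; congr (_ * _); field.
  rewrite [X in _ - X](eq_J (g := fun s =>
      (1 / 3 + 0 * s + 0 * s ^+ 2 + (- 1 / 3) * s ^+ 3) * w s));
    last by move=> s /andP[_ sl1]; rewrite J_cubic ?ltW//; congr (_ * _); field.
  by rewrite -JB// -[RHS]mulN1r -JZ//; [apply: eq_J => s _; ring|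
    move: (bsw 0 1 (- 1) 0); congr bmeas; apply/funext => s; ring].
set V := J 0 1 (fun s => s * (1 - s) * w s) in E *.
have bt : bmeas (fun t : R => 0 + 0 * t + 2 * t ^+ 2 + 0 * t ^+ 3) by exact: bmeas_cubic.
have bl : bmeas (fun t : R => 1 - 2 * t).
  by apply: bmeasB; [exact: bmeas_cst|apply: bmeasM; [exact: bmeas_cst|exact: bmeas_id]].
have bGl : bmeas (fun t => 2 * ((1 - 2 * t) * G t)).
  by apply: bmeasM; [exact: bmeas_cst|exact: bmeasM].
apply: (@le_trans _ _ (J 0 1 (fun t => 2 * ((1 - 2 * t) * G t) +
    (0 + 0 * t + 2 * t ^+ 2 + 0 * t ^+ 3)))).
  apply: le_J => //; [|exact: bmeasD|].
    apply: bmeasM; first by apply: bmeasM => //; exact: bmeas_cst.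
    by apply: bmeasB => //; exact: bmeas_cst.
  move=> t _; rewrite -/(G t); have := sqr_ge0 (G t - t); lra.
rewrite JD// JZ//; last exact: bmeasM.
rewrite J_cubic//.
have -> : J 0 1 (fun t => (1 - 2 * t) * G t) = - (V / A).
  by apply: (mulfI (lt0r_neq0 A0)); rewrite E; field; rewrite gt_eqF.
lra.
Qed.

End mean_distance_interval.

(** * Chord lengths and the projected laws *)

Section chord.
Context {R : realType}.
Local Notation mu := (@lebesgue_measure R).
Implicit Type K : set (plane R).

Definition chord K (x : R) : R := fine (mu (xsection K x)).

Lemma measurable_chord K : measurable K -> measurable_fun setT (chord K).
Proof.
move=> mK.
have mX : measurable_fun setT (mu \o xsection K) by exact: measurable_fun_xsection.
exact: (measurableT_comp (@fine_measurable R setT measurableT) mX).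
Qed.

Section graphs.
Variables (K : set (plane R)) (m M : R) (g' h : R -> R).
Hypotheses (hK : convex_body K) (gK : graph_body K m M g' h).

Let W0 : 0 < M - m. Proof. by case: gK => mM _ _ _ _ _; rewrite subr_gt0. Qed.

Lemma chordE x : m <= x <= M -> chord K x = h x + g' x.
Proof.
move=> xI; have [_ memK leK _ _ _] := gK.
rewrite /chord (_ : xsection K x = `[- g' x, h x]%classic); last first.
  apply/seteqP; split => y /=; rewrite xsectionE/= in_itv/=.
    by move/memK => [].
  by move=> hy; apply/memK.
rewrite /= lebesgue_measure_itv/= lte_fin; case: ltP => hy /=; first by rewrite opprK.
by have := leK _ xI; lra.
Qed.

Lemma chord_out x : ~~ (m <= x <= M) -> chord K x = 0.
Proof.
move=> xI; have [_ memK _ _ _ _] := gK.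
rewrite /chord (_ : xsection K x = set0) ?measure0//.
apply/seteqP; split => y //=; rewrite xsectionE/= => /memK[/= h1 _].
by rewrite h1 in xI.
Qed.

Lemma chord_bounded : exists N, forall x, 0 <= chord K x <= N.
Proof.
have [cK _ [z0 /interior_subset Kz0]] := hK; have K0 : K !=set0 by exists z0.
have [mM memK leK _ _ _] := gK.
have [zM KzM hM] := compact_max (@continuous_plane_snd R) cK K0.
have [zm Kzm hm] := compact_min (@continuous_plane_snd R) cK K0.
exists (zM.2 - zm.2) => x.
have [xI|/chord_out ->] := boolP (m <= x <= M); last by rewrite lexx subr_ge0 hm.
rewrite chordE//; have c0 := leK _ xI; rewrite c0 /=.
have Kh : K (x, h x) by apply/memK => /=; split => //; lra.
have Kg : K (x, - g' x) by apply/memK => /=; split => //; lra.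
by have /= := hM _ Kh; have /= := hm _ Kg; lra.
Qed.

Lemma mu_xsection x : mu (xsection K x) = (chord K x)%:E.
Proof.
rewrite /chord fineK//; have [_ memK _ _ _ _] := gK.
have [xI|xI] := boolP (m <= x <= M); last first.
  rewrite (_ : xsection K x = set0) ?measure0//.
  apply/seteqP; split => y //=; rewrite xsectionE/= => /memK[/= h1 _].
  by rewrite h1 in xI.
rewrite (_ : xsection K x = `[- g' x, h x]%classic); last first.
  apply/seteqP; split => y /=; rewrite xsectionE/= in_itv/=.
    by move/memK => [].
  by move=> hy; apply/memK.
by rewrite /= lebesgue_measure_itv/=; case: ifP.
Qed.

Lemma area_halfplane z :
  area (K `&` [set u : plane R | u.1 <= z]) =
  ((M - m) * J 0 1 (fun s => (m + (M - m) * s <= z)%R%:R * chord K (m + (M - m) * s)))%:E.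
Proof.
have [N hN] := chord_bounded; have [mM _ _ _ _ _] := gK.
have clK : closed K by exact: convex_body_closed.
pose f x : R := (x <= z)%R%:R * chord K x.
transitivity (\int[mu]_x (f x)%:E)%E.
  apply: eq_integral => x _ /=; rewrite /f.
  case: (boolP (x <= z)) => xz.
    rewrite mul1r (_ : xsection _ x = xsection K x) ?mu_xsection//.
    by apply/seteqP; split => y; rewrite /= !xsectionE/=; [case|].
  rewrite mul0r (_ : xsection _ x = set0) ?measure0//.
  by apply/seteqP; split => y //=; rewrite xsectionE/= => -[_]; apply/negP.
apply: (@integral_supported _ m M N f) => //.
- apply: measurable_funM;
    last by apply: measurable_chord; exact: closed_plane_measurable.
  have -> : (fun x : R => ((x <= z)%R%:R : R)) = \1_(`]-oo, z]%classic : set R).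
    by apply/funext => x; rewrite indicE mem_setE in_itv.
  exact: measurable_indic.
- move=> x; have /andP[c0 cN] := hN x; rewrite /f.
  by case: (x <= z); rewrite ?mul1r ?mul0r ?c0 ?cN ?lexx ?(le_trans c0 cN).
- by move=> x xI; rewrite /f chord_out// mulr0.
Qed.

End graphs.

End chord.

(** * The two excess functions of a convex body *)

Section deficit.
Context {R : realType}.
Local Notation half x := [set z : plane R | z.1 \in `]-oo, x]].

(** The complement [s - r s] to the diagonal of the excess [r], after an affine
    change of variables that takes the projection of the body to [[0, 1]]. *)
Definition deficit (K : set (plane R)) d (T : measurableType d) (P : probability T R)
    (B : T -> plane R) (m W s : R) : R :=
  s - (prob_in P B (half (m + W * s)) - chord K (m + W * s) / perimeter K).

Lemma subdiag_deficit (K : set (plane R)) d (T : measurableType d)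
    (P : probability T R) (B : T -> plane R) (m M : R) (g' h : R -> R) :
  convex_body K -> boundary_law K P B -> graph_body K m M g' h ->
  subdiag (deficit K P B m (M - m)).
Proof.
move=> hK hB gK; have mM := graph_body_itv gK; have W0 : 0 < M - m by lra.
have [SL L0] := perimeterP hB.
have inI s : 0 <= s <= 1 -> m <= m + (M - m) * s <= M.
  by move=> s01; apply/andP; split; nra.
have dE s : 0 <= s <= 1 -> deficit K P B m (M - m) s = s - excess K P B g' h (m + (M - m) * s).
  by move=> /inI sI; rewrite /deficit /excess (chordE gK sI).
have e0 := excess_left hK hB gK; have e1 := excess_right hK hB gK.
have bnd s : 0 <= s <= 1 -> 0 <= deficit K P B m (M - m) s <= s.
  move=> s01; have /andP[h1 h2] := inI s s01; rewrite dE//.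
  rewrite gerBl (excess_ge0 hK hB gK) ?h1// andbT subr_ge0.
  have := excess_convex hK hB gK (lexx m) h1 h2 (lexx M).
  rewrite e0 mulr0 add0r.
  have -> : m + (M - m) * s - m = (M - m) * s by ring.
  rewrite -mulrA ler_pM2l// => h3; apply: le_trans h3 _.
  by case/andP: s01 => s0 _; nra.
split => //.
- split; last first.
    by exists 1 => s s01; have := bnd s; rewrite ler_norml; lra.
  apply: measurable_funB => //.
  have ma := @measurable_affine R m (M - m).
  have -> : (fun s => prob_in P B (half (m + (M - m) * s)) -
      chord K (m + (M - m) * s) / perimeter K) =
      (fun x => prob_in P B (half x) - chord K x / perimeter K) \o
      (fun s => m + (M - m) * s) by [].
  apply: measurableT_comp ma; apply: measurable_funB.
    apply: nondecreasing_measurable => // x y xy.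
    apply: (prob_inS hB); [exact: measurable_fst_halfspace..|].
    by move=> z; rewrite /= !in_itv/= => zx; exact: le_trans xy.
  apply: measurable_funM => //; apply: measurable_chord.
  by apply: closed_plane_measurable; exact: convex_body_closed.
- move=> x y z x0 xy yz z1.
  rewrite !dE; try by apply/andP; split; lra.
  have cx := excess_convex hK hB gK (x := m + (M - m) * x) (y := m + (M - m) * y)
    (z := m + (M - m) * z).
  have {cx} : (M - m) * ((z - x) * excess K P B g' h (m + (M - m) * y)) <=
    (M - m) * ((z - y) * excess K P B g' h (m + (M - m) * x) +
    (y - x) * excess K P B g' h (m + (M - m) * z)).
    apply: le_trans (le_trans _ (cx _ _ _ _)) _; [|nra|nra|nra|nra|];
    by rewrite le_eqVlt; apply/orP; left; apply/eqP; ring.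
  by rewrite ler_pM2l//; lra.
Qed.

Local Notation flip := (lin (-1) 0 0 1).

Lemma orthogonal_flip : @orthogonal R (-1) 0 0 1.
Proof. by split; [ring..|split; ring]. Qed.

Lemma graph_body_flip (K : set (plane R)) (m M : R) (g' h : R -> R) :
  graph_body K m M g' h ->
  graph_body (flip @^-1` K) (- M) (- m) (g' \o -%R) (h \o -%R).
Proof.
move=> [mM memK leK ltK ch cg]; split.
- by lra.
- move=> z; rewrite /lin /=; split.
    move/memK; rewrite /= !mulN1r !mul0r !mul1r addr0 add0r => -[? ?].
    by split => //; lra.
  move=> [? ?]; apply/memK; rewrite /= !mulN1r !mul0r !mul1r addr0 add0r.
  by split => //; lra.
- by move=> x xI; apply: leK; lra.
- by move=> x xI; apply: ltK; lra.
- by move=> x y z mx xy yz zM /=; have := ch (- z) (- y) (- x); lra.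
- by move=> x y z mx xy yz zM /=; have := cg (- z) (- y) (- x); lra.
Qed.

Lemma chord_flip (K : set (plane R)) (m M : R) (g' h : R -> R) x :
  graph_body K m M g' h -> m <= x <= M -> chord (flip @^-1` K) (- x) = chord K x.
Proof.
move=> gK xI; rewrite (chordE (graph_body_flip gK)) ?(chordE gK)//=; last by lra.
by rewrite opprK.
Qed.

Lemma perimeter_flip (K : set (plane R)) : convex_body K ->
  perimeter (flip @^-1` K) = perimeter K.
Proof.
move=> hK; rewrite /perimeter.
have -> := boundary_lin orthogonal_flip hK.
by have -> := arclength_lin (boundary K) orthogonal_flip.
Qed.

Section profile.
Variables (K : set (plane R)) (d : measure_display) (T : measurableType d).
Variables (P : probability T R) (B : T -> plane R) (m M : R) (g' h : R -> R).
Hypotheses (hK : convex_body K) (hB : boundary_law K P B).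
Hypothesis (gK : graph_body K m M g' h).

(** No mass is counted twice: a vertical line of abscissa strictly between [m] and
    [M] meets the boundary in two points only. *)
Lemma half_flip x : m < x < M ->
  prob_in P (flip \o B) (half (- x)) = 1 - prob_in P B (half x).
Proof.
move=> xI.
have m1 := measurable_fst_halfspace `]-oo, x].
have m2 := measurable_fst_halfspace `]x, +oo[.
have m3 := measurable_fst_halfspace `[x, x].
have Etot : prob_in P B (half x) + prob_in P B [set z | z.1 \in `]x, +oo[] = 1.
  rewrite -(prob_inU hB m1 m2); last first.
    by apply/seteqP; split => // z []; rewrite /= !in_itv/= andbT => h1; rewrite ltNge h1.
  rewrite (_ : _ `|` _ = setT) ?/prob_in ?preimage_setT ?probability_setT//.
  apply/seteqP; split => // z _; rewrite /= !in_itv/= andbT.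
  by case: (leP z.1 x) => ?; [left|right].
have Eflip : prob_in P (flip \o B) (half (- x)) =
    prob_in P B [set z | z.1 \in `[x, x]] + prob_in P B [set z | z.1 \in `]x, +oo[].
  rewrite -(prob_inU hB m3 m2); last first.
    apply/seteqP; split => // z []; rewrite /= !in_itv/= andbT => /andP[_ h1].
    by rewrite ltNge h1.
  rewrite /prob_in; congr (fine (P _)); apply/seteqP; split => w; rewrite /= !in_itv/=.
    move=> h1; case: (ltP x (B w).1) => h2; [by right|left].
    by apply/andP; split; lra.
  by move=> [/andP[]|]; lra.
by rewrite Eflip (vertical_line hK hB gK xI); lra.
Qed.

Local Notation q := (deficit K P B m (M - m)).
Local Notation p := (deficit (flip @^-1` K) P (flip \o B) (- M) (M - m)).

Lemma subdiag_deficit_flip : subdiag p.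
Proof.
have -> : M - m = - m - - M by ring.
apply: subdiag_deficit (graph_body_flip gK).
  exact: (convex_body_lin orthogonal_flip hK).
exact: (boundary_law_lin orthogonal_flip hK hB).
Qed.

Lemma deficit_sum s : 0 < s < 1 ->
  q s + p (1 - s) = 2 / perimeter K * chord K (m + (M - m) * s).
Proof.
move=> s01; have mM := graph_body_itv gK; rewrite /deficit.
have -> : - M + (M - m) * (1 - s) = - (m + (M - m) * s) by ring.
have xI : m < m + (M - m) * s < M by apply/andP; split; nra.
rewrite perimeter_flip// (chord_flip gK) ?half_flip//; first by ring.
by apply/andP; split; lra.
Qed.

Lemma deficit_diff s : 0 < s < 1 ->
  1 - 2 * s + q s - p (1 - s) = 1 - 2 * prob_in P B (half (m + (M - m) * s)).
Proof.
move=> s01; have mM := graph_body_itv gK; rewrite /deficit.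
have -> : - M + (M - m) * (1 - s) = - (m + (M - m) * s) by ring.
have xI : m < m + (M - m) * s < M by apply/andP; split; nra.
rewrite perimeter_flip// (chord_flip gK) ?half_flip//; first by ring.
by apply/andP; split; lra.
Qed.

End profile.

End deficit.

(** * The inequality in one direction *)

Section direction.
Context {R : realType}.
Local Notation mu := (@lebesgue_measure R).
Local Notation half x := [set z : plane R | z.1 \in `]-oo, x]].

Definition area_law (K : set (plane R)) d (T : measurableType d) (P : probability T R)
    (X : T -> plane R) : Prop :=
  measurable_fun setT X /\ forall A, measurable A ->
    P (X @^-1` A) = (area (A `&` K) / area K)%E.

Definition independent_maps d (T : measurableType d) (P : probability T R)
    (X Y : T -> plane R) : Prop :=
  forall A B, measurable A -> measurable B ->
    P (X @^-1` A `&` Y @^-1` B) = (P (X @^-1` A) * P (Y @^-1` B))%E.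

Lemma mean_abscissa d (T : measurableType d) (P : probability T R)
    (Y1 Y2 : T -> plane R) (F : R -> R) (m M : R) : m < M ->
  measurable_fun setT Y1 -> measurable_fun setT Y2 -> independent_maps P Y1 Y2 ->
  (forall z, P (Y1 @^-1` half z) = (F z)%:E) ->
  (forall z, P (Y2 @^-1` half z) = (F z)%:E) ->
  (forall z, z < m -> F z = 0) -> (forall z, M <= z -> F z = 1) ->
  (\int[P]_w `|(Y1 w).1 - (Y2 w).1|%:E =
   ((M - m) * J 0 1 (fun s => 2 * F (m + (M - m) * s) * (1 - F (m + (M - m) * s))))%:E)%E.
Proof.
move=> mM mY1 mY2 ind F1 F2 Fm FM.
have halfE (Y : T -> plane R) z : [set w | (Y w).1 <= z] = Y @^-1` half z.
  by apply/seteqP; split => w; rewrite /= in_itv.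
have F01 z : 0 <= F z <= 1.
  by rewrite -!lee_fin -F1 measure_ge0 probability_le1//;
    rewrite -[X in measurable X]setTI; apply: mY1 => //; exact: measurable_fst_halfspace.
rewrite (@mean_distance_cdf _ _ _ P (fst \o Y1) (fst \o Y2) F); last 5 first.
- by apply: measurableT_comp mY1; exact: measurable_fst.
- by apply: measurableT_comp mY2; exact: measurable_fst.
- by move=> z; rewrite -F1 -halfE.
- by move=> z; rewrite -F2 -halfE.
- move=> z; rewrite [X in P (X `&` _)](halfE Y1) [X in P (_ `&` X)](halfE Y2).
  rewrite ind; try exact: measurable_fst_halfspace.
  by rewrite F1 F2 -EFinM expr2.
apply: (@integral_supported _ m M 2 (fun z => 2 * F z * (1 - F z))) => //.
- have mF : measurable_fun setT F.
    apply: nondecreasing_measurable => // x y xy.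
    rewrite -lee_fin -!F1; apply: le_measure; rewrite ?inE.
    + by rewrite -[X in measurable X]setTI; apply: mY1 => //; exact: measurable_fst_halfspace.
    + by rewrite -[X in measurable X]setTI; apply: mY1 => //; exact: measurable_fst_halfspace.
    + by move=> w; rewrite /= !in_itv/= => wx; exact: le_trans xy.
  by apply: measurable_funM; [exact: measurable_funM|exact: measurable_funB].
- by move=> z; have := F01 z; nra.
- move=> z; rewrite negb_and -!ltNge => /orP[zm|Mz]; first by rewrite Fm// mulr0 mul0r.
  by rewrite FM ?(ltW Mz)// subrr mulr0.
Qed.

Section body.
Variables (K : set (plane R)) (m M : R) (g' h : R -> R).
Hypotheses (hK : convex_body K) (gK : graph_body K m M g' h).

Local Notation w := (fun s : R => chord K (m + (M - m) * s)).

Lemma area_law_half d (T : measurableType d) (P : probability T R) (X : T -> plane R) :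
  area_law K P X ->
  0 < J 0 1 w /\ forall z, P (X @^-1` half z) =
    (J 0 1 (fun s => (m + (M - m) * s <= z)%R%:R * w s) / J 0 1 w)%:E.
Proof.
move=> [mX hX]; have mM := graph_body_itv gK; have W0 : 0 < M - m by lra.
have areaK : area K = ((M - m) * J 0 1 w)%:E.
  transitivity (area (K `&` [set u : plane R | u.1 <= M])).
    congr area; apply/seteqP; split => [z Kz|z []//]; split => //.
    by have [_ memK _ _ _ _] := gK; have [/andP[]] := (memK z).1 Kz.
  rewrite (area_halfplane hK gK); congr ((_ * _)%:E).
  apply: eq_J => s s01; rewrite (_ : (m + _ <= M)%R = true) ?mul1r//.
  by nra.
have J0 : 0 < J 0 1 w.
  rewrite lt_neqAle; apply/andP; split; last first.
    apply: Rintegral_ge0 => s _; have [N hN] := chord_bounded hK gK.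
    by have /andP[] := hN (m + (M - m) * s).
  apply/eqP => J0; have := hX setT measurableT.
  rewrite preimage_setT probability_setT setTI areaK -J0 mulr0 mul0e => /eqP.
  by rewrite onee_eq0.
split => // z; rewrite hX; last exact: measurable_fst_halfspace.
rewrite areaK setIC (_ : half z = [set u : plane R | u.1 <= z]); last first.
  by apply/seteqP; split => u; rewrite /= in_itv.
rewrite (area_halfplane hK gK) inver gt_eqF ?mulr_gt0// -EFinM; congr EFin.
by field; rewrite !gt_eqF.
Qed.

Lemma boundary_law_half d (T : measurableType d) (P : probability T R) (B B' : T -> plane R) :
  boundary_law K P B -> boundary_law K P B' -> forall z,
  P (B' @^-1` half z) = (prob_in P B (half z))%:E.
Proof.
move=> hB [_ hB'] z; have mz := measurable_fst_halfspace `]-oo, z].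
rewrite -(prob_inE hB mz) hB'//.
by case: hB => _ ->.
Qed.

(** Both mean distances are integrals of [2 * F * (1 - F)]. For the boundary the
    integrand is [(1 - e s ^+ 2) / 2], where [e] is the difference of the two
    excess functions; for the body the density [w] is proportional to the sum of
    their deficits. [spread_le] compares the two. *)
Lemma abscissa_le d (T : measurableType d) (P : probability T R) (X1 X2 : T -> plane R)
    d' (T' : measurableType d') (P' : probability T' R) (B1 B2 : T' -> plane R) :
  area_law K P X1 -> area_law K P X2 -> independent_maps P X1 X2 ->
  boundary_law K P' B1 -> boundary_law K P' B2 -> independent_maps P' B1 B2 ->
  (\int[P]_w `|(X1 w).1 - (X2 w).1|%:E <= \int[P']_w `|(B1 w).1 - (B2 w).1|%:E)%E.
Proof.
move=> hX1 hX2 iX hB1 hB2 iB; have mM := graph_body_itv gK.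
have [A0 law1] := area_law_half hX1; have [_ law2] := area_law_half hX2.
have [N hN] := chord_bounded hK gK.
have mchord : measurable_fun setT (chord K).
  by apply: measurable_chord; apply: closed_plane_measurable; exact: convex_body_closed.
have mw : measurable_fun setT w.
  by apply: measurableT_comp mchord _; exact: measurable_affine.
have bw : bmeas w.
  by split => //; exists N => s _; have /andP[? ?] := hN (m + (M - m) * s); rewrite ger0_norm.
pose FX z := J 0 1 (fun s => (m + (M - m) * s <= z)%R%:R * w s) / J 0 1 w.
pose FB z := prob_in P' B1 (half z).
rewrite (@mean_abscissa _ _ P X1 X2 FX m M)//; last 4 first.
- by case: hX1.
- by case: hX2.
- move=> z zm; rewrite /FX (eq_J (g := fun=> 0 * 1)); last first.
    by move=> s s01; rewrite (_ : (_ <= z)%R = false) ?mul0r//; nra.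
  by rewrite JZ// ?mul0r//; exact: bmeas_cst.
- move=> z Mz; rewrite /FX (eq_J (g := w)); first by rewrite divff// gt_eqF.
  by move=> s s01; rewrite (_ : (_ <= z)%R = true) ?mul1r//; nra.
rewrite (@mean_abscissa _ _ P' B1 B2 FB m M)//; last 6 first.
- by case: hB1.
- by case: hB2.
- by move=> z; exact: boundary_law_half.
- by move=> z; exact: boundary_law_half.
- by move=> z zm; rewrite /FB (half_out hK hB1 gK).
- by move=> z Mz; rewrite /FB (half_full hK hB1 gK).
rewrite lee_fin ler_pM2l ?subr_gt0//.
pose q := deficit K P' B1 m (M - m).
pose p := deficit (lin (-1) 0 0 1 @^-1` K) P' (lin (-1) 0 0 1 \o B1) (- M) (M - m).
have sq : subdiag q by exact: (subdiag_deficit hK hB1 gK).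
have sp : subdiag p by exact: (subdiag_deficit_flip hK hB1 gK).
have bq : bmeas q by case: sq. have bp : bmeas p by case: sp.
have [_ L0] := perimeterP hB1; pose k := 2 / perimeter K.
have k0 : 0 < k by rewrite divr_gt0.
have sumE s : 0 < s < 1 -> q s + p (1 - s) = k * w s by exact: (deficit_sum hK hB1 gK).
have diffE s : 0 < s < 1 -> 1 - 2 * s + q s - p (1 - s) = 1 - 2 * FB (m + (M - m) * s).
  exact: (deficit_diff hK hB1 gK).
have br : bmeas (fun s => p (1 - s)).
  split; first by apply: measurableT_comp (proj1 bp) _; exact: measurable_funB.
  by have [_ [N' hN']] := bp; exists N' => s s01; apply: hN'; lra.
set V := J 0 1 (fun s => s * (1 - s) * w s).
pose e s := 1 - 2 * s + q s - p (1 - s).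
have be : bmeas (fun s => e s ^+ 2).
  apply: bmeasX; apply: bmeasB => //; apply: bmeasD => //.
  by apply: bmeasB; [exact: bmeas_cst|apply: bmeasM; [exact: bmeas_cst|exact: bmeas_id]].
have bV : bmeas (fun s => s * (1 - s) * w s).
  apply: bmeasM bw; apply: bmeasM; first exact: bmeas_id.
  by apply: bmeasB; [exact: bmeas_cst|exact: bmeas_id].
have massE : mom 0 p + mom 0 q = k * J 0 1 w.
  rewrite /mom -JZ// -(J_reflect (bmeas_mom 0 bp)) -JD//; last 2 first.
  - by move: br; congr bmeas; apply/funext => s; rewrite mul1r.
  - exact: bmeas_mom.
  by apply: eq_J => s s01; rewrite !mul1r addrC sumE.
have := spread_le sp sq; rewrite massE.
rewrite [X in _ <= 4 * X](eq_J (g := fun s => k * (s * (1 - s) * w s))); last first.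
  by move=> s s01; rewrite sumE//; ring.
rewrite JZ// -/V -/e => hs.
have hX := mean_distance_density_le mw (fun s => hN _) A0.
have -> : J 0 1 (fun s => 2 * FX (m + (M - m) * s) * (1 - FX (m + (M - m) * s))) =
    J 0 1 (fun t => 2 * (mass_below w t / J 0 1 w) * (1 - mass_below w t / J 0 1 w)).
  apply: eq_J => t t01; suff -> : FX (m + (M - m) * t) = mass_below w t / J 0 1 w by [].
  rewrite /FX /mass_below; congr (_ / _); apply: eq_J => s _.
  by rewrite lerD2l ler_pM2l ?subr_gt0.
apply: le_trans hX _.
have -> : J 0 1 (fun s => 2 * FB (m + (M - m) * s) * (1 - FB (m + (M - m) * s))) =
    J 0 1 (fun s => 1 / 2 - 1 / 2 * e s ^+ 2).
  by apply: eq_J => s s01; rewrite /e diffE//; field.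
rewrite JB//; [|exact: bmeas_cst|by apply: bmeasM => //; exact: bmeas_cst].
rewrite [X in _ <= _ - X]JZ//.
have -> : J 0 1 (fun=> 1 / 2 : R) = 1 / 2.
  by rewrite /J Rintegral_cst//= lebesgue_measure_itv/= lte_fin ltr01 -EFinB subr0 mulr1.
have hs' : 1 / 3 + J 0 1 (fun s => e s ^+ 2) <= 4 * (V / J 0 1 w).
  rewrite mulrA ler_pdivlMr// mulrC -(ler_pM2l k0) [leLHS]mulrA [leRHS]mulrCA.
  exact: hs.
rewrite -/V; lra.
Qed.

End body.
End direction.

(** * Rotation invariance of the area *)

Section rotations.
Context {R : realType}.
Local Notation mu := (@lebesgue_measure R).
Implicit Types (A K : set (plane R)).

Definition rotation (c s : R) : plane R -> plane R := lin c (- s) s c.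

Lemma measurable_preimage_lin (a b c d : R) A : measurable A ->
  measurable (lin a b c d @^-1` A).
Proof.
by move=> mA; rewrite -[X in measurable X]setTI; exact: measurable_lin.
Qed.

Lemma lebesgue_measure_translate (a : R) (S S' : set R) : measurable S ->
  (forall y, S' y <-> S (a + y)) -> mu S' = mu S.
Proof.
move=> mS SS'; rewrite (lebesgue_measure_affine a ltr01 mS) mul1e; congr (mu _).
by apply/seteqP; split => y /=; rewrite mul1r => /SS'.
Qed.

Lemma area_shear_y (s : R) A : measurable A -> area (lin 1 0 s 1 @^-1` A) = area A.
Proof.
move=> mA; apply: eq_integral => x _ /=.
apply: (@lebesgue_measure_translate (s * x)); first exact: measurable_xsection.
by move=> y; rewrite !xsectionE /lin /= !mul1r mul0r addr0.
Qed.

Lemma areaE_ysection A : measurable A -> area A = (\int[mu]_y mu (ysection A y))%E.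
Proof.
move=> mA; apply: (@product_measure_unique _ _ _ _ R mu mu (mu \x^ mu)%E) => //.
by move=> B C mB mC; exact: product_measure2E.
Qed.

Lemma area_shear_x (t : R) A : measurable A -> area (lin 1 t 0 1 @^-1` A) = area A.
Proof.
move=> mA; rewrite !areaE_ysection//; last exact: measurable_preimage_lin.
apply: eq_integral => y _ /=.
apply: (@lebesgue_measure_translate (t * y)); first exact: measurable_ysection.
by move=> x; rewrite !ysectionE /lin /= !mul1r mul0r add0r addrC.
Qed.

(** A rotation with nonzero sine is a product of three shears. *)
Lemma area_rotation (c s : R) A : c ^+ 2 + s ^+ 2 = 1 -> measurable A ->
  area (rotation c s @^-1` A) = area A.
Proof.
have shears c' s' B : c' ^+ 2 + s' ^+ 2 = 1 -> s' != 0 -> measurable B ->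
    area (rotation c' s' @^-1` B) = area B.
  move=> cs s0 mB; pose t := (c' - 1) / s'.
  have E z : rotation c' s' z = lin 1 t 0 1 (lin 1 0 s' 1 (lin 1 t 0 1 z)).
    have ts : t * s' = c' - 1 by rewrite /t divfK.
    have ce : c' = 1 + t * s' by lra.
    have tc : t * (1 + c') = - s'.
      apply: (mulIf s0); rewrite mulrAC ts.
      by move: cs; rewrite !expr2; lra.
    rewrite /rotation /lin /=; congr (_, _).
      by rewrite -tc ce; ring.
    by rewrite ce; ring.
  have -> : rotation c' s' @^-1` B =
      lin 1 t 0 1 @^-1` (lin 1 0 s' 1 @^-1` (lin 1 t 0 1 @^-1` B)).
    by apply/seteqP; split => z; rewrite /preimage /mkset E.
  have m1 := measurable_preimage_lin 1 t 0 1 mB.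
  have m2 := measurable_preimage_lin 1 0 s' 1 m1.
  by have -> := area_shear_x t m2; have -> := area_shear_y s' m1; exact: area_shear_x.
have [->|s0] := eqVneq s 0; last by move=> cs; exact: shears.
rewrite expr0n addr0 => /eqP; rewrite sqrf_eq1 => /orP[/eqP->|/eqP->] mA.
  rewrite (_ : rotation 1 0 @^-1` A = A)//; apply/seteqP.
  by split => -[x y]; rewrite /rotation /lin /= oppr0 !mul1r !mul0r addr0 add0r.
have E z : rotation (-1) 0 z = rotation 0 1 (rotation 0 1 z).
  by rewrite /rotation /lin /=; congr (_, _); ring.
have -> : rotation (-1) 0 @^-1` A = rotation 0 1 @^-1` (rotation 0 1 @^-1` A).
  by apply/seteqP; split => z; rewrite /preimage /mkset E.
have o1 : (0 : R) ^+ 2 + 1 ^+ 2 = 1 by rewrite expr0n add0r expr1n.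
have m1 : measurable (rotation 0 1 @^-1` A) by exact: measurable_preimage_lin.
have -> := shears _ _ _ o1 (oner_neq0 R) m1.
exact: (shears _ _ _ o1 (oner_neq0 R) mA).
Qed.

Lemma orthogonal_rotation (c s : R) : c ^+ 2 + s ^+ 2 = 1 ->
  orthogonal c (- s) s c.
Proof. by move=> cs; split; rewrite -?cs; [ring..|split; ring]. Qed.

Lemma area_law_rotation (c s : R) K d (T : measurableType d)
    (P : probability T R) (X : T -> plane R) : c ^+ 2 + s ^+ 2 = 1 ->
  convex_body K -> area_law K P X ->
  area_law (lin c s (- s) c @^-1` K) P (rotation c s \o X).
Proof.
move=> cs hK [mX hX]; have o := orthogonal_rotation cs.
have mK : measurable K by apply: closed_plane_measurable; exact: convex_body_closed.
have mK' : measurable (lin c s (- s) c @^-1` K) by exact: measurable_preimage_lin.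
split; first by apply: measurableT_comp mX; exact: measurable_lin.
move=> A mA; have mA' := measurable_preimage_lin c (- s) s c mA.
have mAK : measurable (A `&` lin c s (- s) c @^-1` K) by exact: measurableI.
have <- := area_rotation cs mAK.
have <- := area_rotation cs mK'.
rewrite preimage_setI /rotation (preimage_linK _ o).
exact: hX.
Qed.

Lemma independent_maps_lin (a b c e : R) d (T : measurableType d)
    (P : probability T R) (X Y : T -> plane R) :
  independent_maps P X Y ->
  independent_maps P (lin a b c e \o X) (lin a b c e \o Y).
Proof.
move=> ind A B mA mB; exact: (ind _ _ (measurable_preimage_lin a b c e mA)
  (measurable_preimage_lin a b c e mB)).
Qed.

Lemma integral_rotation (c s : R) (f : plane R -> \bar R) : c ^+ 2 + s ^+ 2 = 1 ->
  measurable_fun setT f -> (forall z, 0 <= f z)%E ->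
  (\int[mu \x mu]_z f z = \int[mu \x mu]_z f (rotation c s z))%E.
Proof.
move=> cs mf f0.
pose RR : measurableType _ := (measurableTypeR R * measurableTypeR R)%type.
pose nu : {measure set RR -> \bar R} := (mu \x mu)%E.
pose phi (z : RR) : RR := rotation c s z.
have m : measurable_fun setT phi by exact: measurable_lin.
change (\int[nu]_z f z = \int[nu]_z (f \o phi) z)%E.
have mf' : measurable_fun setT (f : RR -> \bar R) by exact: mf.
have := @ge0_integral_pushforward _ _ RR RR R phi m nu setT f measurableT mf' (fun z _ => f0 z).
rewrite preimage_setT => <-.
apply: eq_measure_integral => A mA _; exact/esym/area_rotation.
Qed.

End rotations.

(** * Averaging over directions *)

Section disc.
Context {R : realType}.
Local Notation mu := (@lebesgue_measure R).
Local Notation RR := (measurableTypeR R * measurableTypeR R)%type.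

Lemma sigma_finite_area : sigma_finite setT (mu \x mu)%E.
Proof.
exists (fun n : nat => `[- n%:R, n%:R]%classic `*` `[- n%:R, n%:R]%classic).
  apply/seteqP; split => // z _; have z0 : 0 <= `|z.1| + `|z.2| by exact: addr_ge0.
  exists (Num.bound (`|z.1| + `|z.2|)) => //.
  have := archi_boundP z0; set n := (_%:R : R) => hn.
  have := normr_ge0 z.1; have := normr_ge0 z.2 => h1 h2.
  by split; rewrite /= in_itv/= -ler_norml; lra.
move=> n; split; first exact: measurableX.
rewrite product_measure1E//= !lebesgue_measure_itv/=.
by case: ifP => _; rewrite -?EFinB -?EFinM ?mule0 ltry.
Qed.

Let area_mixin := Measure_isSigmaFinite.Build _ _ _
  ((mu \x mu)%E : {measure set RR -> \bar R}) sigma_finite_area.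

(** The area with the structure that Tonelli's theorem asks for. *)
Definition area_measure : {sigma_finite_measure set RR -> \bar R} :=
  HB.pack (mu \x mu)%E area_mixin.
Local Notation nu := area_measure.

Definition dot (z y : plane R) : R := z.1 * y.1 + z.2 * y.2.

Definition disc : set (plane R) := [set y | y.1 ^+ 2 + y.2 ^+ 2 <= 1].

Definition disc_dot (z y : plane R) : R := \1_disc y * `|dot z y|.

Definition disc_width : \bar R := (\int[nu]_y (disc_dot (1, 0) y)%:E)%E.

Lemma disc_dot_ge0 z y : 0 <= disc_dot z y.
Proof. by apply: mulr_ge0 => //; rewrite indicE. Qed.

Lemma measurable_dot d (T : measurableType d) (Z Y : T -> plane R) :
  measurable_fun setT Z -> measurable_fun setT Y ->
  measurable_fun setT (fun w => dot (Z w) (Y w)).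
Proof.
move=> mZ mY; apply: measurable_funD; apply: measurable_funM;
  by [apply: measurableT_comp mZ; exact: measurable_fst|
      apply: measurableT_comp mZ; exact: measurable_snd|
      apply: measurableT_comp mY; exact: measurable_fst|
      apply: measurableT_comp mY; exact: measurable_snd].
Qed.

Lemma measurable_disc : measurable disc.
Proof.
have m : measurable_fun setT (fun y : plane R => dot y y).
  by apply: measurable_dot; exact: measurable_id.
have -> : disc = setT `&` (fun y => dot y y) @^-1` `]-oo, 1].
  by apply/seteqP; split => y; rewrite /disc /dot /= in_itv/= -!expr2; [|case].
exact: m.
Qed.

Lemma measurable_disc_dot z : measurable_fun setT (disc_dot z).
Proof.
apply: measurable_funM; first by apply: measurable_indic; exact: measurable_disc.
apply: measurableT_comp => //.
by apply: measurable_dot; [exact: measurable_cst|exact: measurable_id].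
Qed.

(** The rotation that takes [z] to the first axis preserves the disc. *)
Lemma integral_disc_dot (z : plane R) :
  (\int[nu]_y (disc_dot z y)%:E = (eucl_norm z)%:E * disc_width)%E.
Proof.
have n2 : eucl_norm z ^+ 2 = z.1 ^+ 2 + z.2 ^+ 2.
  by rewrite /eucl_norm sqr_sqrtr// addr_ge0 ?sqr_ge0.
have n0 : 0 <= eucl_norm z by exact: sqrtr_ge0.
have [r0|r0] := eqVneq (eucl_norm z) 0.
  rewrite r0 mul0e integral0_eq// => y _.
  move: n2; rewrite r0 expr0n/= => /esym/eqP.
  rewrite paddr_eq0 ?sqr_ge0// !sqrf_eq0 => /andP[/eqP z1 /eqP z2].
  by rewrite /disc_dot /dot z1 z2 !mul0r addr0 normr0 mulr0.
set r := eucl_norm z in n2 n0 r0 *; pose c := z.1 / r; pose s := z.2 / r.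
have zc : z.1 = c * r by rewrite /c divfK.
have zs : z.2 = s * r by rewrite /s divfK.
have cs : c ^+ 2 + s ^+ 2 = 1.
  apply: (mulIf (expf_neq0 2 r0)); by rewrite mul1r [RHS]n2 zc zs; ring.
have mf : measurable_fun setT (fun y => (disc_dot z y)%:E).
  by apply/measurable_EFinP; exact: measurable_disc_dot.
have f0 y : (0 <= (disc_dot z y)%:E)%E by rewrite lee_fin disc_dot_ge0.
have -> := integral_rotation cs mf f0.
rewrite /disc_width -ge0_integralZl_EFin//; last 2 first.
- by move=> y _; rewrite lee_fin disc_dot_ge0.
- by apply/measurable_EFinP; exact: measurable_disc_dot.
apply: eq_integral => y _; rewrite -EFinM; congr EFin.
rewrite /disc_dot mulrCA; congr (_ * _).
  rewrite !indicE; congr ((nat_of_bool _)%:R).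
  apply/idP/idP; rewrite !inE /disc /rotation /lin /=; apply: le_trans;
    rewrite le_eqVlt; apply/orP; left; apply/eqP;
    transitivity ((c ^+ 2 + s ^+ 2) * (y.1 ^+ 2 + y.2 ^+ 2));
    by [ring|rewrite cs mul1r].
rewrite -[X in _ = X * _](ger0_norm n0) -normrM; congr (`|_|).
rewrite /dot /rotation /lin /= zc zs mul1r mul0r addr0.
by transitivity ((c ^+ 2 + s ^+ 2) * (r * y.1)); [ring|rewrite cs mul1r].
Qed.

Lemma disc_width_gt0 : (0 < disc_width)%E.
Proof.
pose D : set RR := `[1 / 4, 1 / 2]%classic `*` `[- (1 / 2), 1 / 2]%classic.
have mD : measurable D by exact: measurableX.
apply: (@lt_le_trans _ _ (\int[nu]_y (1 / 4 * \1_D y)%:E)%E).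
  under eq_integral do rewrite EFinM.
  rewrite ge0_integralZl_EFin//; last by apply/measurable_EFinP; exact: measurable_indic.
  rewrite integral_indic// setIT [X in (_ * X)%E]product_measure1E//.
  rewrite /= !lebesgue_measure_itv/= !lte_fin (_ : (1 / 4 < 1 / 2)%R = true); last lra.
  rewrite (_ : (- (1 / 2) < 1 / 2)%R = true); last lra.
  by rewrite -!EFinB -!EFinM lte_fin; lra.
apply: ge0_le_integral => //.
- by apply/measurable_EFinP; apply: measurable_funM => //; exact: measurable_indic.
- by apply/measurable_EFinP; exact: measurable_disc_dot.
move=> y _; rewrite lee_fin; have [yD|yD] := boolP (y \in D); last first.
  by rewrite indicE (negbTE yD) mulr0 disc_dot_ge0.
have := yD; rewrite inE => -[]; rewrite /= !in_itv/= => h1 h2.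
have yd : y \in disc by rewrite inE /disc /=; nra.
by rewrite /disc_dot !indicE yD yd mul1r mulr1 /dot /= mul1r mul0r addr0 ger0_norm; lra.
Qed.

Lemma disc_width_fin_num : disc_width \is a fin_num.
Proof.
rewrite ge0_fin_numE; last exact: ltW disc_width_gt0.
pose D : set RR := `[- 1, 1]%classic `*` `[- 1, 1]%classic.
have mD : measurable D by exact: measurableX.
apply: (@le_lt_trans _ _ (\int[nu]_y (\1_D y)%:E)%E).
  apply: ge0_le_integral => //.
  - by move=> y _; rewrite lee_fin disc_dot_ge0.
  - by apply/measurable_EFinP; exact: measurable_disc_dot.
  - by apply/measurable_EFinP; exact: measurable_indic.
  move=> y _; rewrite lee_fin; have [yd|yd] := boolP (y \in disc); last first.
    by rewrite /disc_dot indicE (negbTE yd) mul0r indicE.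
  have := yd; rewrite inE /disc /= => h1.
  have h2 : - 1 <= y.1 <= 1 by nra.
  have yD : y \in D by rewrite inE /D /=; split; rewrite /= in_itv/=; nra.
  rewrite /disc_dot !indicE yD yd mul1r /dot /= mul1r mul0r addr0.
  by rewrite ler_norml.
rewrite integral_indic// setIT [X in (X < _)%E]product_measure1E//.
rewrite /= !lebesgue_measure_itv/= !lte_fin (_ : (- 1 < 1)%R = true); last lra.
by rewrite -!EFinB -!EFinM ltry.
Qed.

Section mean.
Context d (T : measurableType d) (P : probability T R) (Y1 Y2 : T -> plane R).
Hypotheses (mY1 : measurable_fun setT Y1) (mY2 : measurable_fun setT Y2).

Lemma measurable_plane_sub : measurable_fun setT (fun w => Y1 w - Y2 w : plane R).
Proof.
apply: measurable_fun_pair; apply: measurable_funB;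
  by [apply: measurableT_comp mY1; exact: measurable_fst|
      apply: measurableT_comp mY1; exact: measurable_snd|
      apply: measurableT_comp mY2; exact: measurable_fst|
      apply: measurableT_comp mY2; exact: measurable_snd].
Qed.

Lemma measurable_eucl_dist : measurable_fun setT (fun w => eucl_dist (Y1 w) (Y2 w)).
Proof.
have -> : (fun w => eucl_dist (Y1 w) (Y2 w)) =
    Num.sqrt \o (fun w => dot (Y1 w - Y2 w) (Y1 w - Y2 w)).
  by apply/funext => w; rewrite /eucl_dist /eucl_norm /dot /= !expr2.
apply: measurableT_comp.
  by apply: continuous_measurable_fun; exact: sqrt_continuous.
by apply: measurable_dot; exact: measurable_plane_sub.
Qed.

(** Crofton-type formula: a distance is, up to the factor [disc_width], the
    average over the disc of its one-dimensional projections. *)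
Lemma mean_eucl_dist :
  ((\int[P]_w (eucl_dist (Y1 w) (Y2 w))%:E) * disc_width =
   \int[nu]_y ((\1_disc y)%:E * \int[P]_w `|dot (Y1 w - Y2 w) y|%:E))%E.
Proof.
rewrite -ge0_integralZr//; last 3 first.
- by apply/measurable_EFinP; exact: measurable_eucl_dist.
- by move=> w _; rewrite lee_fin eucl_dist_ge0.
- exact: ltW disc_width_gt0.
under eq_integral do rewrite -integral_disc_dot.
pose G (u : T * RR) : \bar R := (disc_dot (Y1 u.1 - Y2 u.1) u.2)%:E.
have md : measurable_fun setT (fun u : T * RR => dot (Y1 u.1 - Y2 u.1) u.2).
  apply: measurable_dot; last exact: measurable_snd.
  by apply: (measurableT_comp measurable_plane_sub); exact: measurable_fst.
have mG : measurable_fun setT G.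
  apply/measurable_EFinP; apply: measurable_funM.
    have mi : measurable_fun setT (\1_disc : RR -> R).
      by apply: measurable_indic; exact: measurable_disc.
    by apply: (measurableT_comp mi); exact: measurable_snd.
  exact: measurableT_comp.
have G0 u : (0 <= G u)%E by rewrite lee_fin disc_dot_ge0.
transitivity (\int[P]_w \int[nu]_y G (w, y))%E; first by [].
rewrite (@fubini_tonelli _ _ _ _ R P nu G mG G0).
apply: eq_integral => y _; rewrite -ge0_integralZl_EFin//.
apply/measurable_EFinP; apply: measurableT_comp => //.
by apply: measurable_dot; [exact: measurable_plane_sub|exact: measurable_cst].
Qed.

End mean.

End disc.

(** * Comparison of mean distances *)

Section comparison.
Context {R : realType}.
Variables (K : set (plane R)) (hK : convex_body K).
Variables (d : measure_display) (T : measurableType d) (P : probability T R).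
Variables (X1 X2 : T -> plane R).
Hypotheses (hX1 : area_law K P X1) (hX2 : area_law K P X2).
Hypothesis (iX : independent_maps P X1 X2).
Variables (d' : measure_display) (T' : measurableType d') (P' : probability T' R).
Variables (B1 B2 : T' -> plane R).
Hypotheses (hB1 : boundary_law K P' B1) (hB2 : boundary_law K P' B2).
Hypothesis (iB : independent_maps P' B1 B2).

(** A rotation takes the direction of [y] to the first axis. *)
Lemma projection_le (y : plane R) :
  (\int[P]_w `|dot (X1 w - X2 w) y|%:E <= \int[P']_w `|dot (B1 w - B2 w) y|%:E)%E.
Proof.
have n2 : eucl_norm y ^+ 2 = y.1 ^+ 2 + y.2 ^+ 2.
  by rewrite /eucl_norm sqr_sqrtr// addr_ge0 ?sqr_ge0.
have n0 : 0 <= eucl_norm y by exact: sqrtr_ge0.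
have [r0|r0] := eqVneq (eucl_norm y) 0.
  move: n2; rewrite r0 expr0n/= => /esym/eqP.
  rewrite paddr_eq0 ?sqr_ge0// !sqrf_eq0 => /andP[/eqP y1 /eqP y2].
  rewrite integral0_eq ?integral_ge0// => w _.
  by rewrite /dot y1 y2 !mulr0 addr0 normr0.
set r := eucl_norm y in n2 n0 r0; pose c := y.1 / r; pose s := - (y.2 / r).
have yc : y.1 = c * r by rewrite /c divfK.
have ys : y.2 = - s * r by rewrite /s opprK divfK.
have cs : c ^+ 2 + s ^+ 2 = 1.
  apply: (mulIf (expf_neq0 2 r0)).
  by rewrite mul1r [RHS]n2 yc ys; ring.
have reduce e (S : measurableType e) (Q : probability S R) (Y1 Y2 : S -> plane R) :
    measurable_fun setT Y1 -> measurable_fun setT Y2 ->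
    (\int[Q]_w `|dot (Y1 w - Y2 w) y|%:E =
     r%:E * \int[Q]_w `|(rotation c s (Y1 w)).1 - (rotation c s (Y2 w)).1|%:E)%E.
  move=> mY1 mY2.
  have mrot (Y : S -> plane R) : measurable_fun setT Y ->
      measurable_fun setT (fun w => (rotation c s (Y w)).1 : R).
    move=> mY; apply: (@measurableT_comp _ _ _ _ _ _ fst); first exact: measurable_fst.
    by apply: measurableT_comp mY; exact: measurable_lin.
  rewrite -ge0_integralZl_EFin//; last first.
    apply/measurable_EFinP; apply: measurableT_comp => //.
    by apply: measurable_funB; exact: mrot.
  apply: eq_integral => w _; rewrite -EFinM -[in RHS](ger0_norm n0) -normrM.
  by congr (`|_|%:E); rewrite /dot /rotation /lin /= yc ys; ring.
rewrite !reduce; try by [case: hX1|case: hX2|case: hB1|case: hB2].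
apply: lee_wpmul2l; first by rewrite lee_fin.
have o := orthogonal_rotation cs.
have hK' := convex_body_lin (orthogonal_tr o) hK.
have [m [M [g' [h gK']]]] := convex_body_graphs hK'.
apply: (abscissa_le hK' gK').
- exact: area_law_rotation.
- exact: area_law_rotation.
- exact: independent_maps_lin.
- exact: (boundary_law_lin o hK hB1).
- exact: (boundary_law_lin o hK hB2).
- exact: independent_maps_lin.
Qed.

Lemma mean_eucl_dist_le :
  (\int[P]_w (eucl_dist (X1 w) (X2 w))%:E <= \int[P']_w (eucl_dist (B1 w) (B2 w))%:E)%E.
Proof.
have [mX1 _] := hX1; have [mX2 _] := hX2; have [mB1 _] := hB1; have [mB2 _] := hB2.
rewrite -(lee_pmul2r (@disc_width_fin_num R) disc_width_gt0) !mean_eucl_dist//.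
have mproj e (S : measurableType e) (Q : probability S R) (Y1 Y2 : S -> plane R) :
    measurable_fun setT Y1 -> measurable_fun setT Y2 ->
    measurable_fun setT (fun y : plane R =>
      ((\1_disc y)%:E * \int[Q]_w `|dot (Y1 w - Y2 w) y|%:E)%E).
  move=> mY1 mY2; apply: emeasurable_funM.
    by apply/measurable_EFinP; apply: measurable_indic; exact: measurable_disc.
  pose G (u : S * (measurableTypeR R * measurableTypeR R)) : \bar R :=
    (`|dot (Y1 u.1 - Y2 u.1) u.2|)%:E.
  have mG : measurable_fun setT G.
    apply/measurable_EFinP; apply: measurableT_comp => //.
    apply: measurable_dot; last exact: measurable_snd.
    by apply: (measurableT_comp (measurable_plane_sub mY1 mY2)); exact: measurable_fst.
  exact: (@measurable_fun_fubini_tonelli_G _ _ _ _ R Q G mG (fun u => ltac:(by rewrite lee_fin))).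
apply: ge0_le_integral => //.
- by move=> y _; apply: mule_ge0; [rewrite lee_fin|exact: integral_ge0].
- exact: mproj.
- exact: mproj.
- move=> y _; apply: lee_wpmul2l; first by rewrite lee_fin.
  exact: projection_le.
Qed.

End comparison.

Unset Implicit Arguments.

Theorem corollary3p2 (R : realType) (K : set (plane R)) (hK : convex_body K)
    (d : measure_display) (T : measurableType d) (P : probability T R)
    (X1 X2 : {RV P >-> plane R})
    (hX : independent_RV X1 X2)
    (hX1 : uniform_on (@area R) K X1) (hX2 : uniform_on (@area R) K X2)
    (d' : measure_display) (T' : measurableType d') (P' : probability T' R)
    (B1 B2 : {RV P' >-> plane R})
    (hB : independent_RV B1 B2)
    (hB1 : uniform_on (@arclength R) (boundary K) B1)
    (hB2 : uniform_on (@arclength R) (boundary K) B2) :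
  ('E_P[fun w => eucl_dist (X1 w) (X2 w)] <=
   'E_P'[fun w => eucl_dist (B1 w) (B2 w)])%E.
Proof.
have law d0 (T0 : measurableType d0) (P0 : probability T0 R)
    (X : {RV P0 >-> plane R}) : measurable_fun setT X by exact: measurable_funPT.
rewrite unlock; apply: (mean_eucl_dist_le hK).
- by split; [exact: law|exact: hX1].
- by split; [exact: law|exact: hX2].
- exact: hX.
- by split; [exact: law|exact: hB1].
- by split; [exact: law|exact: hB2].
- exact: hB.
Qed.
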